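(* Consider the Rescaled Pólya urn with $k\ge 2$ colors and parameters $\alpha>0$ and $\beta\in[0,1)$. Assume $p_{0,i}>0$ for all $i=1,\dots,k$. Define $$\gamma=\beta+(1-\beta)\frac{\alpha}{(1-\beta)\sum_{i=1}^k b_{0,i}+\alpha},\qquad \lambda=\frac{(1-\beta)^2}{(\gamma-\beta)^2+(1-\gamma^2)}\Big(1+2\frac{\gamma}{1-\gamma}\Big).$$ Then $\gamma\in(\beta,1)$ and $\lambda>1$. Moreover, setting $O_i=\sum_{n=1}^N\xi_{n,i}$ for $i=1,\dots,k$, as $N\to\infty$ one has $O_i/N\to p_{0,i}$ almost surely for every $i$, and $$\sum_{i=1}^k\frac{(O_i-Np_{0,i})^2}{Np_{0,i}}\ \xrightarrow{\ d\ }\ W_*=\lambda W_0,$$ where $W_0$ has distribution $\chi^2(k-1)=\Gamma\big(\tfrac{k-1}{2},\tfrac12\big)$ and, consequently, $W_*$ has distribution $\Gamma\big(\tfrac{k-1}{2},\tfrac{1}{2\lambda}\big)$.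
   Context: For $x\in\mathbb{R}^k$, $|x|=\sum_{i=1}^k|x_i|$; $e_1,\dots,e_k$ is the canonical basis of $\mathbb{R}^k$. Rescaled Pólya (RP) urn with $k$ colors and parameters $\alpha,\beta$: let $\boldsymbol{b}_0=(b_{0,1},\dots,b_{0,k})^\top$ and $\boldsymbol{B}_0=(B_{0,1},\dots,B_{0,k})^\top$ be deterministic vectors with nonnegative real entries such that $|\boldsymbol{b}_0|>0$ and $b_{0,i}+B_{0,i}>0$ for every $i$. The draws $\boldsymbol{\xi}_n=(\xi_{n,1},\dots,\xi_{n,k})^\top$, $n\ge1$, are random vectors with values in $\{e_1,\dots,e_k\}$ ($\xi_{n,i}=1$ iff the ball drawn at time $n$ has color $i$). Set $\boldsymbol{B}_{n}=\beta\boldsymbol{B}_{n-1}+\alpha\boldsymbol{\xi}_{n}$ for $n\ge1$, and $\boldsymbol{N}_n=\boldsymbol{b}_0+\boldsymbol{B}_n$ for $n\ge0$. With $\mathcal{F}_0$ trivial and $\mathcal{F}_n=\sigma(\boldsymbol{\xi}_1,\dots,\boldsymbol{\xi}_n)$, the law of the draws is determined by $$P(\xi_{n+1,i}=1\mid\mathcal{F}_n)=\psi_{n,i},\qquad \boldsymbol{\psi}_n=\frac{\boldsymbol{N}_n}{|\boldsymbol{N}_n|}=\frac{\boldsymbol{b}_0+\boldsymbol{B}_n}{|\boldsymbol{b}_0|+|\boldsymbol{B}_n|},\qquad n\ge0.$$ Set $\boldsymbol{p}_0=\boldsymbol{b}_0/|\boldsymbol{b}_0|$, with components $p_{0,i}$.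 $\Gamma(a,b)$ denotes the Gamma distribution with density $\frac{b^a}{\Gamma(a)}w^{a-1}e^{-bw}$ on $w>0$; $\chi^2(k-1)$ is the chi-squared distribution with $k-1$ degrees of freedom; $\xrightarrow{d}$ is convergence in distribution. *)

(* Defs.v *)
From HB Require Import structures.
From mathcomp Require Import all_boot all_order all_algebra.
From mathcomp Require Import all_classical all_reals all_analysis.
From mathcomp Require Import measurable_realfun.

Set Implicit Arguments.
Unset Strict Implicit.
Unset Printing Implicit Defensive.

Import Order.TTheory GRing.Theory Num.Theory.
Import numFieldNormedType.Exports.

Local Open Scope classical_set_scope.
Local Open Scope ring_scope.

Section probability_notions.
Context {R : realType}.

(* [f] is a version of the conditional probability of the event [A] given the
   sub-sigma-algebra [F]. *)
Definition is_cond_prob d (T : measurableType d) (P : probability T R)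
    (F : set (set T)) (A : set T) (f : T -> R) : Prop :=
  [/\ forall Y : set R, measurable Y -> F (f @^-1` Y),
      P.-integrable setT (EFin \o f) &
      forall B, F B -> (\int[P]_(t in B) (f t)%:E = P (A `&` B))%E].

Definition has_law d (T : measurableType d) (P : probability T R)
    (X : T -> R) (mu : set R -> \bar R) : Prop :=
  measurable_fun setT X /\
  forall A : set R, measurable A -> P (X @^-1` A) = mu A.

(* Weak convergence: E[f(X_n)] --> E[f(Y)] for every bounded continuous f.
   The limit [Y] may live on another probability space. *)
Definition cvg_in_distribution d (T : measurableType d) (P : probability T R)
    (X : nat -> T -> R) d' (T' : measurableType d') (P' : probability T' R)
    (Y : T' -> R) : Prop :=
  forall f : R -> R, continuous f -> (exists M : R, forall x, `|f x| <= M) ->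
    ('E_P[f \o X n] @[n --> \oo] --> 'E_P'[f \o Y])%E.

Definition Gamma_fun (a : R) : R :=
  \int[@lebesgue_measure R]_(x in `]0, +oo[) (x `^ (a - 1) * expR (- x)).

(* [b] is the rate parameter *)
Definition gamma_pdf (a b w : R) : R :=
  if 0 < w then b `^ a / Gamma_fun a * w `^ (a - 1) * expR (- (b * w)) else 0.

Definition gamma_law (a b : R) (A : set R) : \bar R :=
  (\int[lebesgue_measure]_(w in A) (gamma_pdf a b w)%:E)%E.

(* [measurableTypeR R] is [R] with its Borel sets, under the display used by
   [normal_prob]. *)
Definition add_sqr (z : R * measurableTypeR R) : R := z.1 + (z.2 : R) ^+ 2.

Lemma measurable_add_sqr : measurable_fun setT add_sqr.
Proof.
apply: (@measurable_funD _ _ R); first exact: measurable_fst.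
apply: (@measurable_funX _ _ R); exact: measurable_snd.
Qed.

HB.instance Definition _ :=
  isMeasurableFun.Build _ _ _ _ add_sqr measurable_add_sqr.

(* The law of Z_1^2 + ... + Z_m^2 for independent standard normal Z_i: by
   independence, (Z_1^2 + ... + Z_m^2, Z_(m+1)) has as law the product of the
   laws of its two components. *)
Fixpoint chi2_law (m : nat) : probability R R :=
  if m is m'.+1 then
    distribution (chi2_law m' \x normal_prob (0 : R) 1)%E
      (add_sqr : {mfun _ >-> _})
  else \d_(0 : R).

End probability_notions.

Section rescaled_polya_urn.
Context {R : realType} {k : nat}.

(* the l^1 norm (the library norm on matrices is the sup norm) *)
Definition norm1 (x : 'cV[R]_k) : R := \sum_(i < k) `|x i 0|.

Section dynamics.
Context {T : Type}.
Variables (alpha beta : R) (b0 B0 : 'cV[R]_k) (xi : nat -> T -> 'cV[R]_k).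

(* The draw at time n >= 1 is [xi n]; [xi 0] is never used. *)

Fixpoint rp_B (n : nat) (t : T) : 'cV[R]_k :=
  if n is m.+1 then beta *: rp_B m t + alpha *: xi n t else B0.

Definition rp_N (n : nat) (t : T) : 'cV[R]_k := b0 + rp_B n t.

Definition rp_psi (n : nat) (t : T) : 'cV[R]_k :=
  (norm1 (rp_N n t))^-1 *: rp_N n t.

Definition rp_filtration (n : nat) : set (set T) :=
  <<s [set A | exists m i Y, [/\ (1 <= m <= n)%N, measurable (Y : set R) &
                              A = (fun t => xi m t i 0) @^-1` Y]] >>.

Definition rp_count (N : nat) (i : 'I_k) (t : T) : R :=
  \sum_(1 <= n < N.+1) xi n t i 0.

End dynamics.

Record rescaled_polya_urn d (T : measurableType d) (P : probability T R)
    (alpha beta : R) (b0 B0 : 'cV[R]_k) (xi : nat -> T -> 'cV[R]_k) : Prop := {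
  rp_b0_ge0 : forall i, 0 <= b0 i 0;
  rp_B0_ge0 : forall i, 0 <= B0 i 0;
  rp_b0_gt0 : 0 < norm1 b0;
  rp_b0B0_gt0 : forall i, 0 < b0 i 0 + B0 i 0;
  rp_draw_measurable : forall n i, (1 <= n)%N ->
    measurable_fun setT (fun t => xi n t i 0);
  rp_draw_basis : forall n t, (1 <= n)%N -> exists j, xi n t = delta_mx j 0;
  rp_draw_law : forall n i,
    is_cond_prob P (rp_filtration xi n) [set t | xi n.+1 t i 0 = 1]
      (fun t => rp_psi alpha beta b0 B0 xi n t i 0)
}.

Definition rp_p0 (b0 : 'cV[R]_k) : 'cV[R]_k := (norm1 b0)^-1 *: b0.

Definition rp_gamma (alpha beta : R) (b0 : 'cV[R]_k) : R :=
  beta + (1 - beta) * (alpha / ((1 - beta) * \sum_(i < k) b0 i 0 + alpha)).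

Definition rp_lambda (beta gamma : R) : R :=
  (1 - beta) ^+ 2 / ((gamma - beta) ^+ 2 + (1 - gamma ^+ 2))
  * (1 + 2 * (gamma / (1 - gamma))).

Definition rp_chi2_stat T (b0 : 'cV[R]_k) (xi : nat -> T -> 'cV[R]_k)
    (N : nat) (t : T) : R :=
  \sum_(i < k) (rp_count xi N i t - N%:R * rp_p0 b0 i 0) ^+ 2
               / (N%:R * rp_p0 b0 i 0).

End rescaled_polya_urn.

(* Main.v *)
Require Import Defs.
From HB Require Import structures.
From mathcomp Require Import all_boot all_order all_algebra.
From mathcomp Require Import all_classical all_reals all_analysis.
From mathcomp Require Import measurable_realfun ring lra.

(** The statistic is a quadratic function of the centred counts of the colours, so the
    point is a central limit theorem for these counts, although the draws are neither
    independent nor stationary.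

    Write [psi] for the drawing probabilities, and [M] for the martingale whose
    increments are those of the counts minus [psi]. The deviation of the content
    of the urn from its proportional share satisfies a linear recursion, and [psi - p0]
    is that deviation divided by the total mass, which converges geometrically.
    Adding a multiple of the deviation, which is bounded, turns the centred counts
    into [(1 - beta) / (1 - gamma) * M], up to a bounded error
    ([UrnPath.centred_mart_close]). As [M] has bounded increments, its fourth
    moment is at most of order [N ^+ 2]; hence the fourth moments of the centred
    frequencies are summable, and the frequencies converge almost surely
    ([rp_count_ae_cvg]).

    The conditional covariance of an increment of [M] is not constant, since [psi]
    does not converge. But [psi - p0] is nearly an autoregressive process with
    contraction factor [gamma], and the fluctuating part of the covariance, which is a
    quadratic polynomial in [psi - p0], is the average increment of another such
    polynomial, the corrector ([UrnPath.corrector_eq]). Therefore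
    the covariance averages to a multiple of [diag p0 - p0 p0^T]. With the factor
    [(1 - beta) / (1 - gamma)], and after division of the coordinates by the square
    roots of those of [p0], it becomes [lambda] times a projection of rank [k - 1],
    which explains the chi-squared law, its number of degrees of freedom and
    the factor [lambda].

    The limit is identified through Laplace transforms. All the expectations that
    matter are averages over finite words of draws ([path_exp], [word_integral]). The
    Laplace transform of the squared norm of the normalized martingale is compared,
    one draw after the other, with the explicit Gaussian expectation in which the
    remaining increments are replaced by Gaussian ones
    ([MartingaleCLT.path_exp_laplace_cvg]). The convergence of Laplace transforms
    implies convergence in distribution for nonnegative variables, because a damped
    continuous function is uniformly approximated by combinations of exponentials
    ([laplace_cvg_in_distribution]); applied to constant sequences, the same result
    shows that a law on the half-line is determined by its Laplace transform
    ([laplace_unique]). The latter identifies the chi-squared laws and their multiples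
    with Gamma laws, as both transforms are powers of [1 + c * s]. *)

Set Implicit Arguments.
Unset Strict Implicit.
Unset Printing Implicit Defensive.

Import Order.TTheory GRing.Theory Num.Theory.
Import numFieldNormedType.Exports.

Local Open Scope classical_set_scope.
Local Open Scope ring_scope.

(** * Expectation along random words *)

Section path_expectation.
Context {R : realType} {J : finType}.
Variable q : seq J -> J -> R.

(** The expectation of [f] over a word of [n] successive draws, where [q w j] is
    the conditional probability to draw [j] after the draws in [w]. The most recent
    draw is the head of the word, so that an increment given the past relates
    [j :: w] to [w]. *)
Fixpoint path_exp (n : nat) (f : seq J -> R) : R :=
  if n is m.+1 then path_exp m (fun w => \sum_j q w j * f (j :: w))
  else f [::].

Hypothesis q_ge0 : forall w j, 0 <= q w j.
Hypothesis q_sum1 : forall w, \sum_j q w j = 1.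

Lemma eq_path_exp n f g :
  (forall w, size w = n -> f w = g w) -> path_exp n f = path_exp n g.
Proof.
elim: n f g => [|n IH] f g fg /=; first exact: fg.
by apply: IH => w wn; apply: eq_bigr => j _; rewrite fg//= wn.
Qed.

Lemma path_expD n f g :
  path_exp n (fun w => f w + g w) = path_exp n f + path_exp n g.
Proof.
elim: n f g => [//|n IH] f g /=; rewrite -IH; apply: eq_path_exp => w _.
by rewrite -big_split/=; apply: eq_bigr => j _; rewrite mulrDr.
Qed.

Lemma path_expZ n c f : path_exp n (fun w => c * f w) = c * path_exp n f.
Proof.
elim: n f => [//|n IH] f /=; rewrite -IH; apply: eq_path_exp => w _.
by rewrite mulr_sumr; apply: eq_bigr => j _; rewrite mulrCA.
Qed.

Lemma path_expB n f g :
  path_exp n (fun w => f w - g w) = path_exp n f - path_exp n g.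
Proof.
rewrite path_expD; congr (_ + _).
by rewrite -mulN1r -path_expZ; apply: eq_path_exp => w _; rewrite mulN1r.
Qed.

Lemma path_exp_cst n c : path_exp n (fun=> c) = c.
Proof.
elim: n => [//|n IH] /=; rewrite -[RHS]IH; apply: eq_path_exp => w _.
by rewrite -mulr_suml q_sum1 mul1r.
Qed.

Lemma le_path_exp n f g :
  (forall w, size w = n -> f w <= g w) -> path_exp n f <= path_exp n g.
Proof.
elim: n f g => [|n IH] f g fg /=; first exact: fg.
apply: IH => w wn; apply: ler_sum => j _.
by apply: ler_wpM2l => //; apply: fg; rewrite /= wn.
Qed.

Lemma path_exp_le_cst n f c :
  (forall w, size w = n -> f w <= c) -> path_exp n f <= c.
Proof. by move=> fc; rewrite -[leRHS](path_exp_cst n); exact: le_path_exp. Qed.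

Lemma norm_path_exp_le n f c :
  (forall w, size w = n -> `|f w| <= c) -> `|path_exp n f| <= c.
Proof.
move=> fc.
have h w : size w = n -> - c <= f w <= c by move=> /fc; rewrite ler_norml.
rewrite ler_norml; apply/andP; split; last first.
  by apply: path_exp_le_cst => w /h/andP[].
rewrite -[leLHS](path_exp_cst n); apply: le_path_exp => w /h/andP[].
done.
Qed.

(** The one-step increments of a functional telescope, so an estimate of each of
    them given the past bounds the change of the expectation over [n] steps. *)
Lemma path_exp_telescope n (u : nat -> seq J -> R) (c : nat -> R) :
  (forall i w, (i < n)%N -> size w = i ->
    `|\sum_j q w j * u i.+1 (j :: w) - u i w| <= c i) ->
  `|path_exp n (u n) - u 0%N [::]| <= \sum_(i < n) c i.
Proof.
elim: n => [|n IH] uc; first by rewrite /= subrr normr0 big_ord0.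
rewrite big_ord_recr/= -(subrK (path_exp n (u n)) (path_exp n _)) -addrA.
rewrite addrC; apply: (le_trans (ler_normD _ _)); apply: lerD.
  by apply: IH => i w lin wi; apply: uc => //; exact: ltnW.
by rewrite -path_expB; apply: norm_path_exp_le => w wn; exact: uc.
Qed.

End path_expectation.

(** * Uniform polynomial bounds *)

(** A family [f], indexed by [z] in a domain [D], is of order [eps ^+ a] up to a
    polynomial factor in the size [t] of the state. *)
Section poly_bound.
Context {R : realType} {Z : Type}.
Variables (D : Z -> Prop) (eps t : Z -> R).

Definition poly_bound (a b : nat) (f : Z -> R) :=
  exists2 C, 0 <= C & forall z, D z -> `|f z| <= C * (eps z ^+ a * t z ^+ b).

Hypothesis eps01 : forall z, D z -> 0 <= eps z <= 1.
Hypothesis t_ge1 : forall z, D z -> 1 <= t z.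

Lemma poly_boundE a b f g : (forall z, D z -> f z = g z) ->
  poly_bound a b g -> poly_bound a b f.
Proof. by move=> fg [C C0 gC]; exists C => // z Dz; rewrite fg//; exact: gC. Qed.

Lemma poly_bound_weak a b a' b' f : (a' <= a)%N -> (b <= b')%N ->
  poly_bound a b f -> poly_bound a' b' f.
Proof.
move=> aa bb [C C0 fC]; exists C => // z Dz; apply: (le_trans (fC z Dz)).
have /andP[e0 e1] := eps01 Dz; have t1 := t_ge1 Dz.
apply: ler_wpM2l => //; apply: ler_pM => //.
- exact: exprn_ge0.
- by apply: exprn_ge0; exact: le_trans t1.
- exact: ler_wiXn2l.
- exact: ler_weXn2l.
Qed.

Lemma poly_bound_cst c : poly_bound 0 0 (fun=> c).
Proof. by exists `|c| => // z _; rewrite !expr0 !mulr1. Qed.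

Lemma poly_bound_bounded C f : (forall z, D z -> `|f z| <= C) ->
  poly_bound 0 0 f.
Proof.
move=> fC; exists `|C| => // z Dz; rewrite !expr0 !mulr1.
exact: (le_trans (fC _ Dz) (ler_norm _)).
Qed.

Lemma poly_boundD a b f g : poly_bound a b f -> poly_bound a b g ->
  poly_bound a b (fun z => f z + g z).
Proof.
move=> [C C0 fC] [C' C'0 gC]; exists (C + C'); first exact: addr_ge0.
move=> z Dz; rewrite mulrDl; apply: (le_trans (ler_normD _ _)).
by apply: lerD; [exact: fC|exact: gC].
Qed.

Lemma poly_boundN a b f : poly_bound a b f -> poly_bound a b (fun z => - f z).
Proof. by move=> [C C0 fC]; exists C => // z Dz; rewrite normrN; exact: fC. Qed.

Lemma poly_boundB a b f g : poly_bound a b f -> poly_bound a b g ->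
  poly_bound a b (fun z => f z - g z).
Proof. by move=> ? /poly_boundN; exact: poly_boundD. Qed.

Lemma poly_boundM a b a' b' f g : poly_bound a b f -> poly_bound a' b' g ->
  poly_bound (a + a') (b + b') (fun z => f z * g z).
Proof.
move=> [C C0 fC] [C' C'0 gC]; exists (C * C'); first exact: mulr_ge0.
move=> z Dz; rewrite normrM !exprD.
apply: (le_trans (ler_pM (normr_ge0 _) (normr_ge0 _) (fC z Dz) (gC z Dz))).
by rewrite le_eqVlt; apply/orP; left; apply/eqP; ring.
Qed.

Lemma poly_boundX a b f n : poly_bound a b f ->
  poly_bound (a * n) (b * n) (fun z => f z ^+ n).
Proof.
move=> fO; elim: n => [|n IH]; first by rewrite !muln0; exact: poly_bound_cst.
by rewrite !mulnS; apply: (poly_boundE (fun z _ => exprS _ _)); exact: poly_boundM.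
Qed.

Lemma poly_bound_sum (I : finType) a b (f : I -> Z -> R) :
  (forall i, poly_bound a b (f i)) ->
  poly_bound a b (fun z => \sum_i f i z).
Proof.
move=> fO.
have /choice[C CP] i : exists C, 0 <= C /\
    forall z, D z -> `|f i z| <= C * (eps z ^+ a * t z ^+ b).
  by have [C C0 fC] := fO i; exists C.
exists (\sum_i C i); first by apply: sumr_ge0 => i _; exact: (CP i).1.
move=> z Dz; rewrite mulr_suml; apply: (le_trans (ler_norm_sum _ _ _)).
by apply: ler_sum => i _; exact: (CP i).2.
Qed.

End poly_bound.

(** * Elementary inequalities *)

Section elementary.
Context {R : realType}.
Implicit Types x v : R.

(** Both signs of [x] are allowed, since this is to be iterated at the intermediate
    points. *)
Lemma mean_value_at0 (f df : R -> R) x : f 0 = 0 ->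
  (forall y, is_derive y (1 : R) f (df y)) ->
  exists c, f x = df c * x /\ ((0 <= c <= x) \/ (x <= c <= 0)).
Proof.
move=> f0 fdf.
have cf (a b : R) : {within `[a, b]%classic, continuous f}.
  apply: continuous_subspaceT => y; apply: differentiable_continuous.
  by apply/derivable1_diffP; exact: ex_derive.
have [x0|x0] := leP 0 x.
  have [c cx E] := MVT_segment x0 (fun y _ => fdf y) (cf _ _).
  exists c; split; first by move: E; rewrite f0 !subr0.
  by left; move: cx; rewrite in_itv.
have [c cx E] := MVT_segment (ltW x0) (fun y _ => fdf y) (cf _ _).
exists c; split; last by right; move: cx; rewrite in_itv.
by apply/oppr_inj; rewrite -mulrN -[RHS]add0r; move: E; rewrite f0 !sub0r add0r.
Qed.

(** Iterating the mean value theorem at [0] replaces Taylor's formula: the three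
    successive differences are products of [x], and of points between [0] and
    [x], with a value of the exponential. *)
Lemma expR_taylor2 x : `|expR x - 1 - x - x ^+ 2 / 2| <= `|x| ^+ 3 * (1 + expR x).
Proof.
have D0 (y : R) : is_derive y (1 : R) (fun z : R => expR z - 1) (expR y).
  by apply: is_derive_eq; rewrite subr0 ?scaler1 ?mulr1.
have D1 (y : R) : is_derive y (1 : R) (fun z : R => expR z - 1 - z) (expR y - 1).
  by apply: is_derive_eq.
have D2 (y : R) : is_derive y (1 : R) (fun z : R => expR z - 1 - z - z ^+ 2 / 2)
    (expR y - 1 - y).
  apply: is_derive_eq; rewrite /GRing.scale/=.
  by field.
have [|c [-> cx]] := mean_value_at0 x _ D2; first by rewrite expR0; ring.
have [|c' [-> cc']] := mean_value_at0 c _ D1; first by rewrite expR0; ring.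
have [|c'' [-> cc'']] := mean_value_at0 c' _ D0; first by rewrite expR0; ring.
have ax (y z : R) : (0 <= z <= y) \/ (y <= z <= 0) -> `|z| <= `|y|.
  case=> /andP[? ?]; first by rewrite !ger0_norm//; lra.
  by rewrite !ler0_norm//; lra.
have h1 := ax _ _ cx; have h2 := ax _ _ cc'.
have ec : expR c'' <= 1 + expR x.
  have [y0|y0] := leP c'' 0.
    by have := expR_gt0 x; move: y0; rewrite -expR_le1; lra.
  have : expR c'' <= expR x by rewrite ler_expR; lra.
  lra.
rewrite !normrM (ger0_norm (expR_ge0 _)).
have -> : `|x| ^+ 3 * (1 + expR x) = (1 + expR x) * `|x| * `|x| * `|x| by ring.
do 3!rewrite ler_pM ?mulr_ge0 ?expR_ge0//.
exact: le_trans h2 h1.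
Qed.

Lemma ln1D_taylor1 v : 0 <= v -> `|ln (1 + v) - v| <= v ^+ 2.
Proof.
move=> v0; have le1 : ln (1 + v) <= v by apply: le_ln1Dx; lra.
rewrite ler0_norm ?subr_le0// opprB lerBlDr.
have /le_ln1Dx : - 1 < - (v / (1 + v)).
  by rewrite ltrN2 ltr_pdivrMr; lra.
rewrite (_ : 1 + - _ = (1 + v)^-1); last by field; lra.
rewrite lnV ?posrE; last lra.
rewrite lerN2 => h; apply: (@le_trans _ _ (v ^+ 2 + v / (1 + v))); last by rewrite lerD2l.
rewrite -subr_ge0 (_ : _ - _ = v ^+ 3 / (1 + v)); last by field; lra.
by apply: divr_ge0; [exact: exprn_ge0|lra].
Qed.

(** The exponent [b] is absorbed by writing the exponential as a power [b] of
    another one, which dominates a multiple of [1 + x] by convexity. *)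
Lemma expRN_poly_bounded (c : R) (b : nat) : 0 < c ->
  exists2 C, 0 <= C & forall x, 0 <= x -> expR (- (c * x)) * (1 + x) ^+ b <= C.
Proof.
move=> c0; case: b => [|b].
  by exists 1 => // x x0; rewrite expr0 mulr1 expR_le1 oppr_le0 mulr_ge0// ltW.
pose k : R := Num.min 1 (c / b.+1%:R).
have k0 : 0 < k by rewrite lt_min ltr01/= divr_gt0.
exists (k ^- b.+1); first by rewrite invr_ge0 exprn_ge0// ltW.
move=> x x0; rewrite expRN mulrC ler_pdivrMr ?expR_gt0//.
rewrite mulrC ler_pdivlMr ?exprn_gt0// -exprMn.
have -> : c * x = b.+1%:R * (c / b.+1%:R * x) by field; rewrite nat1r pnatr_eq0.
rewrite expRM_natl ler_pXn2r ?nnegrE ?expR_ge0//; last first.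
  by rewrite mulr_ge0 ?(ltW k0)//; lra.
apply: le_trans (expR_ge1Dx _); rewrite mulrDl mul1r lerD ?ge_min ?lexx//.
by rewrite mulrC ler_wpM2r// ge_min lexx orbT.
Qed.

Lemma norm_mul_le_sqr (x y c : R) : x ^+ 2 <= c -> y ^+ 2 <= c -> `|x * y| <= c.
Proof.
move=> xc yc; have xcn : `|x| ^+ 2 <= c by rewrite real_normK ?num_real.
have ycn : `|y| ^+ 2 <= c by rewrite real_normK ?num_real.
rewrite normrM; have := sqr_ge0 (`|x| - `|y|); rewrite sqrrB => h.
by rewrite -(ler_pM2l (ltr0n R 2)) [2 * c]mulr_natl mulr_natl; lra.
Qed.

Lemma norm_le_1Dsqr (x : R) : `|x| <= 1 + x ^+ 2.
Proof.
rewrite -(real_normK (num_real x)); have := sqr_ge0 (`|x| - 1).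
by rewrite sqrrB mulr1 expr1n => h; have := normr_ge0 x; lra.
Qed.

Lemma normB_expR (x y : R) : `|expR x - expR y| <= `|x - y| * (expR x + expR y).
Proof.
wlog yx : x y / y <= x.
  move=> H; have [/H//|/ltW/H] := leP y x.
  by rewrite distrC (distrC y) (addrC (expR y)).
rewrite !ger0_norm ?subr_ge0 ?ler_expR//.
have h : expR x * (1 + (y - x)) <= expR y.
  have -> : expR y = expR x * expR (y - x) by rewrite -expRD addrC subrK.
  by rewrite ler_wpM2l ?expR_ge0 ?expR_ge1Dx.
have := mulr_ge0 (expR_ge0 y) (_ : 0 <= x - y); rewrite subr_ge0 => /(_ yx).
by move: h; rewrite mulrDr; lra.
Qed.

(** If [p] and [r] are the two sums of squares, [r - p] is of order [d * (1 + p)],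
    and the factor [1 + p] is compensated by [expR (- p)]: the estimate is uniform
    in [x] and [y]. *)
Lemma expRN_sumsq_close (I : finType) (x y : I -> R) (d : R) :
  0 <= d <= 1 -> (forall a, `|x a - y a| <= d) ->
  `|expR (- \sum_a x a ^+ 2) - expR (- \sum_a y a ^+ 2)|
    <= (3 * #|I|%:R + 2) * d.
Proof.
move=> /andP[d0 d1]; wlog xy : x y / \sum_a x a ^+ 2 <= \sum_a y a ^+ 2.
  move=> H xyd; have [h|/ltW h] := leP (\sum_a x a ^+ 2) (\sum_a y a ^+ 2).
    exact: H.
  by rewrite distrC; apply: H => // a; rewrite distrC.
move=> xyd; set p := \sum_a x a ^+ 2; set r := \sum_a y a ^+ 2.
rewrite ger0_norm; last by rewrite subr_ge0 ler_expR lerN2.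
have p0 : 0 <= p by apply: sumr_ge0 => a _; rewrite sqr_ge0.
have rp : r - p <= (3 * #|I|%:R + 2) * d * (1 + p).
  apply: (@le_trans _ _ (\sum_(a in I) d * (3 + 2 * x a ^+ 2))).
    rewrite -sumrB; apply: ler_sum => a _.
    have -> : y a ^+ 2 - x a ^+ 2 = (y a - x a) * (2 * x a + (y a - x a)) by ring.
    apply: (le_trans (ler_norm _)); rewrite normrM.
    have yxd : `|y a - x a| <= d by rewrite distrC.
    apply: ler_pM => //; apply: (le_trans (ler_normD _ _)).
    by rewrite normrM ger0_norm//; have := norm_le_1Dsqr (x a); lra.
  rewrite -mulr_sumr big_split/= -mulr_sumr sumr_const -/p -[3 *+ _]mulr_natr.
  have I0 : 0 <= #|I|%:R :> R by [].
  rewrite -mulrA mulrCA ler_wpM2l//.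
  by have := mulr_ge0 I0 p0; rewrite mulrDl !mulrDr; lra.
have C0 : 0 <= (3 * #|I|%:R + 2) * d by rewrite mulr_ge0// addr_ge0// mulr_ge0.
apply: (@le_trans _ _ (expR (- p) * (r - p))).
  have -> : expR (- r) = expR (- p) * expR (- (r - p)) by rewrite -expRD; congr expR; ring.
  by rewrite -{1}[expR (- p)]mulr1 -mulrBr ler_wpM2l ?expR_ge0// lerBlDr -lerBlDl expR_ge1Dx.
apply: (le_trans (ler_wpM2l (expR_ge0 _) rp)).
rewrite mulrCA ler_piMr// -[leRHS](expRxMexpNx_1 p) mulrC ler_wpM2r ?expR_ge0//.
exact: expR_ge1Dx.
Qed.

End elementary.

(** * A martingale central limit theorem for the squared norm *)

(** Let [X] be a martingale with bounded increments whose conditional covariance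
    is [lam * Sig], up to the increment of a bounded process [Rc] and to a summable
    error [eta]. The model case is that of a projection [Sig] of rank [m] whose range
    contains the values of [X]: then [X / sqrt N] converges to a Gaussian vector
    with covariance [lam * Sig], and its squared norm to [lam] times a chi-squared
    variable with [m] degrees of freedom. The convergence of the Laplace transforms
    of the squared norms is proved by Lindeberg's method. If [Z] is Gaussian with
    covariance [Sig], and [x] is in the range of [Sig], then the expectation of
    [expR (- `|x + sqrt tau * Z| ^+ 2)] is
    [(1 + 2 * tau) `^ (- (m / 2)) * expR (- `|x| ^+ 2 / (1 + 2 * tau))]. Along the
    rescaled martingale, with [tau] the variance still to come, this quantity is
    almost a martingale. Its value at time [0] is almost the Laplace transform of the
    limit, and at time [N] its expectation is that of [`|X| ^+ 2 / N]. *)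
Module MartingaleCLT.
Section martingale_clt.
Context {R : realType} {J I : finType}.
Variables (q : seq J -> J -> R) (X : seq J -> I -> R).
Variables (Rc : seq J -> I -> I -> R) (Sig : I -> I -> R).
Variables (K lam : R) (m : nat) (eta : nat -> R).

Hypothesis q_ge0 : forall w j, 0 <= q w j.
Hypothesis q_sum1 : forall w, \sum_j q w j = 1.
Hypothesis lam_ge0 : 0 <= lam.
Hypothesis X_step : forall w j a, `|X (j :: w) a - X w a| <= K.
Hypothesis X_mart : forall w a, \sum_j q w j * (X (j :: w) a - X w a) = 0.
Hypothesis Rc_le : forall w a b, `|Rc w a b| <= K.
Hypothesis X_cov : forall w a b,
  `|\sum_j q w j * ((X (j :: w) a - X w a) * (X (j :: w) b - X w b)
                    + Rc (j :: w) a b)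
    - Rc w a b - lam * Sig a b| <= eta (size w).
Hypothesis eta_ge0 : forall n, 0 <= eta n.
Hypothesis eta_sum : forall n, \sum_(i < n) eta i <= K.
Hypothesis Sig_trace : \sum_a Sig a a = m%:R.
Hypothesis Sig_quad : forall w,
  \sum_a \sum_b Sig a b * (X w a * X w b) = \sum_a X w a ^+ 2.

Variable s : R.
Hypothesis s_ge0 : 0 <= s.

(** The scale at which [X] is observed after [N] steps. *)
Definition eps (N : nat) : R := Num.sqrt (s / N%:R).
(** The variance that is left to come after [n] steps out of [N]. *)
Definition tau (N n : nat) : R := lam * eps N ^+ 2 * (N - n)%:R.
Definition amp N n : R := (1 + 2 * tau N n)^-1.
Definition amp0 : R := (1 + 2 * lam * s)^-1.

Definition quad (r : I -> I -> R) (x : I -> R) : R :=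
  \sum_a \sum_b r a b * (x a * x b).

Lemma K_ge0 : 0 <= K.
Proof. by have := eta_sum 0; rewrite big_ord0. Qed.

Lemma eps_ge0 N : 0 <= eps N. Proof. exact: sqrtr_ge0. Qed.

Lemma eps_sqr N : eps N ^+ 2 = s / N%:R.
Proof. by rewrite /eps sqr_sqrtr// divr_ge0. Qed.

Lemma tau_ge0 N n : 0 <= tau N n.
Proof. by rewrite /tau !mulr_ge0 ?sqr_ge0 ?eps_ge0. Qed.

Lemma tau_le N n : tau N n <= lam * s.
Proof.
rewrite /tau eps_sqr -mulrA ler_wpM2l//; case: N => [|N].
  by rewrite sub0n mulr0.
rewrite mulrAC ler_pdivrMr ?ltr0n// ler_wpM2l// ler_nat leq_subr //.
Qed.

Lemma tauS N n : (n < N)%N -> tau N n = tau N n.+1 + lam * eps N ^+ 2.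
Proof.
by move=> nN; rewrite /tau -[(N - n)%N]subSS subSn// -natr1 mulrDr mulr1.
Qed.

Lemma amp_gt0 N n : 0 < amp N n.
Proof. by rewrite /amp invr_gt0; have := tau_ge0 N n; lra. Qed.

Lemma amp_le1 N n : amp N n <= 1.
Proof. by rewrite /amp invf_le1; have := tau_ge0 N n; lra. Qed.

Lemma lams_ge0 : 0 <= lam * s. Proof. exact: mulr_ge0. Qed.

Lemma amp0_gt0 : 0 < amp0.
Proof. by rewrite /amp0 invr_gt0 -mulrA; have := lams_ge0; lra. Qed.

Lemma amp_ge N n : amp0 <= amp N n.
Proof.
have h0 := tau_ge0 N n; have h1 := tau_le N n.
by have := lams_ge0; rewrite /amp0 /amp -mulrA lef_pV2 ?posrE; lra.
Qed.

Lemma quad_le (r : I -> I -> R) (x : I -> R) c : (forall a b, `|r a b| <= c) ->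
  `|quad r x| <= #|I|%:R ^+ 2 * c * \sum_a x a ^+ 2.
Proof.
move=> rc; set Q := \sum_a _.
have xQ a : x a ^+ 2 <= Q.
  by rewrite /Q (bigD1 a)//= lerDl sumr_ge0// => i _; rewrite sqr_ge0.
have xxQ a b : `|x a * x b| <= Q by exact: norm_mul_le_sqr.
apply: (le_trans (ler_norm_sum _ _ _)).
apply: (@le_trans _ _ (\sum_(a in I) \sum_(b in I) c * Q)).
  apply: ler_sum => a _; apply: (le_trans (ler_norm_sum _ _ _)).
  by apply: ler_sum => b _; rewrite normrM ler_pM.
rewrite !sumr_const -!mulrnA -[leLHS]mulr_natl natrM le_eqVlt.
by apply/orP; left; apply/eqP; ring.
Qed.

(** Half the contraction of [r] with the Hessian of [expR (- A * `|x| ^+ 2)], divided by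
    this function. *)
Definition corr A (r : I -> I -> R) (x : I -> R) : R :=
  - A * \sum_a r a a + 2 * A ^+ 2 * quad r x.

(** The logarithm of the function to be followed along the martingale. The first
    two terms are the Gaussian expectation above. The last one applies half of its
    second differential to [Rc], and so compensates for the increment of [Rc] in the
    conditional covariance. *)
Definition logu N n w : R :=
  - (m%:R / 2 * ln (1 + 2 * tau N n))
  - amp N n * \sum_a (eps N * X w a) ^+ 2
  + eps N ^+ 2 * corr (amp N n) (Rc w) (fun a => eps N * X w a).

Definition K2 : R := #|I|%:R + 2 * #|I|%:R ^+ 2.

Lemma K2_ge0 : 0 <= K2.
Proof. by rewrite /K2 addr_ge0 ?mulr_ge0 ?exprn_ge0. Qed.

Lemma corr_le A (r : I -> I -> R) (x : I -> R) c : 0 <= c -> 0 <= A <= 1 ->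
  (forall a b, `|r a b| <= c) ->
  `|corr A r x| <= K2 * c * (1 + \sum_a x a ^+ 2).
Proof.
move=> c0 /andP[A0 A1] rc; set Q := \sum_a x a ^+ 2.
have Q0 : 0 <= Q by apply: sumr_ge0 => a _; rewrite sqr_ge0.
apply: (le_trans (ler_normD _ _)).
have h1 : `|- A * \sum_a r a a| <= #|I|%:R * c.
  have h : `|\sum_a r a a| <= #|I|%:R * c.
    apply: (le_trans (ler_norm_sum _ _ _)).
    apply: (@le_trans _ _ (\sum_(a in I) c)); first exact: ler_sum.
    by rewrite sumr_const -[leLHS]mulr_natl.
  by rewrite normrM normrN (ger0_norm A0) -[leRHS]mul1r ler_pM.
have h2 : `|2 * A ^+ 2 * quad r x| <= 2 * (#|I|%:R ^+ 2 * c * Q).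
  rewrite normrM ler_pM//; last exact: quad_le.
  have A20 := exprn_ge0 2 A0.
  have A21 : A ^+ 2 <= 1 by rewrite expr_le1.
  by rewrite ger0_norm; lra.
have I0 : 0 <= #|I|%:R * c by rewrite mulr_ge0.
have I2 : 0 <= #|I|%:R ^+ 2 * c by rewrite mulr_ge0 ?exprn_ge0.
apply: (le_trans (lerD h1 h2)).
rewrite /K2 -subr_ge0 (_ : _ - _ = #|I|%:R * c * Q + 2 * (#|I|%:R ^+ 2 * c)).
  by rewrite addr_ge0// mulr_ge0.
by ring.
Qed.

(* A transition from the path [sw] to [sj :: sw] among [sN] steps in all. *)
Record step := Step { sN : nat; sn : nat; sw : seq J; sj : J }.

(** The last bound lets half of the quadratic term of [logu] absorb the corrector. *)
Definition small N := eps N <= 1 /\ eps N ^+ 2 * (K2 * K) <= amp0 / 2.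
Definition D z := [/\ (sn z < sN z)%N, size (sw z) = sn z & small (sN z)].
Definition e z := eps (sN z).
Definition sq N w := 1 + \sum_a (eps N * X w a) ^+ 2.
Definition t z := sq (sN z) (sw z).
(** Estimates are uniform in the number of steps and polynomial in the position,
    because the exponential of [logu] compensates for any power of [t]. *)
Definition O := poly_bound D e t.

Lemma e_itv z : D z -> 0 <= e z <= 1.
Proof. by case=> _ _ [h _]; rewrite eps_ge0. Qed.

Lemma sq_ge1 N w : 1 <= sq N w.
Proof. by rewrite /sq lerDl sumr_ge0// => a _; rewrite sqr_ge0. Qed.

Lemma t_ge1 z : D z -> 1 <= t z. Proof. by move=> _; exact: sq_ge1. Qed.

Definition A z := amp (sN z) (sn z).+1.
Definition A' z := amp (sN z) (sn z).
Definition x z a := e z * X (sw z) a.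
Definition y z a := e z * (X (sj z :: sw z) a - X (sw z) a).
Definition r z := Rc (sw z).
Definition r' z := Rc (sj z :: sw z).
Definition v z := 2 * A z * lam * e z ^+ 2.
Definition qx z := \sum_a x z a ^+ 2.
Definition xy z := \sum_a x z a * y z a.
Definition yy z := \sum_a y z a ^+ 2.
Definition tr z := \sum_a r z a a.
Definition tr' z := \sum_a r' z a a.
Definition lin z := - (2 * A z * xy z).
(** The terms of order at most [2] in [e] of the increment [rho] of [logu]: [lin] has
    order [1]. *)
Definition main z :=
  m%:R * A z * lam * e z ^+ 2 - 2 * A z ^+ 2 * lam * e z ^+ 2 * qx z
  + lin z - A z * yy z
  + e z ^+ 2 * (- A z * (tr' z - tr z)
                + 2 * A z ^+ 2 * (quad (r' z) (x z) - quad (r z) (x z))).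
Definition rho z := logu (sN z) (sn z).+1 (sj z :: sw z) - logu (sN z) (sn z) (sw z).

Definition weak a b a' b' f (h : O a b f) (ha : (a' <= a)%N) (hb : (b <= b')%N) :
  O a' b' f := poly_bound_weak e_itv t_ge1 ha hb h.

Lemma O_e : O 1 0 e.
Proof.
exists 1 => // z Dz; rewrite expr0 expr1 mulr1 mul1r ger0_norm//.
by have /andP[] := e_itv Dz.
Qed.

Lemma O_e2 : O 2 0 (fun z => e z ^+ 2).
Proof. exact: (poly_boundX 2 O_e). Qed.

Lemma O_A : O 0 0 A.
Proof.
by apply: (@poly_bound_bounded _ _ _ _ _ 1) => z _; rewrite gtr0_norm ?amp_gt0 ?amp_le1.
Qed.

Lemma O_A' : O 0 0 A'.
Proof.
by apply: (@poly_bound_bounded _ _ _ _ _ 1) => z _; rewrite gtr0_norm ?amp_gt0 ?amp_le1.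
Qed.

Lemma O_c c : O 0 0 (fun=> c). Proof. exact: poly_bound_cst. Qed.

Lemma qx_ge0 z : 0 <= qx z.
Proof. by apply: sumr_ge0 => a _; rewrite sqr_ge0. Qed.

Lemma O_qx : O 0 1 qx.
Proof.
exists 1 => // z Dz; rewrite expr0 !mul1r expr1 ger0_norm ?qx_ge0//.
by rewrite /t /sq /qx /x /e lerDr.
Qed.

Lemma O_x a : O 0 1 (fun z => x z a).
Proof.
exists 1 => // z Dz; rewrite expr0 !mul1r expr1.
have xq : x z a ^+ 2 <= qx z.
  by rewrite /qx (bigD1 a)//= lerDl sumr_ge0// => i _; rewrite sqr_ge0.
by apply: (le_trans (norm_le_1Dsqr _)); rewrite lerD2l.
Qed.

Lemma O_y a : O 1 0 (fun z => y z a).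
Proof.
apply: (@poly_boundM _ _ D e t 1 0 0 0 e); first exact: O_e.
by apply: (@poly_bound_bounded _ _ _ _ _ K) => z _.
Qed.

Lemma O_r a b : O 0 0 (fun z => r z a b).
Proof. by apply: (@poly_bound_bounded _ _ _ _ _ K) => z _; exact: Rc_le. Qed.

Lemma O_r' a b : O 0 0 (fun z => r' z a b).
Proof. by apply: (@poly_bound_bounded _ _ _ _ _ K) => z _; exact: Rc_le. Qed.

Lemma O_xy : O 1 1 xy.
Proof. by apply: poly_bound_sum => a; exact: (poly_boundM (O_x a) (O_y a)). Qed.

Lemma O_yy : O 2 0 yy.
Proof. by apply: poly_bound_sum => a; exact: (poly_boundX 2 (O_y a)). Qed.

Lemma O_tr : O 0 0 tr. Proof. by apply: poly_bound_sum => a; exact: O_r. Qed.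

Lemma O_tr' : O 0 0 tr'. Proof. by apply: poly_bound_sum => a; exact: O_r'. Qed.

Lemma O_quad : O 0 2 (fun z => quad (r z) (x z)).
Proof.
apply: poly_bound_sum => a; apply: poly_bound_sum => b.
exact: (poly_boundM (O_r a b) (poly_boundM (O_x a) (O_x b))).
Qed.

Lemma O_quad' : O 0 2 (fun z => quad (r' z) (x z)).
Proof.
apply: poly_bound_sum => a; apply: poly_bound_sum => b.
exact: (poly_boundM (O_r' a b) (poly_boundM (O_x a) (O_x b))).
Qed.

Definition cross z := \sum_a \sum_b r' z a b *
  (x z a * y z b + y z a * x z b + y z a * y z b).

Lemma O_cross : O 1 1 cross.
Proof.
apply: poly_bound_sum => a; apply: poly_bound_sum => b.
apply: (poly_boundM (O_r' a b)); apply: poly_boundD; first apply: poly_boundD.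
- exact: (poly_boundM (O_x a) (O_y b)).
- exact: (poly_boundM (O_y a) (O_x b)).
- exact: (weak (poly_boundM (O_y a) (O_y b))).
Qed.

Lemma v_ge0 z : 0 <= v z.
Proof.
have A0 : 0 <= A z := ltW (amp_gt0 (sN z) (sn z).+1).
by rewrite /v mulr_ge0 ?sqr_ge0// mulr_ge0// mulr_ge0.
Qed.

Lemma O_v : O 2 0 v.
Proof.
exact: (poly_boundM (poly_boundM (poly_boundM (O_c 2) O_A) (O_c lam)) O_e2).
Qed.

Lemma O_le (a b : nat) (f g : step -> R) : O a b g ->
  (forall z, D z -> `|f z| <= `|g z|) -> O a b f.
Proof.
by move=> [C C0 gC] fg; exists C => // z Dz; exact: (le_trans (fg z Dz) (gC z Dz)).
Qed.

Lemma ampS z : D z -> A' z = A z / (1 + v z).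
Proof.
case=> h1 _ _; rewrite /A' /A /v /amp tauS// -/(e z) /A /amp.
have := tau_ge0 (sN z) (sn z).+1.
have : 0 <= lam * e z ^+ 2 by rewrite mulr_ge0 ?sqr_ge0.
set T := tau _ _; set E := _ * _ => E0 T0.
have -> : 2 * (1 + 2 * T)^-1 * lam * e z ^+ 2 = 2 * E / (1 + 2 * T).
  by rewrite /E; ring.
field; apply/andP; split; lra.
Qed.

(** Exact form of the remainder. It combines the second order of the logarithm, the
    second order of the change of [amp], and the increments of the arguments of the
    corrector; each of them has order [3]. *)
Lemma rho_main z : D z -> rho z - main z =
  m%:R / 2 * (ln (1 + v z) - v z) + A z * qx z * (v z ^+ 2 / (1 + v z))
  + e z ^+ 2 * (2 * A z ^+ 2 * cross z)
  + e z ^+ 2 * ((A' z - A z) * tr z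
     + 2 * ((A z - A' z) * (A z + A' z)) * quad (r z) (x z)).
Proof.
move=> Dz; have := ampS Dz; case: Dz => h1 _ _ AS.
have v1 : 1 + v z != 0 by have := v_ge0 z; lra.
have lnE : ln (1 + 2 * tau (sN z) (sn z))
         = ln (1 + 2 * tau (sN z) (sn z).+1) + ln (1 + v z).
  rewrite -lnM ?posrE; [|have := tau_ge0 (sN z) (sn z).+1; lra|have := v_ge0 z; lra].
  congr ln; rewrite -[LHS]invrK -/(amp _ _) -/(A' z) AS invfM invrK.
  by rewrite /A /amp invrK.
have xE a : eps (sN z) * X (sj z :: sw z) a = x z a + y z a.
  by rewrite /x /y -mulrDr addrC subrK.
have qE : \sum_a (eps (sN z) * X (sj z :: sw z) a) ^+ 2 = qx z + 2 * xy z + yy z.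
  rewrite /qx /xy /yy mulr_sumr -!big_split/=; apply: eq_bigr => a _.
  by rewrite xE; ring.
have quE : quad (Rc (sj z :: sw z)) (fun a => eps (sN z) * X (sj z :: sw z) a)
         = quad (r' z) (x z) + cross z.
  rewrite /quad /cross -big_split/=; apply: eq_bigr => a _.
  rewrite -big_split/=; apply: eq_bigr => b _.
  by rewrite !xE /r'; ring.
rewrite /rho /logu /corr lnE qE quE.
rewrite -/(A z) -/(A' z) -/(e z) -/(tr' z) -/(tr z) -/(qx z) -/(quad (r z) (x z)).
rewrite /main /lin.
have vE : v z = 2 * A z * lam * e z ^+ 2 by [].
have -> : A z * qx z * (v z ^+ 2 / (1 + v z))
        = A' z * qx z - A z * qx z + A z * qx z * v z.
  by rewrite AS; field.
have -> : m%:R / 2 * (ln (1 + v z) - v z)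
        = m%:R / 2 * ln (1 + v z) - m%:R * A z * lam * e z ^+ 2.
  by rewrite [in LHS]mulrBr {2}vE; field.
by rewrite [in X in _ = X]vE; ring.
Qed.

Lemma O_rho_main : O 3 2 (fun z => rho z - main z).
Proof.
apply: (poly_boundE (fun z => @rho_main z)).
have O_A'A : O 2 0 (fun z => A z - A' z).
  have : O 2 0 (fun z => A z * v z) by exact: (poly_boundM O_A O_v).
  move/O_le; apply=> z Dz; rewrite (ampS Dz).
  have v0 := v_ge0 z; have A0 := amp_gt0 (sN z) (sn z).+1.
  rewrite (_ : _ - _ = A z * v z / (1 + v z)); last by field; lra.
  by rewrite normrM ler_piMr// ger0_norm ?invr_ge0 ?invf_le1; lra.
apply: poly_boundD; first apply: poly_boundD; first apply: poly_boundD.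
- apply: (@weak 4 0); [|by []|by []].
  apply: (poly_boundM (O_c _)) => /=.
  have := poly_boundX 2 O_v => /O_le; apply=> z Dz.
  by rewrite [leRHS]ger0_norm ?sqr_ge0// ln1D_taylor1// v_ge0.
- apply: (@weak 4 1); [|by []|by []].
  apply: (poly_boundM (poly_boundM O_A O_qx)) => /=.
  have := poly_boundX 2 O_v => /O_le; apply=> z Dz.
  have v0 := v_ge0 z.
  by rewrite normrM ler_piMr// ger0_norm ?invr_ge0 ?invf_le1; lra.
- apply: (@weak 3 1); [|by []|by []].
  apply: (poly_boundM O_e2).
  exact: (poly_boundM (poly_boundM (O_c 2) (poly_boundX 2 O_A)) O_cross).
- apply: (@weak 4 2); [|by []|by []].
  apply: (poly_boundM O_e2); apply: poly_boundD.
    apply: (@weak 2 0); [|by []|by []]; apply: (@poly_boundM _ _ D e t 2 0 0 0 _ tr _ O_tr).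
    by apply: (poly_boundE _ (poly_boundN O_A'A)) => z _; rewrite opprB.
  have h : O 2 0 (fun z => (A z - A' z) * (A z + A' z)).
    exact: (poly_boundM O_A'A (poly_boundD O_A O_A')).
  exact: (poly_boundM (poly_boundM (O_c 2) h) O_quad).
Qed.

Lemma O_lin : O 1 1 lin.
Proof.
by apply: poly_boundN; exact: (poly_boundM (poly_boundM (O_c 2) O_A) O_xy).
Qed.

Lemma O_main_lin : O 2 2 (fun z => main z - lin z).
Proof.
pose f z := m%:R * A z * lam * e z ^+ 2 - 2 * A z ^+ 2 * lam * e z ^+ 2 * qx z
  - A z * yy z
  + e z ^+ 2 * (- A z * (tr' z - tr z)
                + 2 * A z ^+ 2 * (quad (r' z) (x z) - quad (r z) (x z))).
apply: (@poly_boundE _ _ _ _ _ _ _ _ f); first by move=> z _; rewrite /main /f; ring.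
have O_A2 := poly_boundX 2 O_A.
apply: poly_boundD; first apply: poly_boundB; first apply: poly_boundB.
- apply: (@weak 2 0); [|by []|by []].
  exact: (poly_boundM (poly_boundM (poly_boundM (O_c _) O_A) (O_c _)) O_e2).
- apply: (@weak 2 1); [|by []|by []].
  exact: (poly_boundM (poly_boundM (poly_boundM (poly_boundM (O_c _) O_A2)
    (O_c _)) O_e2) O_qx).
- by apply: (@weak 2 0); [|by []|by []]; exact: (poly_boundM O_A O_yy).
- apply: (poly_boundM O_e2); apply: poly_boundD.
    apply: (@weak 0 0); [|by []|by []].
    exact: (poly_boundM (poly_boundN O_A) (poly_boundB O_tr' O_tr)).
  exact: (poly_boundM (poly_boundM (O_c _) O_A2) (poly_boundB O_quad' O_quad)).
Qed.

Lemma O_rho_lin : O 2 2 (fun z => rho z - lin z).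
Proof.
apply: (@poly_boundE _ _ _ _ _ _ _ _ (fun z => (rho z - main z) + (main z - lin z))).
  by move=> z _; rewrite addrA subrK.
by apply: poly_boundD; [exact: (weak O_rho_main)|exact: O_main_lin].
Qed.

Lemma O_rho : O 1 2 rho.
Proof.
apply: (@poly_boundE _ _ _ _ _ _ _ _ (fun z => (rho z - lin z) + lin z)).
  by move=> z _; rewrite subrK.
by apply: poly_boundD; [exact: (weak O_rho_lin)|exact: (weak O_lin)].
Qed.

(** The terms of order at most [2] of [expR rho - 1]. *)
Definition second z := main z + lin z ^+ 2 / 2.

Lemma O_second : O 3 4 (fun z => rho z + rho z ^+ 2 / 2 - second z).
Proof.
apply: (@poly_boundE _ _ _ _ _ _ _ _ (fun z => (rho z - main z)
    + (rho z - lin z) * (rho z + lin z) / 2)).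
  by move=> z _; rewrite /second; field.
apply: poly_boundD; first exact: (weak O_rho_main).
have h : O 1 2 (fun z => rho z + lin z).
  by apply: poly_boundD; [exact: O_rho|exact: (weak O_lin)].
exact: (poly_boundM (poly_boundM O_rho_lin h) (O_c _)).
Qed.

Definition err w a b :=
  \sum_j q w j * ((X (j :: w) a - X w a) * (X (j :: w) b - X w b)
                  + Rc (j :: w) a b) - Rc w a b - lam * Sig a b.

(** The corrector [Rc] is exactly what makes the averages of the first and of the
    second order terms cancel, up to the error [err]. *)
Lemma second_avg N n w :
  \sum_j q w j * second (Step N n w j) =
  eps N ^+ 2 * corr (amp N n.+1) (err w) (fun a => eps N * X w a).
Proof.
pose E := eps N; pose a0 := amp N n.+1; pose u a := E * X w a.
pose G j a b := (X (j :: w) a - X w a) * (X (j :: w) b - X w b) + Rc (j :: w) a b.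
pose EG a b := \sum_j q w j * G j a b.
pose Q := \sum_a u a ^+ 2.
pose c := m%:R * a0 * lam - 2 * a0 ^+ 2 * lam * Q + a0 * \sum_a Rc w a a
          - 2 * a0 ^+ 2 * quad (Rc w) u.
have secE j : second (Step N n w j) = E ^+ 2 * c
    - E ^+ 2 * a0 * (\sum_a G j a a) + E ^+ 2 * 2 * a0 ^+ 2 * quad (G j) u
    - 2 * a0 * E * \sum_a u a * (X (j :: w) a - X w a).
  have linE : lin (Step N n w j)
      = - (2 * a0 * E * \sum_a u a * (X (j :: w) a - X w a)).
    have xyE : xy (Step N n w j) = E * \sum_a u a * (X (j :: w) a - X w a).
      rewrite /xy mulr_sumr; apply: eq_bigr => a _.
      by rewrite /x /y /e /= /u mulrCA.
    by rewrite /lin xyE /A /= -/a0; ring.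
  have GaE : \sum_a G j a a
      = \sum_a (X (j :: w) a - X w a) ^+ 2 + \sum_a Rc (j :: w) a a.
    by rewrite -big_split/=; apply: eq_bigr => a _; rewrite /G expr2.
  have GE : quad (G j) u
      = (\sum_a u a * (X (j :: w) a - X w a)) ^+ 2 + quad (Rc (j :: w)) u.
    rewrite expr2 big_distrlr/= /quad -big_split/=; apply: eq_bigr => a _.
    by rewrite -big_split/=; apply: eq_bigr => b _; rewrite /G; ring.
  have yyE : yy (Step N n w j) = E ^+ 2 * \sum_a (X (j :: w) a - X w a) ^+ 2.
    by rewrite /yy mulr_sumr; apply: eq_bigr => a _; rewrite exprMn.
  rewrite /second /main linE yyE GaE GE /tr /tr' /r /r' /e /A /=.
  by rewrite -/E -/a0 /qx -[x _]/u -/Q /c; field.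
under eq_bigr do rewrite secE.
have -> : \sum_j q w j * (E ^+ 2 * c - E ^+ 2 * a0 * (\sum_a G j a a)
      + E ^+ 2 * 2 * a0 ^+ 2 * quad (G j) u
      - 2 * a0 * E * \sum_a u a * (X (j :: w) a - X w a)) =
    E ^+ 2 * c - E ^+ 2 * a0 * (\sum_a EG a a) + E ^+ 2 * 2 * a0 ^+ 2 * quad EG u.
  have e1 : \sum_a EG a a = \sum_j q w j * \sum_a G j a a.
    by rewrite exchange_big; apply: eq_bigr => j _; rewrite mulr_sumr.
  have e2 : quad EG u = \sum_j q w j * quad (G j) u.
    rewrite /quad; under [RHS]eq_bigr do rewrite mulr_sumr.
    rewrite [RHS]exchange_big/=; apply: eq_bigr => a _.
    under [RHS]eq_bigr do rewrite mulr_sumr.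
    rewrite [RHS]exchange_big/=; apply: eq_bigr => b _.
    by rewrite /EG mulr_suml; apply: eq_bigr => j _; rewrite -[LHS]mulrA.
  have e3 : \sum_j q w j * \sum_a u a * (X (j :: w) a - X w a) = 0.
    under eq_bigr do rewrite mulr_sumr; rewrite exchange_big big1//= => a _.
    under eq_bigr do rewrite mulrCA.
    by rewrite -mulr_sumr X_mart mulr0.
  rewrite e1 e2 -[RHS]subr0 -[X in _ = _ - X](mulr0 (2 * a0 * E)).
  rewrite -[X in _ = _ - _ * X]e3.
  pose f1 j := q w j * (E ^+ 2 * c) - E ^+ 2 * a0 * (q w j * \sum_a G j a a).
  pose f2 j := E ^+ 2 * 2 * a0 ^+ 2 * (q w j * quad (G j) u).
  pose f3 j := 2 * a0 * E * (q w j * \sum_a u a * (X (j :: w) a - X w a)).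
  transitivity (\sum_j (f1 j + f2 j - f3 j)).
    by apply: eq_bigr => j _; rewrite /f1 /f2 /f3; ring.
  by rewrite sumrB big_split/= sumrB -!mulr_sumr -mulr_suml q_sum1 mul1r.
have EGE a b : EG a b = err w a b + Rc w a b + lam * Sig a b.
  by rewrite /err -/(EG a b); ring.
have trE : \sum_a EG a a = \sum_a err w a a + \sum_a Rc w a a + lam * m%:R.
  by rewrite -Sig_trace mulr_sumr -!big_split/=; apply: eq_bigr => a _.
have quE : quad EG u = quad (err w) u + quad (Rc w) u + lam * Q.
  have -> : Q = quad Sig u.
    rewrite /Q /quad /u; under eq_bigr do rewrite exprMn.
    rewrite -mulr_sumr -Sig_quad mulr_sumr; apply: eq_bigr => a _.
    by rewrite mulr_sumr; apply: eq_bigr => b _; ring.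
  rewrite /quad mulr_sumr -!big_split/=; apply: eq_bigr => a _.
  rewrite mulr_sumr -!big_split/=; apply: eq_bigr => b _.
  by rewrite EGE; ring.
by rewrite trE quE /corr -/E -/a0 -/u /c; ring.
Qed.

Definition heat N n w := expR (logu N n w).

(** Half of the damping [amp0] pays for the corrector, the other half for the
    polynomial factor. *)
Lemma heat_bound b : exists2 C, 0 <= C &
  forall N n w, small N -> heat N n w * sq N w ^+ b <= C.
Proof.
have [|C C0 CP] := @expRN_poly_bounded R (amp0 / 2) b.
  by rewrite divr_gt0 ?amp0_gt0.
exists (expR (amp0 / 2) * C); first by rewrite mulr_ge0 ?expR_ge0.
move=> N n w [_ sm]; rewrite /sq; set Q := \sum_a _.
have Q0 : 0 <= Q by apply: sumr_ge0 => a _; rewrite sqr_ge0.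
apply: (@le_trans _ _ (expR (amp0 / 2) * (expR (- (amp0 / 2 * Q)) * (1 + Q) ^+ b))).
  rewrite mulrA ler_wpM2r ?exprn_ge0 ?addr_ge0// -expRD ler_expR /logu -/Q.
  have l0 : 0 <= m%:R / 2 * ln (1 + 2 * tau N n).
    by rewrite mulr_ge0 ?ln_ge0// ?divr_ge0// lerDl mulr_ge0 ?tau_ge0.
  have h1 : amp0 * Q <= amp N n * Q by rewrite ler_wpM2r ?amp_ge.
  have h2 : eps N ^+ 2 * corr (amp N n) (Rc w) (fun a => eps N * X w a)
      <= amp0 / 2 * (1 + Q).
    apply: (@le_trans _ _ (eps N ^+ 2 * (K2 * K * (1 + Q)))).
      rewrite ler_wpM2l ?sqr_ge0//; apply: (le_trans (ler_norm _)).
      by apply: corr_le; rewrite ?K_ge0// ltW ?amp_gt0//= amp_le1.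
    by rewrite mulrA ler_wpM2r// addr_ge0.
  by move: l0 h1 h2; set u := _ * ln _; set v1 := amp N n * Q; lra.
by rewrite ler_wpM2l ?expR_ge0// CP.
Qed.

Definition K3 : R := 2 + 2 * (#|I|%:R * K ^+ 2).

(** The cubic remainder also involves the position after the step. *)
Lemma sq_step N w j : eps N <= 1 -> sq N w <= K3 * sq N (j :: w).
Proof.
move=> e1; rewrite /sq.
set Q := \sum_a (eps N * X w a) ^+ 2.
set Q' := \sum_a (eps N * X (j :: w) a) ^+ 2.
have Q'0 : 0 <= Q' by apply: sumr_ge0 => a _; rewrite sqr_ge0.
have IK : 0 <= #|I|%:R * K ^+ 2 by rewrite mulr_ge0 ?sqr_ge0.
have QQ : Q <= 2 * Q' + 2 * (#|I|%:R * K ^+ 2).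
  have -> : #|I|%:R * K ^+ 2 = \sum_(a in I) K ^+ 2.
    by rewrite sumr_const -[RHS]mulr_natl.
  rewrite /Q /Q' !mulr_sumr -big_split/=; apply: ler_sum => a _.
  have eK : (eps N * (X (j :: w) a - X w a)) ^+ 2 <= K ^+ 2.
    rewrite -[leLHS]real_normK ?num_real// normrM ler_pXn2r ?nnegrE ?mulr_ge0 ?K_ge0//.
    rewrite -[leRHS]mul1r; apply: ler_pM => //.
    by rewrite (ger0_norm (eps_ge0 N)).
  have := sqr_ge0 (2 * (eps N * X (j :: w) a) - eps N * X w a).
  by move: eK; rewrite mulrBr !sqrrB; lra.
have := mulr_ge0 IK Q'0; rewrite /K3 mulrDr mulr1 mulrDl.
by move: QQ; set k := #|I|%:R * _; lra.
Qed.

(** By Taylor's formula, the relative increment of [heat] is [second] up to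
    [eps N ^+ 3], and the average of [second] is [eps N ^+ 2] times a linear
    function of [err], whose entries are at most [eta]. *)
Lemma heat_step : exists2 C, 0 <= C & forall N n w,
  small N -> (n < N)%N -> size w = n ->
  `|\sum_j q w j * heat N n.+1 (j :: w) - heat N n w|
    <= C * (eps N ^+ 3 + eps N ^+ 2 * eta n).
Proof.
have [Cr Cr0 rhoC] := O_rho; have [C2 C20 secC] := O_second.
have [H6 H60 H6P] := heat_bound 6; have [H4 H40 H4P] := heat_bound 4.
have [H1 H10 H1P] := heat_bound 1.
have K30 : 0 <= K3 by rewrite addr_ge0// mulr_ge0// mulr_ge0 ?sqr_ge0.
pose C3 := Cr ^+ 3 * (H6 + K3 ^+ 6 * H6) + C2 * H4.
have C30 : 0 <= C3.
  by rewrite addr_ge0 ?mulr_ge0 ?exprn_ge0// addr_ge0// mulr_ge0 ?exprn_ge0.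
exists (C3 + K2 * H1); first by rewrite addr_ge0// mulr_ge0 ?K2_ge0.
move=> N n w sm nN wn.
pose z j := Step N n w j; have Dz j : D (z j) by [].
pose T := sq N w; pose E := eps N; pose h := heat N n w.
have T0 : 0 <= T by exact: le_trans (sq_ge1 N w).
have h0 : 0 <= h by exact: expR_ge0.
have heatE j : heat N n.+1 (j :: w) = h * expR (rho (z j)).
  by rewrite /h /heat -expRD /rho/= addrC subrK.
have E0 : 0 <= E by exact: eps_ge0.
have j_le j : `|h * (expR (rho (z j)) - 1 - second (z j))| <= C3 * E ^+ 3.
  have -> : h * (expR (rho (z j)) - 1 - second (z j)) =
      h * (expR (rho (z j)) - 1 - rho (z j) - rho (z j) ^+ 2 / 2)
      + h * (rho (z j) + rho (z j) ^+ 2 / 2 - second (z j)) by ring.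
  apply: (le_trans (ler_normD _ _)); rewrite /C3 mulrDl; apply: lerD.
    rewrite normrM (ger0_norm h0).
    apply: (le_trans (ler_wpM2l h0 (expR_taylor2 _))).
    rewrite mulrCA mulrDr mulr1 -heatE.
    have r3 : `|rho (z j)| ^+ 3 <= Cr ^+ 3 * E ^+ 3 * T ^+ 6.
      have := rhoC _ (Dz j); rewrite expr1 => r1.
      rewrite (_ : _ * T ^+ 6 = (Cr * (E * T ^+ 2)) ^+ 3); last by ring.
      by rewrite ler_pXn2r ?nnegrE// mulr_ge0// mulr_ge0 ?exprn_ge0.
    apply: (@le_trans _ _ (Cr ^+ 3 * E ^+ 3 * T ^+ 6 * (h + heat N n.+1 (j :: w)))).
      by rewrite ler_wpM2r// addr_ge0 ?expR_ge0.
    rewrite -mulrA [X in _ <= X](_ : _ = Cr ^+ 3 * E ^+ 3 * (H6 + K3 ^+ 6 * H6));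
      last by ring.
    rewrite ler_wpM2l ?mulr_ge0 ?exprn_ge0// mulrDr lerD//.
      by rewrite mulrC; exact: H6P.
    apply: (@le_trans _ _ ((K3 * sq N (j :: w)) ^+ 6 * heat N n.+1 (j :: w))).
      rewrite ler_wpM2r ?expR_ge0// ler_pXn2r ?nnegrE//; first by case: sm => e1 _; exact: sq_step.
      by rewrite mulr_ge0// (le_trans ler01)// sq_ge1.
    by rewrite exprMn -mulrA ler_wpM2l ?exprn_ge0// mulrC H6P.
  rewrite normrM (ger0_norm h0); apply: (le_trans (ler_wpM2l h0 (secC _ (Dz j)))).
  rewrite -/E -/T [X in X <= _](_ : _ = C2 * E ^+ 3 * (h * T ^+ 4)).
    rewrite [X in _ <= X](_ : _ = C2 * E ^+ 3 * H4); last by ring.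
    by rewrite ler_wpM2l ?mulr_ge0 ?exprn_ge0//; exact: H4P.
  by rewrite /e /t /= -/E -/T; ring.
have -> : \sum_j q w j * heat N n.+1 (j :: w) - h =
    \sum_j q w j * (h * (expR (rho (z j)) - 1 - second (z j)))
    + h * \sum_j q w j * second (z j).
  have hE : h = \sum_j q w j * h by rewrite -mulr_suml q_sum1 mul1r.
  rewrite mulr_sumr -big_split/= [X in _ - X = _]hE -sumrB.
  by apply: eq_bigr => j _; rewrite heatE; ring.
rewrite second_avg; apply: (le_trans (ler_normD _ _)).
apply: (@le_trans _ _ (C3 * E ^+ 3 + K2 * H1 * (E ^+ 2 * eta n))).
  apply: lerD.
    apply: (le_trans (ler_norm_sum _ _ _)).
    rewrite -[leRHS]mul1r -[X in _ <= X * _](q_sum1 w) mulr_suml.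
    apply: ler_sum => j _.
    by rewrite normrM (ger0_norm (q_ge0 _ _)) ler_wpM2l.
  rewrite normrM (ger0_norm h0) normrM (ger0_norm (sqr_ge0 _)) mulrCA -/E.
  rewrite [leRHS](_ : _ = E ^+ 2 * (K2 * eta n * H1)); last by ring.
  rewrite ler_wpM2l ?sqr_ge0//.
  apply: (@le_trans _ _ (h * (K2 * eta n * T))).
    rewrite ler_wpM2l//; apply: corr_le => //; first by rewrite ltW ?amp_gt0 ?amp_le1.
    by move=> a b; rewrite -wn; exact: X_cov.
  rewrite mulrCA ler_wpM2l ?mulr_ge0 ?K2_ge0//.
  by have := H1P _ n w sm; rewrite expr1.
have a1 : 0 <= K2 * H1 * E ^+ 3 by rewrite mulr_ge0 ?exprn_ge0 ?mulr_ge0 ?K2_ge0.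
have a2 : 0 <= C3 * (E ^+ 2 * eta n) by rewrite mulr_ge0 ?mulr_ge0 ?exprn_ge0.
rewrite -/E -subr_ge0.
rewrite (_ : _ - _ = K2 * H1 * E ^+ 3 + C3 * (E ^+ 2 * eta n)); first exact: addr_ge0.
by ring.
Qed.

Lemma eps_cvg0 : eps N @[N --> \oo] --> (0 : R).
Proof.
have h : s / N%:R @[N --> \oo] --> (0 : R).
  rewrite -(mulr0 s); apply: cvgMr => //.
  by apply/gtr0_cvgV0; [near=> N; rewrite ltr0n; near: N; exact: nbhs_infty_gt|exact: cvgr_idn].
rewrite -[X in _ --> X](sqrtr0 R).
by apply: (cvg_comp _ _ h); exact: sqrt_continuous.
Unshelve. all: by end_near. Qed.

Lemma small_near : \forall N \near \oo, small N.
Proof.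
have c0 : 0 < amp0 / 2 / (1 + K2 * K).
  by rewrite !divr_gt0 ?amp0_gt0// ltr_pwDl// mulr_ge0 ?K2_ge0 ?K_ge0.
have KK0 : 0 <= K2 * K by rewrite mulr_ge0 ?K2_ge0 ?K_ge0.
near=> N.
have e1 : eps N <= 1.
  near: N; move/cvgrPdist_le : eps_cvg0 => /(_ 1 ltr01).
  by apply: filterS => N; rewrite sub0r normrN ger0_norm ?eps_ge0.
have e2 : eps N <= amp0 / 2 / (1 + K2 * K).
  near: N; move/cvgrPdist_le : eps_cvg0 => /(_ _ c0).
  by apply: filterS => N; rewrite sub0r normrN ger0_norm ?eps_ge0.
split => //; move: e2; rewrite ler_pdivlMr; last lra.
move=> /(le_trans _); apply; have e0 := eps_ge0 N.
apply: ler_pM => //; first exact: sqr_ge0.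
  by rewrite expr2 ler_piMr.
lra.
Unshelve. all: by end_near. Qed.

Definition target : R := - (m%:R / 2 * ln (1 + 2 * (lam * s))).

(** The [N] one-step errors [eps N ^+ 3] add up to [s * eps N], and those of order
    [eps N ^+ 2 * eta n] to at most [eps N ^+ 2 * K]. The corrector is negligible at
    both ends. *)
Lemma path_exp_heat_close : exists2 C, 0 <= C & forall N, (0 < N)%N -> small N ->
  `|path_exp q N (fun w => expR (- (s / N%:R * \sum_a X w a ^+ 2)))
    - expR target| <= C * eps N.
Proof.
have [C C0 CP] := heat_step.
have [H0 H00 H0P] := heat_bound 0; have [H1 H10 H1P] := heat_bound 1.
have [G1 G10 G1P] := @expRN_poly_bounded R 1 1 ltr01.
pose Q0 := \sum_a X [::] a ^+ 2.
have Q00 : 0 <= Q0 by apply: sumr_ge0 => a _; rewrite sqr_ge0.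
have KK0 : 0 <= K2 * K by rewrite mulr_ge0 ?K2_ge0 ?K_ge0.
pose B0 := (Q0 + K2 * K * (1 + Q0)) * (H0 + 1).
have B00 : 0 <= B0.
  by apply: mulr_ge0; apply: addr_ge0 => //; apply: mulr_ge0 => //; apply: addr_ge0.
exists (C * (s + K) + K2 * K * (H1 + G1) + B0).
  have := K_ge0 => K0.
  apply: addr_ge0 => //; apply: addr_ge0; apply: mulr_ge0 => //; exact: addr_ge0.
move=> N N0 sm; have [e1 _] := sm; have e0 := eps_ge0 N.
set E := eps N.
have EN : E ^+ 2 * N%:R = s by rewrite eps_sqr divfK// pnatr_eq0 -lt0n.
have E2E : E ^+ 2 <= E by rewrite expr2 ler_piMr.
have KA w a b : `|Rc w a b| <= K by exact: Rc_le.
have amp01 n : 0 <= amp N n <= 1 by rewrite ltW ?amp_gt0//= amp_le1.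
have h1 : `|path_exp q N (heat N N) - heat N 0 [::]| <= C * (s + K) * E.
  apply: (le_trans (path_exp_telescope q_ge0 q_sum1
    (c := fun n => C * (E ^+ 3 + E ^+ 2 * eta n)) _)).
    by move=> n w nN wn; exact: CP.
  rewrite -mulr_sumr -mulrA ler_wpM2l// big_split/= sumr_const card_ord.
  rewrite -mulr_sumr -mulr_natr mulrDl lerD//.
    by rewrite -EN [leRHS](_ : _ = E ^+ 3 * N%:R)//; ring.
  rewrite [leRHS]mulrC; apply: ler_pM => //; first exact: sqr_ge0.
    by apply: sumr_ge0 => i _.
  exact: eta_sum.
have h2 w : `|heat N N w - expR (- (s / N%:R * \sum_a X w a ^+ 2))|
    <= K2 * K * (H1 + G1) * E.
  have -> : s / N%:R * \sum_a X w a ^+ 2 = \sum_a (E * X w a) ^+ 2.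
    by rewrite -eps_sqr mulr_sumr; apply: eq_bigr => a _; rewrite exprMn.
  set Q := \sum_a _; have Q_ge0 : 0 <= Q by apply: sumr_ge0 => a _; rewrite sqr_ge0.
  apply: (le_trans (normB_expR _ _)).
  have -> : logu N N w - - Q
      = E ^+ 2 * corr (amp N N) (Rc w) (fun a => eps N * X w a).
    rewrite /logu /amp /tau subnn !mulr0 addr0 ln1 mulr0 invr1 mul1r -/E -/Q.
    by rewrite oppr0 add0r opprK addrAC addNr add0r.
  rewrite normrM (ger0_norm (sqr_ge0 E)).
  have c1 := corr_le (fun a => eps N * X w a) K_ge0 (amp01 N) (KA w).
  have c2 : heat N N w * (1 + Q) <= H1 by have := H1P _ N w sm; rewrite expr1.
  have c3 : expR (- Q) * (1 + Q) <= G1 by have := G1P _ Q_ge0; rewrite expr1 mul1r.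
  rewrite [leRHS](_ : _ = E * (K2 * K * (H1 + G1))); last by ring.
  have hh : 0 <= heat N N w + expR (- Q) by apply: addr_ge0; exact: expR_ge0.
  rewrite -[leLHS]mulrA; apply: ler_pM; rewrite ?sqr_ge0 ?mulr_ge0//.
  apply: (@le_trans _ _ (K2 * K * (1 + Q) * (heat N N w + expR (- Q)))).
    exact: ler_wpM2r.
  by rewrite -mulrA ler_wpM2l// mulrDr lerD// mulrC.
have h3 : `|heat N 0 [::] - expR target| <= B0 * E.
  apply: (le_trans (normB_expR _ _)).
  have tE : tau N 0 = lam * s by rewrite /tau subn0 -mulrA EN.
  have tg : expR target <= 1.
    rewrite expR_le1 oppr_le0 mulr_ge0 ?ln_ge0// ?divr_ge0//.
    by rewrite lerDl mulr_ge0 ?lams_ge0.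
  have hH : heat N 0 [::] <= H0 by have := H0P _ 0%N [::] sm; rewrite expr0 mulr1.
  have -> : logu N 0 [::] - target = E ^+ 2 * (- amp N 0 * Q0
      + corr (amp N 0) (Rc [::]) (fun a => eps N * X [::] a)).
    rewrite /logu /target tE -/E.
    have -> : \sum_a (E * X [::] a) ^+ 2 = E ^+ 2 * Q0.
      by rewrite mulr_sumr; apply: eq_bigr => a _; rewrite exprMn.
    ring.
  rewrite normrM (ger0_norm (sqr_ge0 E)).
  rewrite [leRHS](_ : _ = E * B0); last by ring.
  have hh : 0 <= heat N 0 [::] + expR target by apply: addr_ge0; exact: expR_ge0.
  rewrite -[leLHS]mulrA; apply: ler_pM; rewrite ?sqr_ge0 ?mulr_ge0//.
  apply: ler_pM => //; last exact: lerD.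
  have /andP[a0 a1] := amp01 0%N.
  apply: (le_trans (ler_normD _ _)); apply: lerD.
    by rewrite normrM normrN !ger0_norm// ler_piMl.
  apply: (le_trans (corr_le (fun a => eps N * X [::] a) K_ge0 (amp01 0%N) (KA [::]))).
  rewrite ler_wpM2l// lerD2l; apply: ler_sum => a _.
  by rewrite exprMn ler_piMl ?sqr_ge0// expr_le1.
have h4 : `|path_exp q N (fun w => expR (- (s / N%:R * \sum_a X w a ^+ 2)))
    - path_exp q N (heat N N)| <= K2 * K * (H1 + G1) * E.
  rewrite -path_expB; apply: (norm_path_exp_le q_ge0 q_sum1) => w _.
  by rewrite distrC.
move: h1 h3 h4; set u2 := path_exp q N (heat N N); set u3 := heat N 0 [::].
set u1 := path_exp _ _ _ => h1 h3 h4.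
rewrite (_ : u1 - _ = (u1 - u2) + (u2 - u3) + (u3 - expR target)); last by ring.
apply: (le_trans (ler_normD _ _)); rewrite [leRHS]mulrDl lerD//.
by apply: (le_trans (ler_normD _ _)); rewrite addrC [leRHS]mulrDl lerD.
Qed.

Theorem path_exp_laplace_cvg :
  path_exp q N (fun w => expR (- (s / N%:R * \sum_a X w a ^+ 2)))
    @[N --> \oo] --> expR target.
Proof.
have [C C0 CP] := path_exp_heat_close.
apply/cvgrPdist_le => d d0.
have d1 : 0 < d / (1 + C) by rewrite divr_gt0// ltr_pwDl.
near=> N; rewrite distrC; apply: (le_trans (CP N _ _)).
- by near: N; exact: nbhs_infty_gt.
- by near: N; exact: small_near.
have : eps N <= d / (1 + C).
  near: N; move/cvgrPdist_le : eps_cvg0 => /(_ _ d1).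
  by apply: filterS => N; rewrite sub0r normrN ger0_norm ?eps_ge0.
rewrite ler_pdivlMr; last lra.
have e0 := eps_ge0 N; move=> /(le_trans _); apply.
by rewrite mulrC ler_wpM2l//; lra.
Unshelve. all: by end_near. Qed.

End martingale_clt.
End MartingaleCLT.

(** * Moments of bounded martingales *)

Section fourth_moment.
Context {R : realType} {J : finType}.
Variables (q : seq J -> J -> R) (M : seq J -> R).
Hypothesis q_ge0 : forall w j, 0 <= q w j.
Hypothesis q_sum1 : forall w, \sum_j q w j = 1.
Hypothesis M0 : M [::] = 0.
Hypothesis M_step : forall w j, `|M (j :: w) - M w| <= 1.
Hypothesis M_mart : forall w, \sum_j q w j * (M (j :: w) - M w) = 0.

(** Increments of a martingale are orthogonal. *)
Lemma path_exp_sqr_le n : path_exp q n (fun w => M w ^+ 2) <= n%:R.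
Proof.
elim: n => [|n IH] /=; first by rewrite M0 expr0n.
rewrite -[n.+1%:R]natr1.
apply: (@le_trans _ _ (path_exp q n (fun w => M w ^+ 2 + 1))).
  apply: le_path_exp => // w _.
  apply: (@le_trans _ _ (\sum_j (q w j * (M w ^+ 2 + 1)
      + 2 * M w * (q w j * (M (j :: w) - M w))))).
    apply: ler_sum => j _.
    have -> : M (j :: w) ^+ 2 = M w ^+ 2 + 2 * M w * (M (j :: w) - M w)
        + `|M (j :: w) - M w| ^+ 2 by rewrite real_normK ?num_real//; ring.
    have d1 : `|M (j :: w) - M w| ^+ 2 <= 1 by rewrite expr_le1.
    rewrite (mulrCA (2 * M w)) -mulrDr ler_wpM2l//; lra.
  by rewrite big_split/= -mulr_suml -mulr_sumr M_mart mulr0 addr0 q_sum1 mul1r.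
by rewrite path_expD path_exp_cst// lerD2r.
Qed.

(** In the fourth power of [M w] plus a centred increment bounded by [1], the term in
    [M w ^+ 3] averages to [0], and those of lower degree are at most
    [8 * M w ^+ 2 + 3]. *)
Lemma path_exp_pow4_le n : path_exp q n (fun w => M w ^+ 4) <= 11 * n%:R ^+ 2.
Proof.
elim: n => [|n IH] /=; first by rewrite M0 !expr0n/= mulr0.
apply: (@le_trans _ _ (path_exp q n (fun w => M w ^+ 4 + (8 * M w ^+ 2 + 3)))).
  apply: le_path_exp => // w _.
  apply: (@le_trans _ _ (\sum_j (q w j * (M w ^+ 4 + (8 * M w ^+ 2 + 3))
      + 4 * M w ^+ 3 * (q w j * (M (j :: w) - M w))))).
    apply: ler_sum => j _; set x := M w; set y := M (j :: w) - x.
    rewrite (mulrCA (4 * x ^+ 3)) -mulrDr ler_wpM2l//.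
    have -> : M (j :: w) = x + y by rewrite /y addrC subrK.
    have y1 : `|y| <= 1 by exact: M_step.
    have y2 : y ^+ 2 <= 1 by rewrite -real_normK ?num_real// expr_le1.
    have y4E : y ^+ 4 = (y ^+ 2) ^+ 2 by ring.
    have y4 : y ^+ 4 <= 1 by rewrite y4E expr_le1// sqr_ge0.
    have xy2 : x ^+ 2 * y ^+ 2 <= x ^+ 2 by rewrite ler_piMr ?sqr_ge0.
    (* [y ^+ 3] is at most [1] in absolute value, and [2 * x * y ^+ 3] is at most
       [x ^+ 2 + y ^+ 6]. *)
    have xy3 : 4 * x * y ^+ 3 <= 2 * x ^+ 2 + 2.
      have y6 : y ^+ 3 * y ^+ 3 <= 1.
        rewrite (_ : _ * _ = y ^+ 4 * y ^+ 2); last by ring.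
        by rewrite mulr_ile1 ?sqr_ge0// y4E sqr_ge0.
      by have := sqr_ge0 (x - y ^+ 3); rewrite sqrrB !expr2; lra.
    rewrite (_ : (x + y) ^+ 4 = x ^+ 4 + 4 * x ^+ 3 * y + 6 * (x ^+ 2 * y ^+ 2)
      + 4 * x * y ^+ 3 + y ^+ 4); last by ring.
    lra.
  by rewrite big_split/= -mulr_suml -mulr_sumr M_mart mulr0 addr0 q_sum1 mul1r.
rewrite path_expD path_expD path_exp_cst// path_expZ.
have := path_exp_sqr_le n; have := ler0n R n.
by rewrite -[n.+1%:R]natr1 sqrrD; lra.
Qed.

End fourth_moment.

(** * The rescaled urn along a word of draws *)

(** The words are those of the draws, the most recent one first, and the initial
    content that is kept forever is [b * p] with [p] of sum [1]. Writing [phi] for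
    the excess of the drawing probabilities over [p], the deviation [dev] of the
    variable content satisfies [dev' = beta * dev + alpha * (xi - p)], and [phi] is
    [dev] divided by the total mass, which tends to [lim_tot] at speed [beta ^+ n].
    Hence [phi] is close to [theta := dev / lim_tot], which contracts by the factor
    [gam] on average. *)
Module UrnPath.
Section urn_path.
Context {R : realType} {J : finType}.
Variables (alpha beta b : R) (p B0 : J -> R).
Hypothesis alpha_gt0 : 0 < alpha.
Hypothesis beta01 : 0 <= beta < 1.
Hypothesis b_gt0 : 0 < b.
Hypothesis p_gt0 : forall a, 0 < p a.
Hypothesis p_sum1 : \sum_a p a = 1.
Hypothesis B0_ge0 : forall a, 0 <= B0 a.

Fixpoint urnB (w : seq J) (a : J) : R :=
  if w is j :: w' then beta * urnB w' a + alpha * (j == a)%:R else B0 a.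

Fixpoint totB (n : nat) : R :=
  if n is m.+1 then beta * totB m + alpha else \sum_a B0 a.

Definition draw (w : seq J) (a : J) : R :=
  (b * p a + urnB w a) / (b + totB (size w)).

Fixpoint centred (w : seq J) (a : J) : R :=
  if w is j :: w' then centred w' a + ((j == a)%:R - p a) else 0.

(** The martingale part of [centred]. *)
Fixpoint mart (w : seq J) (a : J) : R :=
  if w is j :: w' then mart w' a + ((j == a)%:R - draw w' a) else 0.

Definition lim_tot : R := b + alpha / (1 - beta).
Definition gain : R := alpha / lim_tot.
Definition gam : R := beta + gain.
Definition dev (w : seq J) (a : J) : R := urnB w a - totB (size w) * p a.
Definition theta w a : R := dev w a / lim_tot.
Definition phi w a : R := draw w a - p a.
(** The ratio between [centred] and [mart], up to a bounded error. *)
Definition scal : R := (1 - beta) / (1 - gam).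
(** The form in which the asymptotic variance comes out of the computation: the
    second factor is that of the corrected covariance of [mart]. *)
Definition lam : R := scal ^+ 2 * ((1 - gam ^+ 2) / (1 - gam ^+ 2 + gain ^+ 2)).

Lemma beta1 : 0 < 1 - beta. Proof. by have /andP[_] := beta01; lra. Qed.
Lemma beta_ge0 : 0 <= beta. Proof. by have /andP[] := beta01. Qed.

Lemma lim_tot_gt0 : 0 < lim_tot.
Proof. by rewrite addr_gt0// divr_gt0// beta1. Qed.

Lemma gain_gt0 : 0 < gain. Proof. by rewrite divr_gt0// lim_tot_gt0. Qed.

Lemma gainE : gain = (1 - beta) * (alpha / ((1 - beta) * b + alpha)).
Proof.
rewrite /gain /lim_tot; have := beta1 => h.
have : 0 < (1 - beta) * b + alpha by rewrite addr_gt0// mulr_gt0.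
by move=> ?; field; rewrite !gt_eqF.
Qed.

Lemma gain_lt : gain < 1 - beta.
Proof.
have h := beta1; have hb := mulr_gt0 h b_gt0; rewrite gainE gtr_pMr//.
by rewrite ltr_pdivrMr ?addr_gt0// mul1r ltrDr.
Qed.

Lemma gam_bounds : beta < gam < 1.
Proof. by rewrite /gam; have := gain_gt0; have := gain_lt; lra. Qed.

Lemma gam_lt1 : 0 < 1 - gam. Proof. by have /andP[_] := gam_bounds; lra. Qed.
Lemma gam_gt0 : 0 < gam.
Proof. by have /andP[h _] := gam_bounds; exact: le_lt_trans beta_ge0 h. Qed.

Lemma gam2_gt0 : 0 < 1 - gam ^+ 2.
Proof.
rewrite (_ : _ - _ = (1 - gam) * (1 + gam)); last by ring.
by rewrite mulr_gt0 ?gam_lt1// addr_gt0// gam_gt0.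
Qed.

Lemma den_gt0 : 0 < 1 - gam ^+ 2 + gain ^+ 2.
Proof. by rewrite ltr_pwDl ?gam2_gt0// sqr_ge0. Qed.

Lemma scal_gt0 : 0 < scal. Proof. by rewrite divr_gt0 ?beta1 ?gam_lt1. Qed.

Lemma lam_ge0 : 0 <= lam.
Proof.
by rewrite mulr_ge0 ?sqr_ge0// divr_ge0 ?ltW ?gam2_gt0 ?den_gt0.
Qed.

Lemma lamE : lam = (1 - beta) ^+ 2 / ((gam - beta) ^+ 2 + (1 - gam ^+ 2))
  * (1 + 2 * (gam / (1 - gam))).
Proof.
have h1 := gam_lt1; have h2 := den_gt0.
have g : gain = gam - beta by rewrite /gam; ring.
have h3 : 0 < gain ^+ 2 + (1 - gam ^+ 2) by rewrite addrC.
by rewrite /lam /scal -g; field; rewrite ?(gt_eqF h1) ?(gt_eqF h2) ?(gt_eqF h3).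
Qed.

Lemma lam_gt1 : 1 < lam.
Proof.
have h1 := gam_lt1; have h2 := den_gt0; have h3 := gain_gt0.
have h4 := gain_lt; have h5 := beta_ge0.
have -> : lam = (1 - beta) ^+ 2 * (1 + gam)
               / ((1 - gam) * (1 - gam ^+ 2 + gain ^+ 2)).
  by rewrite /lam /scal; field; rewrite !gt_eqF.
rewrite ltr_pdivlMr ?mulr_gt0// mul1r -subr_gt0.
have -> : (1 - beta) ^+ 2 * (1 + gam) - (1 - gam) * (1 - gam ^+ 2 + gain ^+ 2)
  = 2 * gain * ((1 - beta) + (1 - gam) * beta).
  by rewrite /gam; ring.
have h6 : 0 < 1 - beta + (1 - gam) * beta.
  by rewrite ltr_pwDl ?beta1// mulr_ge0// ltW.
by apply: mulr_gt0 => //; exact: mulr_gt0.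
Qed.

Lemma totB_ge0 n : 0 <= totB n.
Proof.
elim: n => [|n IH] /=; first exact: sumr_ge0.
by rewrite addr_ge0 ?mulr_ge0 ?beta_ge0// ltW.
Qed.

Lemma urnB_ge0 w a : 0 <= urnB w a.
Proof.
elim: w => [//|j w IH] /=.
by rewrite addr_ge0 ?mulr_ge0 ?beta_ge0// ltW.
Qed.

Lemma urnB_sum w : \sum_a urnB w a = totB (size w).
Proof.
elim: w => [//|j w IH] /=.
rewrite big_split/= -!mulr_sumr IH; congr (_ + _).
by rewrite (bigD1 j)//= eqxx big1 ?addr0 ?mulr1// => a /negPf; rewrite eq_sym => ->.
Qed.

Lemma tot_gt0 n : 0 < b + totB n.
Proof. by rewrite ltr_pwDl// totB_ge0. Qed.

Lemma draw_ge0 w a : 0 <= draw w a.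
Proof.
by rewrite divr_ge0 ?(ltW (tot_gt0 _))// addr_ge0 ?urnB_ge0// mulr_ge0// ltW.
Qed.

Lemma draw_sum1 w : \sum_a draw w a = 1.
Proof.
rewrite -mulr_suml big_split/= -mulr_sumr p_sum1 mulr1 urnB_sum divff//.
by rewrite gt_eqF// tot_gt0.
Qed.

Lemma draw_le1 w a : draw w a <= 1.
Proof.
by rewrite -(draw_sum1 w) (bigD1 a)//= lerDl sumr_ge0// => i _; exact: draw_ge0.
Qed.

Lemma phi_dev w a : phi w a = dev w a / (b + totB (size w)).
Proof.
by rewrite /phi /draw /dev; have := tot_gt0 (size w) => h; field; rewrite gt_eqF.
Qed.

Lemma dev_cons j w a :
  dev (j :: w) a = beta * dev w a + alpha * ((j == a)%:R - p a).
Proof. by rewrite /dev /=; ring. Qed.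

Lemma theta_cons j w a :
  theta (j :: w) a = beta * theta w a + gain * ((j == a)%:R - p a).
Proof.
by rewrite /theta dev_cons /gain; have := lim_tot_gt0 => ?; field; rewrite gt_eqF.
Qed.

Lemma sum_betaX_le n : \sum_(i < n) beta ^+ i <= (1 - beta)^-1.
Proof.
have E : (\sum_(i < n) beta ^+ i) * (1 - beta) = 1 - beta ^+ n.
  by have := subrX1 beta n; set S := \sum_(i < n) _ => e; rewrite mulrC; lra.
rewrite -[leRHS]mul1r ler_pdivlMr ?beta1// E lerBlDr lerDl exprn_ge0//.
exact: beta_ge0.
Qed.

Let O := poly_bound (fun _ : seq J => True) (fun w => beta ^+ size w) (fun=> 1).

Lemma betaX_itv (w : seq J) : True -> 0 <= beta ^+ size w <= 1.
Proof.
move=> _; have := beta01 => /andP[h0 h1].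
by rewrite exprn_ge0//= exprn_ile1// ltW.
Qed.

Lemma O_bounded (f : seq J -> R) C : (forall w, `|f w| <= C) -> O 0 0 f.
Proof. by move=> fC; apply: (@poly_bound_bounded _ _ _ _ _ C) => w _; exact: fC. Qed.

Lemma O_cst c : O 0 0 (fun=> c). Proof. exact: poly_bound_cst. Qed.

Lemma totB_cvg n : totB n - alpha / (1 - beta)
  = beta ^+ n * (\sum_a B0 a - alpha / (1 - beta)).
Proof.
elim: n => [|n IH]; first by rewrite /= expr0 mul1r.
rewrite exprS -[in RHS]mulrA -IH /=; have := beta1 => h.
by field; rewrite gt_eqF.
Qed.

Lemma p_le1 a : p a <= 1.
Proof. by rewrite -p_sum1 (bigD1 a)//= lerDl sumr_ge0// => i _; rewrite ltW. Qed.

Lemma O_totB : O 0 0 (fun w => totB (size w)).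
Proof.
pose c := alpha / (1 - beta).
have -> : (fun w : seq J => totB (size w)) =
    (fun w => c + beta ^+ size w * (\sum_a B0 a - c)).
  by apply/funext => w; rewrite -totB_cvg addrC subrK.
apply: poly_boundD; first exact: O_cst.
apply: (@poly_boundM _ _ _ _ _ 0 0 0 0); last exact: O_cst.
by apply: (@O_bounded _ 1) => w; have /andP[? ?] := betaX_itv w I; rewrite ger0_norm.
Qed.

Lemma O_dev a : O 0 0 (fun w => dev w a).
Proof.
apply: poly_boundB; last exact: (poly_boundM O_totB (O_cst _)).
have [C C0 CP] := O_totB; apply: (@O_bounded _ C) => w.
have := CP w I; rewrite !expr0 !mulr1; apply: le_trans.
rewrite !ger0_norm ?urnB_ge0 ?totB_ge0// -urnB_sum (bigD1 a)//= lerDl sumr_ge0// => i _.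
exact: urnB_ge0.
Qed.

Lemma O_theta a : O 0 0 (fun w => theta w a).
Proof. exact: (poly_boundM (O_dev a) (O_cst _)). Qed.

Lemma O_phi_theta a : O 1 0 (fun w => phi w a - theta w a).
Proof.
apply: (@poly_boundE _ _ _ _ _ _ _ _ (fun w => dev w a * (beta ^+ size w *
    ((alpha / (1 - beta) - \sum_a B0 a) / (b + totB (size w)) / lim_tot)))).
  move=> w _; rewrite phi_dev /theta.
  have h1 := tot_gt0 (size w); have h2 := lim_tot_gt0.
  have E : lim_tot - (b + totB (size w))
      = beta ^+ size w * (alpha / (1 - beta) - \sum_a0 B0 a0).
    by rewrite -[in RHS]opprB mulrN -totB_cvg /lim_tot; ring.
  rewrite [RHS](_ : _ = dev w a * ((lim_tot - (b + totB (size w)))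
    / (b + totB (size w)) / lim_tot)); last by rewrite E; ring.
  by field; rewrite !gt_eqF.
apply: (@poly_boundM _ _ _ _ _ 0 0 1 0); first exact: O_dev.
apply: (@poly_boundM _ _ _ _ _ 1 0 0 0).
  by exists 1 => // w _; rewrite expr1 expr0 mulr1 mul1r ger0_norm//; have /andP[] := betaX_itv w I.
apply: (@poly_boundM _ _ _ _ _ 0 0 0 0); last exact: O_cst.
apply: (@poly_boundM _ _ _ _ _ 0 0 0 0); first exact: O_cst.
apply: (@O_bounded _ b^-1) => w; rewrite ger0_norm ?invr_ge0 ?(ltW (tot_gt0 _))//.
by rewrite lef_pV2 ?posrE ?tot_gt0// lerDl totB_ge0.
Qed.

(** The increment of [centred] is that of [mart] plus [phi], and [phi] is nearly
    [theta], a multiple of [dev]. As the increment of [dev] is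
    [- (1 - beta) * dev + alpha * phi] plus a multiple of that of [mart], a
    combination of [centred] and [dev] has [scal] times the increment of [mart], up
    to a multiple of [phi - theta], which is summable; and [dev] is bounded. *)
Lemma centred_mart_close a :
  exists2 C, 0 <= C & forall w, `|centred w a - scal * mart w a| <= C.
Proof.
have [C1 C10 dC] := O_dev a; have [C2 C20 tC] := O_phi_theta a.
pose kap := (lim_tot * (1 - gam))^-1.
pose F w := centred w a + kap * dev w a - scal * mart w a.
have h1 := lim_tot_gt0; have h2 := gam_lt1; have h3 := beta1; have h4 := scal_gt0.
have FS j w : F (j :: w) - F w = scal * (phi w a - theta w a).
  (* The weight [kap] of [dev] is the one for which its contraction balances
     [scal * phi]. *)
  have e1 : 1 + kap * alpha = scal.
    have -> : alpha = gain * lim_tot by rewrite /gain divfK ?gt_eqF.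
    rewrite /kap /scal (_ : gain = gam - beta); last by rewrite /gam; ring.
    by field; rewrite !gt_eqF.
  have e2 : kap * (1 - beta) = scal / lim_tot by rewrite /kap /scal; field; rewrite !gt_eqF.
  rewrite /F dev_cons /= (_ : draw w a = p a + phi w a); last by rewrite /phi; ring.
  rewrite (_ : theta w a = dev w a / lim_tot)//.
  rewrite [RHS]mulrBr [scal * (_ / _)]mulrCA [_ * (scal / _)]mulrC -e2 -e1.
  ring.
have FC w : `|F w| <= `|F [::]| + scal * C2 * \sum_(i < size w) beta ^+ i.
  elim: w => [|j w IH]; first by rewrite /= big_ord0 mulr0 addr0.
  have -> : F (j :: w) = F w + scal * (phi w a - theta w a).
    by rewrite -(FS j) addrC subrK.
  rewrite [size _]/= big_ord_recr/= [in leRHS]mulrDr [leRHS]addrA.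
  apply: (le_trans (ler_normD _ _)); apply: lerD => //.
  rewrite normrM (gtr0_norm h4) -mulrA; apply: (ler_wpM2l (ltW h4)).
  by have /= := tC w I; rewrite expr1 expr0 mulr1.
pose C3 := `|F [::]| + scal * C2 / (1 - beta).
have h40 := ltW h4; have h30 := ltW h3.
exists (C3 + `|kap| * C1).
  apply: addr_ge0; last exact: mulr_ge0.
  by apply: addr_ge0 => //; apply: divr_ge0 => //; exact: mulr_ge0.
move=> w; rewrite (_ : _ - _ = F w - kap * dev w a); last by rewrite /F; ring.
apply: (le_trans (ler_normB _ _)); apply: lerD.
  apply: (le_trans (FC w)); rewrite lerD2l; apply: ler_wpM2l; first exact: mulr_ge0.
  exact: sum_betaX_le.
by rewrite normrM ler_wpM2l//; have := dC w I; rewrite !expr0 !mulr1.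
Qed.

Lemma mart_step w j a : `|mart (j :: w) a - mart w a| <= 1.
Proof.
rewrite /= addrC addKr; have := draw_ge0 w a; have := draw_le1 w a.
by case: (j == a) => /= h1 h2; rewrite ler_norml; apply/andP; split; lra.
Qed.

Lemma draw_pred w a : \sum_j draw w j * (j == a)%:R = draw w a.
Proof.
by rewrite (bigD1 a)//= eqxx mulr1 big1 ?addr0// => j /negPf ->; rewrite mulr0.
Qed.

Lemma mart_avg0 w a : \sum_j draw w j * (mart (j :: w) a - mart w a) = 0.
Proof.
under eq_bigr do rewrite /= [mart w a + _]addrC addrK mulrBr.
by rewrite sumrB draw_pred -mulr_suml draw_sum1 mul1r subrr.
Qed.

Lemma mart_sum0 w : \sum_a mart w a = 0.
Proof.
elim: w => [|j w IH] /=; first by rewrite big1.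
rewrite big_split/= IH add0r sumrB draw_sum1 (bigD1 j)//= eqxx big1 ?addr0 ?subrr//.
by move=> a /negPf; rewrite eq_sym => ->.
Qed.

(** The draws have conditional covariance [diag p - p p^T + lcov phi - phi phi^T]. Up to
    the difference of [phi] and [theta], this is a multiple of [diag p - p p^T] minus
    the average increment of [cx * lcov theta + cy * theta theta^T]: the average of
    [lcov theta] after a draw is [gam * lcov theta], and that of [theta theta^T] is
    [(gam ^+ 2 - gain ^+ 2) * theta theta^T
     + gain ^+ 2 * (diag p - p p^T + lcov theta)].
    The two constants cancel the coefficients of [theta theta^T] and of [lcov theta],
    and leave [1 + cy * gain ^+ 2] for [diag p - p p^T]. *)
Let cy : R := - (1 - gam ^+ 2 + gain ^+ 2)^-1.
Let cx : R := (1 + gam) / (1 - gam ^+ 2 + gain ^+ 2).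
Let sp a : R := Num.sqrt (p a).
Let dl (a c : J) : R := (a == c)%:R.
Let sc a c : R := scal ^+ 2 / (sp a * sp c).

Definition lcov (v : J -> R) a c : R := v a * dl a c - p a * v c - p c * v a.

Definition corrector w a c : R :=
  sc a c * (cx * lcov (theta w) a c + cy * (theta w a * theta w c)).

(** Divided by [sp], the multinomial covariance [diag p - p p^T] becomes the orthogonal
    projection [cov_lim] onto the hyperplane orthogonal to [sp]. *)
Definition norm_mart w a : R := scal / sp a * mart w a.

Definition cov_lim a c : R := dl a c - sp a * sp c.

Lemma sp_gt0 a : 0 < sp a. Proof. by rewrite sqrtr_gt0. Qed.
Lemma sp_sqr a : sp a ^+ 2 = p a. Proof. by rewrite sqr_sqrtr// ltW. Qed.

(** Replacing [phi], which involves the current total mass of the urn, by [theta]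
    makes the corrector equation exact; hence the defect is linear in their
    difference, with coefficients that are bounded along the words. *)
Lemma corrector_eq w a c :
  \sum_j draw w j * ((norm_mart (j :: w) a - norm_mart w a)
      * (norm_mart (j :: w) c - norm_mart w c) + corrector (j :: w) a c)
  - corrector w a c - lam * cov_lim a c =
  sc a c * ((phi w a - theta w a) * ((1 + cx * gain + cy * gain ^+ 2) * (dl a c - p c)
                 - phi w c + cy * beta * gain * theta w c)
            + (phi w c - theta w c) * (- (1 + cx * gain + cy * gain ^+ 2) * p a
                 - theta w a + cy * beta * gain * theta w a)).
Proof.
have s0 : sp a != 0 by rewrite gt_eqF ?sp_gt0.
have s1 : sp c != 0 by rewrite gt_eqF ?sp_gt0.
have g0 : 1 - gam != 0 by rewrite gt_eqF ?gam_lt1.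
have d0 : 1 - gam ^+ 2 + gain ^+ 2 != 0 by rewrite gt_eqF ?den_gt0.
set ta := theta w a; set tc := theta w c.
set fa := phi w a; set fc := phi w c; set d := dl a c.
have dlE j : (j == a)%:R * (j == c)%:R = (j == a)%:R * d :> R.
  by rewrite /d /dl; case: eqP => [->//|_]; rewrite !mul0r.
have da : draw w a = p a + fa by rewrite /fa /phi; ring.
have dc : draw w c = p c + fc by rewrite /fc /phi; ring.
(* The summand is affine in the indicators of [j == a] and [j == c]. *)
pose u0 := sc a c * (draw w a * draw w c
  + cx * (beta * lcov (theta w) a c + gain * (- p a * d + 2 * p a * p c))
  + cy * ((beta * ta - gain * p a) * (beta * tc - gain * p c))).
pose ua := sc a c * (d - draw w c + cx * gain * (d - p c)
  + cy * (gain ^+ 2 * d + gain * (beta * tc - gain * p c))).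
pose uc := sc a c * (- draw w a - cx * gain * p a
  + cy * gain * (beta * ta - gain * p a)).
have E j : (norm_mart (j :: w) a - norm_mart w a)
      * (norm_mart (j :: w) c - norm_mart w c) + corrector (j :: w) a c
    = u0 + ua * (j == a)%:R + uc * (j == c)%:R.
  have -> : (norm_mart (j :: w) a - norm_mart w a)
      * (norm_mart (j :: w) c - norm_mart w c)
      = sc a c * ((j == a)%:R * (j == c)%:R - (j == a)%:R * draw w c
                  - (j == c)%:R * draw w a + draw w a * draw w c).
    by rewrite /norm_mart /sc /=; field; rewrite s0 s1.
  rewrite dlE /corrector /lcov !theta_cons -/ta -/tc -/d.
  have -> : cy * ((beta * ta + gain * ((j == a)%:R - p a))
      * (beta * tc + gain * ((j == c)%:R - p c))) =
    cy * ((beta * ta - gain * p a) * (beta * tc - gain * p c)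
      + gain * (beta * tc - gain * p c) * (j == a)%:R
      + gain * (beta * ta - gain * p a) * (j == c)%:R
      + gain ^+ 2 * ((j == a)%:R * (j == c)%:R)) by ring.
  by rewrite dlE /u0 /ua /uc /lcov -/ta -/tc -/d; ring.
have -> : \sum_j draw w j * ((norm_mart (j :: w) a - norm_mart w a)
      * (norm_mart (j :: w) c - norm_mart w c) + corrector (j :: w) a c)
    = u0 + ua * draw w a + uc * draw w c.
  transitivity (\sum_j (u0 * draw w j + ua * (draw w j * (j == a)%:R)
                       + uc * (draw w j * (j == c)%:R))).
    by apply: eq_bigr => j _; rewrite E; ring.
  by rewrite !big_split/= -!mulr_sumr !draw_pred draw_sum1 mulr1.
have -> : lam * cov_lim a c = sc a c * ((1 - gam ^+ 2) / (1 - gam ^+ 2 + gain ^+ 2)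
    * (p a * d - p a * p c)).
  have -> : p a * d - p a * p c = sp a * sp c * (d - sp a * sp c).
    by rewrite -!sp_sqr /d /dl; case: eqP => [->|_] /=; ring.
  by rewrite /lam /cov_lim /sc -/d; field; rewrite s0 s1 d0.
rewrite /u0 /ua /uc /corrector /lcov -/ta -/tc -/d da dc -/fa -/fc /cx /cy.
rewrite (_ : beta = gam - gain); last by rewrite /gam; ring.
by field.
Qed.

Lemma O_phi a : O 0 0 (fun w => phi w a).
Proof.
apply: (@O_bounded _ 1) => w; rewrite /phi.
have h1 := draw_ge0 w a; have h2 := draw_le1 w a.
have h3 := p_gt0 a; have h4 := p_le1 a.
by rewrite ler_norml; apply/andP; split; lra.
Qed.

Lemma O_theta2 a c : O 0 0 (fun w => theta w a * theta w c).
Proof. exact: (poly_boundM (O_theta a) (O_theta c)). Qed.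

Lemma O_corrector a c : O 0 0 (fun w => corrector w a c).
Proof.
apply: (poly_boundM (O_cst _)); apply: poly_boundD; last first.
  exact: (poly_boundM (O_cst _) (O_theta2 a c)).
apply: (poly_boundM (O_cst _)); apply: poly_boundB; first apply: poly_boundB.
- exact: (poly_boundM (O_theta a) (O_cst _)).
- exact: (poly_boundM (O_cst _) (O_theta c)).
- exact: (poly_boundM (O_cst _) (O_theta a)).
Qed.

Lemma O_corrector_eq a c : O 1 0 (fun w =>
  \sum_j draw w j * ((norm_mart (j :: w) a - norm_mart w a)
      * (norm_mart (j :: w) c - norm_mart w c) + corrector (j :: w) a c)
  - corrector w a c - lam * cov_lim a c).
Proof.
apply: (poly_boundE (fun w _ => corrector_eq w a c)).
apply: (@poly_boundM _ _ _ _ _ 0 0 1 0); first exact: O_cst.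
apply: poly_boundD.
  apply: (@poly_boundM _ _ _ _ _ 1 0 0 0); first exact: O_phi_theta.
  apply: poly_boundD; first apply: poly_boundB.
  - exact: O_cst.
  - exact: O_phi.
  - exact: (poly_boundM (O_cst _) (O_theta c)).
apply: (@poly_boundM _ _ _ _ _ 1 0 0 0); first exact: O_phi_theta.
apply: poly_boundD; first apply: poly_boundB.
- exact: O_cst.
- exact: O_theta.
- exact: (poly_boundM (O_cst _) (O_theta a)).
Qed.

Lemma card_gt0 : (0 < #|J|)%N.
Proof.
rewrite lt0n; apply/eqP => J0.
have := p_sum1; rewrite big_pred0; last exact: (card0_eq J0).
by move/eqP; rewrite eq_sym oner_eq0.
Qed.

Lemma cov_lim_trace : \sum_a cov_lim a a = #|J|.-1%:R.
Proof.
rewrite /cov_lim; under eq_bigr do rewrite /dl eqxx -expr2 sp_sqr.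
by rewrite sumrB sumr_const p_sum1 -[in LHS](prednK card_gt0) mulrSr addrK.
Qed.

(** As [mart] has sum [0], [norm_mart] is orthogonal to [sp]. *)
Lemma cov_lim_quad w :
  \sum_a \sum_c cov_lim a c * (norm_mart w a * norm_mart w c)
  = \sum_a norm_mart w a ^+ 2.
Proof.
have z : \sum_a sp a * norm_mart w a = 0.
  rewrite -[RHS](mulr0 scal) -[in RHS](mart_sum0 w) mulr_sumr.
  apply: eq_bigr => a _; rewrite /norm_mart.
  by have := sp_gt0 a => ?; field; rewrite gt_eqF.
transitivity (\sum_a norm_mart w a ^+ 2
    - (\sum_a sp a * norm_mart w a) * (\sum_a sp a * norm_mart w a)).
  rewrite big_distrlr/= -sumrB; apply: eq_bigr => a _.
  transitivity (\sum_c (dl a c * (norm_mart w a * norm_mart w c)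
      - sp a * norm_mart w a * (sp c * norm_mart w c))).
    by apply: eq_bigr => c _; rewrite /cov_lim; ring.
  rewrite sumrB; congr (_ - _); rewrite (bigD1 a)//= big1 ?addr0.
    by rewrite /dl eqxx mul1r expr2.
  by move=> c /negPf; rewrite /dl eq_sym => ->; rewrite mul0r.
by rewrite z mulr0 subr0.
Qed.

Lemma norm_mart_laplace_cvg s : 0 <= s ->
  path_exp draw N (fun w => expR (- (s / N%:R * \sum_a norm_mart w a ^+ 2)))
    @[N --> \oo] --> expR (- (#|J|.-1%:R / 2 * ln (1 + 2 * (lam * s)))).
Proof.
move=> s0.
have /choice[K1 K1P] (ac : J * J) : exists C, 0 <= C /\
    forall w, `|corrector w ac.1 ac.2| <= C.
  have [C C0 CP] := O_corrector ac.1 ac.2; exists C; split => // w.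
  by have /= := CP w I; rewrite !expr0 !mulr1.
have /choice[K2 K2P] (ac : J * J) : exists C, 0 <= C /\ forall w,
    `|\sum_j draw w j * ((norm_mart (j :: w) ac.1 - norm_mart w ac.1)
      * (norm_mart (j :: w) ac.2 - norm_mart w ac.2) + corrector (j :: w) ac.1 ac.2)
      - corrector w ac.1 ac.2 - lam * cov_lim ac.1 ac.2| <= C * beta ^+ size w.
  have [C C0 CP] := O_corrector_eq ac.1 ac.2; exists C; split => // w.
  by have /= := CP w I; rewrite expr1 expr0 mulr1.
pose K1' := \sum_ac K1 ac; pose K2' := \sum_ac K2 ac.
pose K3' := \sum_a (scal / sp a).
have K1'_ge0 : 0 <= K1' by apply: sumr_ge0 => ac _; have [] := K1P ac.
have K2'_ge0 : 0 <= K2' by apply: sumr_ge0 => ac _; have [] := K2P ac.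
have b1 := beta1; have ssp a : 0 <= scal / sp a.
  by rewrite ltW// divr_gt0 ?scal_gt0 ?sp_gt0.
have K3'_ge0 : 0 <= K3' by apply: sumr_ge0.
have K4_ge0 : 0 <= K2' / (1 - beta) by rewrite divr_ge0// ltW.
pose K := K1' + K2' / (1 - beta) + K3'.
have bn n : 0 <= beta ^+ n by rewrite exprn_ge0// beta_ge0.
apply: (@MartingaleCLT.path_exp_laplace_cvg R J J draw norm_mart corrector cov_lim
  K lam #|J|.-1 (fun n => K2' * beta ^+ n)) => //.
- exact: draw_ge0.
- exact: draw_sum1.
- exact: lam_ge0.
- move=> w j a; rewrite /norm_mart -mulrBr normrM.
  apply: (@le_trans _ _ (scal / sp a)).
    by rewrite ger0_norm// ler_piMr// mart_step.
  apply: (@le_trans _ _ K3'); last by rewrite /K; lra.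
  by rewrite /K3' (bigD1 a)//= lerDl sumr_ge0.
- move=> w a; rewrite /norm_mart; under eq_bigr do rewrite -mulrBr mulrCA.
  by rewrite -mulr_sumr mart_avg0 mulr0.
- move=> w a c; have [_ /(_ w) h] := K1P (a, c); apply: (le_trans h).
  apply: (@le_trans _ _ K1'); last by rewrite /K; lra.
  by rewrite /K1' (bigD1 (a, c))//= lerDl sumr_ge0// => ac _; have [] := K1P ac.
- move=> w a c; have [_ /(_ w) h] := K2P (a, c); apply: (le_trans h).
  rewrite ler_wpM2r//.
  by rewrite /K2' (bigD1 (a, c))//= lerDl sumr_ge0// => ac _; have [] := K2P ac.
- by move=> n; rewrite mulr_ge0.
- move=> n; rewrite -mulr_sumr; apply: (@le_trans _ _ (K2' / (1 - beta))).
    by rewrite ler_wpM2l// sum_betaX_le.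
  by rewrite /K; lra.
- exact: cov_lim_trace.
- exact: cov_lim_quad.
Qed.

(** [centred] and [scal * mart] differ by a bounded quantity, which vanishes at the
    scale [sqrt N]. *)
Theorem centred_laplace_cvg s : 0 <= s ->
  path_exp draw N (fun w => expR (- (s / N%:R * \sum_a centred w a ^+ 2 / p a)))
    @[N --> \oo] --> expR (- (#|J|.-1%:R / 2 * ln (1 + 2 * (lam * s)))).
Proof.
move=> s0.
have /choice[C CP] a : exists C, 0 <= C /\
    forall w, `|centred w a - scal * mart w a| <= C.
  by have [C ? ?] := centred_mart_close a; exists C.
pose K := \sum_a C a / sp a.
have CK a : 0 <= C a / sp a.
  by have [h _] := CP a; apply: divr_ge0 => //; rewrite ltW ?sp_gt0.
have K0 : 0 <= K by exact: sumr_ge0.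
pose e N : R := Num.sqrt (s / N%:R).
have e0 N : 0 <= e N by exact: sqrtr_ge0.
have e2 N : e N ^+ 2 = s / N%:R by rewrite sqr_sqrtr// divr_ge0.
have close N w : e N * K <= 1 ->
    `|expR (- (s / N%:R * \sum_a centred w a ^+ 2 / p a))
      - expR (- (s / N%:R * \sum_a norm_mart w a ^+ 2))|
    <= (3 * #|J|%:R + 2) * (e N * K).
  move=> eK.
  have -> : s / N%:R * \sum_a centred w a ^+ 2 / p a
      = \sum_a (e N * (centred w a / sp a)) ^+ 2.
    rewrite -e2 mulr_sumr; apply: eq_bigr => a _.
    by rewrite exprMn expr_div_n sp_sqr.
  have -> : s / N%:R * \sum_a norm_mart w a ^+ 2 = \sum_a (e N * norm_mart w a) ^+ 2.
    by rewrite -e2 mulr_sumr; apply: eq_bigr => a _; rewrite [RHS]exprMn.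
  apply: expRN_sumsq_close => [|a]; first by rewrite mulr_ge0.
  rewrite -mulrBr normrM (ger0_norm (e0 N)) ler_wpM2l//.
  have -> : centred w a / sp a - norm_mart w a
      = (centred w a - scal * mart w a) / sp a.
    by rewrite /norm_mart; have := sp_gt0 a => ?; field; rewrite gt_eqF.
  rewrite normrM [X in _ * X]ger0_norm ?invr_ge0 ?(ltW (sp_gt0 _))//.
  apply: (@le_trans _ _ (C a / sp a)).
    by rewrite ler_wpM2r ?invr_ge0 ?(ltW (sp_gt0 _))//; have [_] := CP a; exact.
  by rewrite /K (bigD1 a)//= lerDl sumr_ge0.
have ecvg : e N * K @[N --> \oo] --> (0 : R).
  rewrite -[X in _ --> X](mul0r K); apply: cvgMl; exact: MartingaleCLT.eps_cvg0.
rewrite -[X in _ --> X]addr0.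
pose u N := path_exp draw N (fun w => expR (- (s / N%:R * \sum_a norm_mart w a ^+ 2))).
pose v N := path_exp draw N (fun w => expR (- (s / N%:R * \sum_a centred w a ^+ 2 / p a))).
rewrite (_ : path_exp draw^~ _ = (fun N => u N + (v N - u N))); last first.
  by apply/funext => N; rewrite addrC subrK.
apply: cvgD; first exact: norm_mart_laplace_cvg.
apply/cvgrPdist_le => d d0.
have c0 : 0 < 3 * #|J|%:R + 2 :> R by rewrite ltr_wpDl// mulr_ge0.
near=> N; rewrite sub0r normrN /u /v -path_expB.
apply: (norm_path_exp_le draw_ge0 draw_sum1) => w _.
apply: (le_trans (close N w _)).
  near: N; move/cvgrPdist_le : ecvg => /(_ 1 ltr01).
  by apply: filterS => N; rewrite sub0r normrN => /(le_trans (ler_norm _)).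
rewrite -ler_pdivlMl// [leRHS]mulrC.
near: N; move/cvgrPdist_le : ecvg => /(_ (d / (3 * #|J|%:R + 2))).
rewrite divr_gt0// => /(_ isT).
by apply: filterS => N; rewrite sub0r normrN => /(le_trans (ler_norm _)).
Unshelve. all: by end_near. Qed.

(** Convexity of the fourth power gives the factor [8] in
    [(x + y) ^+ 4 <= 8 * x ^+ 4 + 8 * y ^+ 4]. *)
Theorem centred_pow4_le a : exists2 C, 0 <= C & forall N, (0 < N)%N ->
  path_exp draw N (fun w => centred w a ^+ 4) <= C * N%:R ^+ 2.
Proof.
have [C C0 CP] := centred_mart_close a.
have sc0 := ltW scal_gt0.
exists (88 * scal ^+ 4 + 8 * C ^+ 4).
  by rewrite addr_ge0// mulr_ge0// exprn_ge0.
move=> N N0; apply: (@le_trans _ _ (path_exp draw N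
    (fun w => 8 * scal ^+ 4 * mart w a ^+ 4 + 8 * C ^+ 4))).
  apply: (le_path_exp draw_ge0) => w _.
  set x := scal * mart w a; set y := centred w a - x.
  have -> : centred w a = x + y by rewrite /y addrC subrK.
  have y4 : y ^+ 4 <= C ^+ 4.
    have -> : y ^+ 4 = `|y| ^+ 4.
      rewrite (_ : `|y| ^+ 4 = (`|y| ^+ 2) ^+ 2); last by ring.
      by rewrite real_normK ?num_real//; ring.
    by rewrite ler_pXn2r ?nnegrE//; exact: CP.
  have -> : 8 * scal ^+ 4 * mart w a ^+ 4 = 8 * x ^+ 4 by rewrite /x; ring.
  apply: (@le_trans _ _ (8 * x ^+ 4 + 8 * y ^+ 4)); last by rewrite lerD2l ler_wpM2l.
  rewrite -subr_ge0.
  have -> : 8 * x ^+ 4 + 8 * y ^+ 4 - (x + y) ^+ 4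
      = (x - y) ^+ 2 * (5 * (x + y) ^+ 2 + 2 * x ^+ 2 + 2 * y ^+ 2) by ring.
  by rewrite mulr_ge0 ?sqr_ge0// !addr_ge0// mulr_ge0 ?sqr_ge0.
rewrite path_expD path_exp_cst ?path_expZ; last exact: draw_sum1.
have h := path_exp_pow4_le draw_ge0 draw_sum1 (M := fun w => mart w a) erefl
  (fun w j => mart_step w j a) (fun w => mart_avg0 w a) N.
have N1 : 1 <= N%:R ^+ 2 :> R by rewrite expr_ge1// ler1n.
rewrite [leRHS]mulrDl; apply: lerD.
  rewrite (_ : 88 * _ * _ = 8 * scal ^+ 4 * (11 * N%:R ^+ 2)); last by ring.
  by rewrite ler_wpM2l// mulr_ge0// exprn_ge0.
by rewrite ler_peMr// mulr_ge0// exprn_ge0.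
Qed.

End urn_path.
End UrnPath.

(** * Polynomial approximation on the unit interval *)

Section weierstrass.
Context {R : realType}.

Lemma uniform_continuity01 (F : R -> R) (e : R) : continuous F -> 0 < e ->
  exists2 d, 0 < d & forall y z, 0 <= y <= 1 -> `|z - y| < d -> `|F z - F y| <= e.
Proof.
move=> cF e0.
have /compact_near_coveringP cov : compact `[0 : R, 1]%classic.
  exact: segment_compact.
pose Pr (n : nat) (y : R) := forall z, `|z - y| < n.+1%:R^-1 -> `|F z - F y| <= e.
have /cov [n _ nP] : forall x, `[0 : R, 1]%classic x ->
    \forall x' \near x & n \near \oo, Pr n x'.
  move=> x _; have e2 : 0 < e / 2 by rewrite divr_gt0.
  have /cvgrPdist_le /(_ _ e2) /nbhs_ballP[d /= d0 dP] := cF x.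
  have d2 : 0 < d / 2 by rewrite divr_gt0.
  exists (ball x (d / 2), [set n | n.+1%:R^-1 < d / 2]); first split => /=.
  - exact: nbhsx_ballx.
  - exact: (near_infty_natSinv_lt (PosNum d2)).
  move=> [x' n] /= [xx' nd] z zx'.
  have h1 : `|F x - F x'| <= e / 2.
    by apply: dP; apply: lt_trans xx' _; lra.
  have h2 : `|F x - F z| <= e / 2.
    have xx2 : `|x - x'| < d / 2 := xx'.
    have zx2 : `|z - x'| < d / 2 := lt_trans zx' nd.
    apply: dP; suff : `|x - z| < d by [].
    rewrite (_ : x - z = (x - x') - (z - x')); last by ring.
    apply: (le_lt_trans (ler_normB _ _)).
    by rewrite [ltRHS](splitr d) ltrD.
  rewrite (_ : F z - F x' = (F x - F x') - (F x - F z)); last by ring.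
  by apply: (le_trans (ler_normB _ _)); lra.
exists n.+1%:R^-1 => // y z y01 zy.
by apply: (nP n (leqnn n)) => //=; rewrite in_itv.
Qed.

Let coin (y : R) (w : seq bool) (j : bool) : R := if j then y else 1 - y.
Let heads (w : seq bool) : R := \sum_(j <- w) j%:R.

Lemma coin_horner n (f : seq bool -> {poly R}) : exists P : {poly R},
  forall y, path_exp (coin y) n (fun w => (f w).[y]) = P.[y].
Proof.
elim: n f => [|n IH] f; first by exists (f [::]).
have [P PE] := IH (fun w => 'X * f (true :: w) + (1 - 'X) * f (false :: w)).
exists P => y; rewrite -PE /=; apply: eq_path_exp => w _.
by rewrite big_bool /= !hornerE.
Qed.

(** Bernstein's argument: the average of [F] over the frequency of heads is a
    polynomial in the bias, and the frequency concentrates at the bias by the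
    second moment bound for bounded martingale increments. *)
Theorem weierstrass01 (F : R -> R) (e : R) : continuous F -> 0 < e ->
  exists P : {poly R}, forall y, 0 <= y <= 1 -> `|F y - P.[y]| <= e.
Proof.
move=> cF e0; have e2 : 0 < e / 2 by rewrite divr_gt0.
have [d d0 dP] := uniform_continuity01 cF e2.
have [M M0 FM] : exists2 M, 0 <= M & forall y, 0 <= y <= 1 -> `|F y| <= M.
  have cnF : {within `[0 : R, 1]%classic, continuous (fun x => `|F x|)}.
    by apply: continuous_subspaceT => x; apply: cvg_norm; exact: cF.
  have [c _ cP] := EVT_max ler01 cnF.
  by exists `|F c| => // y y01; apply: cP; rewrite in_itv.
pose K := 2 * M / d ^+ 2.
have K0 : 0 <= K by apply: divr_ge0; [exact: mulr_ge0|exact: sqr_ge0].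
have FK y z : 0 <= y <= 1 -> 0 <= z <= 1 -> `|F y - F z| <= e / 2 + K * (z - y) ^+ 2.
  move=> y01 z01; have [zy|dz] := ltP `|z - y| d.
    rewrite distrC; apply: (le_trans (dP y z y01 zy)).
    by rewrite lerDl mulr_ge0// sqr_ge0.
  have h : d ^+ 2 <= (z - y) ^+ 2.
    by rewrite -[leRHS]real_normK ?num_real// ler_pXn2r ?nnegrE// ltW.
  have : 2 * M <= K * (z - y) ^+ 2.
    by rewrite /K mulrAC ler_pdivlMr ?exprn_gt0// ler_wpM2l// mulr_ge0.
  have := ler_normB (F y) (F z); have := FM _ y01; have := FM _ z01; lra.
pose n := (Num.truncn (K / (e / 2))).+1.
have n0 : 0 < n%:R :> R by rewrite ltr0n.
have nK : K / n%:R <= e / 2.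
  by rewrite ler_pdivrMr// mulrC -ler_pdivrMr// ltW// truncnS_gt.
have [P PE] := coin_horner n (fun w => (F (heads w / n%:R))%:P).
exists P => y y01; rewrite -PE.
have -> : path_exp (coin y) n (fun w => (F (heads w / n%:R))%:P.[y])
    = path_exp (coin y) n (fun w => F (heads w / n%:R)).
  by apply: eq_path_exp => w _; rewrite hornerC.
have [y0 y1] := andP y01.
have q0 w j : 0 <= coin y w j by rewrite /coin; case: j => //; rewrite subr_ge0.
have q1 w : \sum_j coin y w j = 1 by rewrite big_bool /coin /= addrC subrK.
have hw w : size w = n -> 0 <= heads w / n%:R <= 1.
  move=> wn; rewrite divr_ge0 ?sumr_ge0//= ler_pdivrMr// mul1r -wn.
  rewrite /heads -sum1_size natr_sum; apply: ler_sum => j _.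
  by case: j.
pose mart w := heads w - (size w)%:R * y.
have martS j w : mart (j :: w) - mart w = j%:R - y.
  by rewrite /mart /heads big_cons /= -natr1; ring.
have sq : path_exp (coin y) n (fun w => mart w ^+ 2) <= n%:R.
  apply: path_exp_sqr_le => //.
  - by rewrite /mart /heads big_nil mul0r subrr.
  - move=> w j; rewrite martS ler_norml; case: j => /=; lra.
  - by move=> w; rewrite big_bool/= !martS /coin /=; ring.
rewrite -(path_exp_cst q1 n (F y)) -path_expB.
apply: (@le_trans _ _ (path_exp (coin y) n (fun w => e / 2 + K / n%:R ^+ 2 * mart w ^+ 2))).
  have h w : size w = n ->
      `|F y - F (heads w / n%:R)| <= e / 2 + K / n%:R ^+ 2 * mart w ^+ 2.
    move=> wn; apply: (le_trans (FK _ _ y01 (hw w wn))); rewrite lerD2l.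
    rewrite le_eqVlt /mart wn; apply/orP; left; apply/eqP; field.
    by rewrite gt_eqF.
  rewrite ler_norml; apply/andP; split; last first.
    by apply: le_path_exp => // w /h; rewrite ler_norml => /andP[].
  rewrite -mulN1r -path_expZ; apply: le_path_exp => // w /h.
  by rewrite ler_norml mulN1r => /andP[].
rewrite path_expD (path_exp_cst q1) path_expZ.
rewrite [leRHS](splitr e) lerD2l; apply: le_trans nK.
apply: (@le_trans _ _ (K / n%:R ^+ 2 * n%:R)).
  by rewrite ler_wpM2l// divr_ge0// exprn_ge0// ltW.
by rewrite le_eqVlt; apply/orP; left; apply/eqP; field; rewrite gt_eqF.
Qed.

End weierstrass.

(** * Laplace transforms and convergence in distribution *)

Section integral_bounded.
Context {R : realType} {d} {T : measurableType d} (P : probability T R).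
Implicit Types f g : T -> R.

Lemma bounded_integrable f M : measurable_fun setT f ->
  (forall t, `|f t| <= M) -> P.-integrable setT (EFin \o f).
Proof.
move=> mf fM; apply: (@le_integrable _ _ _ _ _ _ _ (cst M%:E)) => //.
- exact/measurable_EFinP.
- by move=> t _ /=; rewrite lee_fin; apply: (le_trans (fM t)); exact: ler_norm.
- exact: finite_measure_integrable_cst.
Qed.

Lemma expectation_Rintegral f M : measurable_fun setT f ->
  (forall t, `|f t| <= M) -> 'E_P[f]%E = (\int[P]_t f t)%:E.
Proof.
move=> mf fM; rewrite unlock /Rintegral fineK//.
apply: integrable_fin_num => //; exact: (bounded_integrable mf fM).
Qed.

Lemma Rintegral_probability_cst c : \int[P]_t c = c :> R.
Proof. by rewrite /Rintegral integral_cst//= probability_setT mule1. Qed.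

End integral_bounded.

Section laplace_continuity.
Context {R : realType} {d} {T : measurableType d} (P : probability T R).
Context {d'} {T' : measurableType d'} (P' : probability T' R).
Variables (X : nat -> T -> R) (Y : T' -> R).
Hypothesis mX : forall n, measurable_fun setT (X n).
Hypothesis mY : measurable_fun setT Y.
Hypothesis X_ge0 : forall n t, 0 <= X n t.
Hypothesis Y_ge0 : forall t, 0 <= Y t.

(* Bounded on the half-line where the variables take their values. *)
Let admissible (g : R -> R) :=
  measurable_fun setT g /\ exists M, forall x, 0 <= x -> `|g x| <= M.

Let converging (g : R -> R) :=
  \int[P]_t g (X n t) @[n --> \oo] --> \int[P']_t g (Y t).

Let intX g n : admissible g -> P.-integrable setT (EFin \o (fun t => g (X n t))).
Proof.
move=> [mg [M gM]]; apply: (@bounded_integrable _ _ _ _ _ M) => [|t]; last exact: gM.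
exact: measurableT_comp.
Qed.

Let intY g : admissible g -> P'.-integrable setT (EFin \o (fun t => g (Y t))).
Proof.
move=> [mg [M gM]]; apply: (@bounded_integrable _ _ _ _ _ M) => [|t]; last exact: gM.
exact: measurableT_comp.
Qed.

Let admissibleD g h : admissible g -> admissible h ->
  admissible (fun x => g x + h x).
Proof.
move=> [mg [M gM]] [mh [N hN]]; split; first exact: measurable_funD.
exists (M + N) => x x0; apply: (le_trans (ler_normD _ _)).
by apply: lerD; [exact: gM|exact: hN].
Qed.

Let admissibleZ c g : admissible g -> admissible (fun x => c * g x).
Proof.
move=> [mg [M gM]]; split; first exact: measurable_funM.
by exists (`|c| * M) => x x0; rewrite normrM ler_wpM2l// gM.
Qed.

Let convergingD g h : admissible g -> admissible h ->
  converging g -> converging h -> converging (fun x => g x + h x).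
Proof.
move=> ag ah cg ch; rewrite /converging (RintegralD measurableT (intY ag) (intY ah)).
rewrite (_ : (fun n => _) =
    (fun n => \int[P]_t g (X n t) + \int[P]_t h (X n t))); first exact: cvgD.
by apply/funext => n; rewrite (RintegralD measurableT (intX n ag) (intX n ah)).
Qed.

Let convergingZ c g : admissible g -> converging g ->
  converging (fun x => c * g x).
Proof.
move=> ag cg; rewrite /converging (RintegralZl _ measurableT (intY ag)).
rewrite (_ : (fun n => _) = (fun n => c * \int[P]_t g (X n t))); first exact: cvgMr.
by apply/funext => n; rewrite (RintegralZl _ measurableT (intX n ag)).
Qed.

(* The set of test functions for which the expectations converge is closed under
   approximation, where the error [h] is itself a test function of this set. *)
Let converging_approx f : admissible f ->
  (forall e, 0 < e -> exists g h, [/\ admissible g /\ admissible h,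
     converging g /\ converging h,
     forall x, 0 <= x -> `|f x - g x| <= h x &
     \int[P']_t h (Y t) <= e]) ->
  converging f.
Proof.
move=> af fP; apply/cvgrPdist_le => e e0.
have [|g [h [[ag ah] [cg ch] fgh hY]]] := fP (e / 4); first by rewrite divr_gt0.
have e4 : 0 < e / 4 by rewrite divr_gt0.
have YB : `|\int[P']_t f (Y t) - \int[P']_t g (Y t)| <= e / 4.
  rewrite -RintegralB//; [|exact: intY|exact: intY].
  have afg := admissibleD af (admissibleZ (-1) ag).
  have ifg : P'.-integrable setT (EFin \o (fun t => f (Y t) - g (Y t))).
    by apply: eq_integrable (intY afg) => // t _ /=; rewrite mulN1r.
  apply: (le_trans (le_normr_Rintegral _ _)) => //.
  apply: le_trans hY; apply: le_Rintegral => //.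
  - have := integrable_abse ifg; apply: eq_integrable => // t _.
  - exact: intY.
  - by move=> t _; exact: fgh.
have XB n : `|\int[P]_t f (X n t) - \int[P]_t g (X n t)| <= \int[P]_t h (X n t).
  rewrite -RintegralB//; [|exact: intX|exact: intX].
  have afg := admissibleD af (admissibleZ (-1) ag).
  have ifg : P.-integrable setT (EFin \o (fun t => f (X n t) - g (X n t))).
    by apply: eq_integrable (intX n afg) => // t _ /=; rewrite mulN1r.
  apply: (le_trans (le_normr_Rintegral _ _)) => //.
  apply: le_Rintegral => //.
  - have := integrable_abse ifg; apply: eq_integrable => // t _.
  - exact: intX.
  - by move=> t _; exact: fgh.
near=> n.
have hg : `|\int[P']_t g (Y t) - \int[P]_t g (X n t)| <= e / 4.
  by near: n; move/cvgrPdist_le : cg; exact.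
have hh : `|\int[P']_t h (Y t) - \int[P]_t h (X n t)| <= e / 4.
  by near: n; move/cvgrPdist_le : ch; exact.
have := XB n; move: YB hg hh hY.
set a := \int[P']_t f _; set b := \int[P']_t g _; set c := \int[P]_t g _.
set u := \int[P]_t f _; set v := \int[P]_t h _; set w := \int[P']_t h _.
rewrite !ler_norml => /andP[? ?] /andP[? ?] /andP[? ?] ? /andP[? ?].
by apply/andP; split; lra.
Unshelve. all: by end_near. Qed.

Hypothesis laplace_cvg : forall s, 0 <= s ->
  \int[P]_t expR (- (s * X n t)) @[n --> \oo] --> \int[P']_t expR (- (s * Y t)).
Hypothesis laplace_at0 : forall e : R, 0 < e ->
  exists2 s, 0 < s & 1 - e <= \int[P']_t expR (- (s * Y t)).

Let admissible_exp s : 0 <= s -> admissible (fun x => expR (- (s * x))).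
Proof.
move=> s0; split.
  by apply: measurableT_comp => //; apply: measurableT_comp => //; exact: measurable_funM.
by exists 1 => x x0; rewrite ger0_norm ?expR_ge0// expR_le1 oppr_le0 mulr_ge0.
Qed.

Let admissible_cst c : admissible (fun=> c).
Proof. by split => //; exists `|c|. Qed.

Let converging_cst c : converging (fun=> c).
Proof.
rewrite /converging !Rintegral_probability_cst; exact: cvg_cst.
Qed.

Let admissible_converging_horner s (p : {poly R}) : 0 <= s ->
  admissible (fun x => p.[expR (- (s * x))]) /\
  converging (fun x => p.[expR (- (s * x))]).
Proof.
move=> s0.
have -> : (fun x => p.[expR (- (s * x))]) =
    (fun x => \sum_(i < size p) p`_i * expR (- (i%:R * s * x))).
  apply/funext => x; rewrite horner_coef; apply: eq_bigr => i _.
  by rewrite -[in RHS]mulrA -[in RHS]mulrN expRM_natl.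
elim: (size p) => [|n [IHa IHc]].
  rewrite (_ : (fun x => _) = fun=> 0); last by apply/funext => x; rewrite big_ord0.
  by split; [exact: admissible_cst|exact: converging_cst].
have ns : 0 <= n%:R * s by rewrite mulr_ge0.
have aZ := admissibleZ p`_n (admissible_exp ns).
rewrite (_ : (fun x => _) = (fun x => \sum_(i < n) p`_i * expR (- (i%:R * s * x))
    + p`_n * expR (- (n%:R * s * x)))); last first.
  by apply/funext => x; rewrite big_ord_recr.
split; first exact: admissibleD.
apply: convergingD => //; apply: convergingZ; first exact: admissible_exp.
exact: laplace_cvg.
Qed.

(** Damped by an exponential, a bounded continuous function of [x] is a
    continuous function of [expR (- (s * x))] on the unit interval, hence is
    uniformly close to a combination of exponentials. *)
Let converging_damped (f : R -> R) s : continuous f -> (exists M, forall x, `|f x| <= M) ->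
  0 < s -> converging (fun x => f x * expR (- (s * x))).
Proof.
move=> cf [M fM] s0; have mf : measurable_fun setT f by exact: continuous_measurable_fun.
have [ae ame] := admissible_exp (ltW s0).
have M0 : 0 <= M by exact: le_trans (fM 0).
apply: converging_approx.
  split; first exact: measurable_funM.
  exists M => x x0; rewrite normrM -[leRHS]mulr1 ler_pM//.
  by rewrite ger0_norm ?expR_ge0// expR_le1 oppr_le0 mulr_ge0// ltW.
move=> e e0.
(* [F (expR (- (s * x)))] is the damped function; its extension by [0] at [y = 0],
   which is [x = +oo], is continuous as [f] is bounded. *)
pose F (y : R) := if 0 < y then f (- (ln y / s)) * y else 0.
have cF : continuous F.
  move=> y; have [y0|y0] := ltP 0 y.
    have cg : {for y, continuous (fun z : R => f (- (ln z / s)) * z)}.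
      apply: cvgM; last exact: cvg_id.
      apply: (@continuous_comp _ _ _ (fun z : R => - (ln z / s)) f); last exact: cf.
      by apply: cvgN; apply: cvgM; [exact: continuous_ln|exact: cvg_cst].
    rewrite /continuous_at {2}/F y0.
    apply: cvg_trans cg; apply: near_eq_cvg; near=> z.
    by rewrite /F ifT//; near: z; exact: lt_nbhsr.
  rewrite /continuous_at {2}/F ltNge y0 /=.
  apply/cvgrPdist_le => r r0.
  have FM z : `|F z| <= M * Num.max 0 z.
    rewrite /F; case: ifPn => [z0|]; last by rewrite normr0 mulr_ge0// le_max lexx.
    by rewrite normrM (gtr0_norm z0) ler_pM ?le_max ?lexx ?orbT// ltW.
  near=> z; rewrite sub0r normrN; apply: (le_trans (FM z)).
  apply: (@le_trans _ _ (M * (r / (1 + M)))); last first.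
    by rewrite mulrA ler_pdivrMr ?ltr_pwDl// mulrC ler_wpM2l ?(ltW r0)// lerDr.
  rewrite ler_wpM2l// ge_max divr_ge0 ?(ltW r0) ?addr_ge0//=.
  rewrite ltW//; near: z; apply: lt_nbhsl.
  by apply: (le_lt_trans y0); rewrite divr_gt0// ltr_pwDl.
have [p pP] := weierstrass01 cF e0.
have [ap cp] := admissible_converging_horner p (ltW s0).
exists (fun x => p.[expR (- (s * x))]), (fun=> e); split => //.
- move=> x x0; have -> : f x * expR (- (s * x)) = F (expR (- (s * x))).
    by rewrite /F expR_gt0 expRK mulNr opprK mulrAC divff ?mul1r// gt_eqF.
  by apply: pP; rewrite expR_ge0 expR_le1 oppr_le0 mulr_ge0// ltW.
- by rewrite Rintegral_probability_cst.
Unshelve. all: by end_near. Qed.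

(** Damping [f] by [expR (- (s * x))] costs at most [M * (1 - expR (- (s * x)))],
    whose expectations converge to that of the limit; this is small for a suitable
    [s], by the continuity at [0] of the limit transform. *)
Theorem laplace_cvg_in_distribution : cvg_in_distribution P X P' Y.
Proof.
move=> f cf [M fM]; have mf : measurable_fun setT f by exact: continuous_measurable_fun.
have M0 : 0 <= M by exact: le_trans (fM 0).
have af : admissible f by split => //; exists M => x _.
have mfY : measurable_fun setT (f \o Y) by exact: measurableT_comp.
have mfX n : measurable_fun setT (f \o X n) by exact: measurableT_comp.
rewrite (expectation_Rintegral P' mfY (fun t => fM (Y t))).
rewrite (_ : (fun n => _) = (fun n => (\int[P]_t f (X n t))%:E)); last first.
  by apply/funext => n; rewrite (expectation_Rintegral P (mfX n) (fun t => fM (X n t))).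
suff cvgf : converging f by apply/fine_cvgP; split => //; near=> n.
apply: converging_approx => // e e0.
have [|s s0 sP] := laplace_at0 (e := e / (1 + M)); first by rewrite divr_gt0// ltr_pwDl.
have as_ := admissible_exp (ltW s0).
exists (fun x => f x * expR (- (s * x))), (fun x => M + - M * expR (- (s * x))).
split.
- split; last by apply: admissibleD => //; exact: admissibleZ.
  split; first by apply: measurable_funM => //; case: as_.
  exists M => x x0; rewrite normrM -[leRHS]mulr1 ler_pM//.
  by rewrite ger0_norm ?expR_ge0// expR_le1 oppr_le0 mulr_ge0// ltW.
- split; first by apply: converging_damped => //; exists M.
  apply: (convergingD (admissible_cst M)) => //; first exact: admissibleZ.
  by apply: convergingZ => //; exact: laplace_cvg (ltW s0).
- move=> x x0; have ex1 : expR (- (s * x)) <= 1.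
    by rewrite expR_le1 oppr_le0 mulr_ge0// ltW.
  rewrite (_ : f x - _ = f x * (1 - expR (- (s * x)))); last by ring.
  rewrite (_ : M + _ = M * (1 - expR (- (s * x)))); last by ring.
  by rewrite normrM ler_pM// ger0_norm// subr_ge0.
- have /= e1 := RintegralD measurableT (intY (admissible_cst M))
    (intY (admissibleZ (- M) as_)).
  have /= e2 := RintegralZl (- M) measurableT (intY as_).
  rewrite e2 Rintegral_probability_cst in e1; rewrite [leLHS]e1.
  apply: (@le_trans _ _ (M * (e / (1 + M)))).
    by rewrite mulNr -[X in X - _]mulr1 -mulrBr ler_wpM2l// lerBlDl -lerBlDr.
  by rewrite mulrA ler_pdivrMr ?ltr_pwDl// mulrC ler_wpM2l ?(ltW e0)// lerDr.
Unshelve. all: by end_near. Qed.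

End laplace_continuity.

(** * Laws given by a density *)

Section density.
Context {R : realType} {d} {T : measurableType d}.
Variables (mu nu : {measure set T -> \bar R}) (p : T -> R).
Hypothesis mp : measurable_fun setT p.
Hypothesis p_ge0 : forall x, 0 <= p x.
Hypothesis nuE : forall A, measurable A -> nu A = (\int[mu]_(x in A) (p x)%:E)%E.
Local Open Scope ereal_scope.

Import HBNNSimple.

Let ge0_integral_density_nnsfun (h : {nnsfun T >-> R}) :
  \int[nu]_x (h x)%:E = \int[mu]_x ((h x)%:E * (p x)%:E).
Proof.
under [LHS]eq_integral do rewrite fimfunE -fsumEFin//.
rewrite [LHS]ge0_integral_fsum//; last 2 first.
  - by move=> r; exact/measurable_EFinP/measurableT_comp.
  - by move=> n x _; rewrite EFinM nnfun_muleindic_ge0.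
under [RHS]eq_integral.
  move=> x xD; rewrite fimfunE -fsumEFin// ge0_mule_fsuml; last first.
    by move=> r; rewrite EFinM nnfun_muleindic_ge0.
  over.
rewrite [RHS]ge0_integral_fsum//; last 2 first.
  - move=> r; apply: emeasurable_funM; last exact/measurable_EFinP.
    by apply/measurable_EFinP; apply/measurableT_comp.
  - move=> n x _; apply: mule_ge0; last by rewrite lee_fin.
    by rewrite EFinM nnfun_muleindic_ge0.
apply: eq_fsbigr => r _.
rewrite integralZl_indic_nnsfun//= integral_indic//= setIT nuE//.
under [RHS]eq_integral do rewrite EFinM -muleA.
have [r0|r0] := leP 0%R r.
  rewrite [RHS]ge0_integralZl//.
  - congr (_ * _); rewrite integral_mkcond; apply: eq_integral => x _.
    by rewrite patchE indicE; case: ifPn => _; rewrite ?mul1e ?mul0e.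
  - apply: emeasurable_funM; last exact/measurable_EFinP.
    exact/measurable_EFinP/measurable_indic.
  - by move=> x _; rewrite mule_ge0 ?lee_fin.
rewrite (_ : h @^-1` [set r] = set0).
  rewrite integral_set0 mule0 integral0_eq// => x _.
  by rewrite indic0 mul0e mule0.
rewrite -subset0 => x /= hr; have : (0 <= h x)%R by [].
by rewrite hr leNgt r0.
Qed.

Lemma ge0_integral_density f : measurable_fun setT f -> (forall x, 0 <= f x) ->
  \int[nu]_x f x = \int[mu]_x (f x * (p x)%:E).
Proof.
move=> mf f0; pose h := nnsfun_approx measurableT mf.
have -> : \int[nu]_x f x = lim (\int[nu]_x (h n x)%:E @[n --> \oo]).
  rewrite -monotone_convergence//=.
  - apply: eq_integral => x _; apply/esym/cvg_lim => //=.
    exact: cvg_nnsfun_approx.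
  - by move=> n; exact/measurable_EFinP.
  - by move=> n x _; rewrite lee_fin.
  - by move=> x _ m n mn; rewrite lee_fin; exact/lefP/nd_nnsfun_approx.
have -> : \int[mu]_x (f x * (p x)%:E) =
    lim (\int[mu]_x ((h n x)%:E * (p x)%:E) @[n --> \oo]).
  rewrite -monotone_convergence//=.
  - apply: eq_integral => x _; apply/esym/cvg_lim => //=.
    by apply: cvgeZr => //; exact: cvg_nnsfun_approx.
  - move=> n; apply: emeasurable_funM; exact/measurable_EFinP.
  - by move=> n x _; rewrite mule_ge0// lee_fin.
  - move=> x _ m n mn; rewrite lee_wpmul2r// lee_fin//.
    exact/lefP/nd_nnsfun_approx.
by apply: congr_lim; apply/funext => n; exact: ge0_integral_density_nnsfun.
Qed.

End density.

Lemma density_probability {R : realType} {d} {T : measurableType d}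
    (mu : {measure set T -> \bar R}) (p : T -> R) :
  measurable_fun setT p -> (forall x, 0 <= p x) ->
  (\int[mu]_x (p x)%:E = 1)%E ->
  exists Q : probability T R,
    forall A, Q A = (\int[mu]_(x in A) (p x)%:E)%E.
Proof.
move=> mp p0 p1; pose nu (A : set T) : \bar R := (\int[mu]_(x in A) (p x)%:E)%E.
have nu0 : nu set0 = 0%E by rewrite /nu integral_set0.
have nu_ge0 A : (0 <= nu A)%E by apply: integral_ge0 => x _; rewrite lee_fin.
have nu_sigma : semi_sigma_additive nu.
  move=> /= F mF tF mUF; rewrite /nu; apply: cvg_toP.
    apply: ereal_nondecreasing_is_cvgn => m n mn.
    apply: lee_sum_nneg_natr => // k _ _; apply: integral_ge0 => /= x Fkx.
    by rewrite lee_fin.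
  rewrite ge0_integral_bigcup//=.
  - exact/measurable_funTS/measurable_EFinP.
  - by move=> x _; rewrite lee_fin.
pose M := isMeasure.Build d T R nu nu0 nu_ge0 nu_sigma.
pose nuM : {measure set T -> \bar R} := HB.pack nu M.
pose Pr := @Measure_isProbability.Build _ _ R nuM p1.
pose Q : probability T R := HB.pack nu M Pr.
by exists Q.
Qed.

(** * The Gamma integral *)

Section gamma_integral.
Context {R : realType}.
Notation mu := (@lebesgue_measure R).
Implicit Types a b c u : R.

(** The dilation by [c] maps the intervals for [u = 1] onto those for [u = c]. *)
Lemma itv_pos_bigcup u : 0 < u ->
  `]0, +oo[%classic = \bigcup_n `[u / n.+1%:R, u * n.+1%:R]%classic.
Proof.
move=> u0; apply/seteqP; split => x /=; rewrite in_itv/= andbT.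
  move=> x0; pose n := (Num.truncn (u / x + x / u)).
  have ux : 0 <= u / x by rewrite divr_ge0// ltW.
  have xu : 0 <= x / u by rewrite divr_ge0// ltW.
  have h : u / x + x / u < n.+1%:R by exact: truncnS_gt.
  exists n => //=; rewrite in_itv/=; apply/andP; split.
    by rewrite ler_pdivrMr// -ler_pdivrMl// mulrC ltW//; lra.
  by rewrite -ler_pdivrMl// mulrC ltW//; lra.
move=> [n _ /=]; rewrite in_itv/= => /andP[+ _]; apply: lt_le_trans.
by rewrite divr_gt0.
Qed.

Lemma itv_pos_nondecreasing u : 0 < u ->
  nondecreasing_seq (fun n => `[u / n.+1%:R, u * n.+1%:R]%classic).
Proof.
move=> u0; apply/nondecreasing_seqP => n; apply/subsetPset.
move=> x /=; rewrite !in_itv/= => /andP[h1 h2]; apply/andP; split.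
  by apply: le_trans h1; rewrite ler_pM2l// lef_pV2 ?posrE// ler_nat.
by apply: (le_trans h2); rewrite ler_pM2l// ler_nat.
Qed.

Lemma ge0_integral_pos_cvg u (f : R -> R) : 0 < u ->
  measurable_fun setT f -> (forall x, 0 <= f x) ->
  (\int[mu]_(x in `[(u / n.+1%:R)%R, (u * n.+1%:R)%R]) (f x)%:E)%E
    @[n --> \oo] --> (\int[mu]_(x in `]0%R, +oo[) (f x)%:E)%E.
Proof.
move=> u0 mf f0; rewrite (itv_pos_bigcup u0).
apply: ge0_nondecreasing_set_cvg_integral => //.
- exact: itv_pos_nondecreasing.
- by move=> n; exact/measurable_funTS/measurable_EFinP.
- by move=> n x _; rewrite lee_fin.
Qed.

Lemma substitution_increasing (F dF G : R -> R) a b : a <= b ->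
  (forall x, is_derive x (1 : R) F (dF x)) -> continuous dF ->
  {in `[a, b] &, {homo F : x y / x < y}} ->
  {in `[F a, F b]%classic, continuous G} ->
  (\int[mu]_(x in `[F a, F b]) (G x)%:E
   = \int[mu]_(x in `[a, b]) (G (F x) * dF x)%:E)%E.
Proof.
move=> ab FdF cdF incF cG.
have F'E : F^`()%classic = dF.
  by apply/funext => x; rewrite derive1E; exact: derive_val.
have cF : continuous F.
  move=> x; apply: differentiable_continuous; apply/derivable1_diffP.
  exact: ex_derive.
rewrite (@integration_by_substitution_increasing _ F G a b)//.
- by apply: eq_integral => x _; rewrite F'E.
- by rewrite F'E => x _; exact: cdF.
- by rewrite F'E; apply/cvg_ex; exists (dF a); apply: cvg_at_right_filter; exact: cdF.
- by rewrite F'E; apply/cvg_ex; exists (dF b); apply: cvg_at_left_filter; exact: cdF.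
- split; first by move=> x _; exact: ex_derive.
    by apply: cvg_at_right_filter; exact: cF.
  by apply: cvg_at_left_filter; exact: cF.
- exact: continuous_in_subspaceT.
Qed.

Definition gamma_kernel a c x : R := x `^ (a - 1) * expR (- (c * x)).

Lemma gamma_kernel_ge0 a c x : 0 <= gamma_kernel a c x.
Proof. by rewrite mulr_ge0 ?powR_ge0 ?expR_ge0. Qed.

Lemma measurable_gamma_kernel a c : measurable_fun setT (gamma_kernel a c).
Proof.
apply: measurable_funM; first exact: measurable_powR.
by apply: measurableT_comp => //; apply: measurableT_comp => //; exact: measurable_funM.
Qed.

Lemma continuous_gamma_kernel a c x : 0 < x -> {for x, continuous (gamma_kernel a c)}.
Proof.
move=> x0; have h : {for x, continuous (fun y : R => y `^ (a - 1))}.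
  apply: differentiable_continuous; apply/derivable1_diffP.
  by apply: derivable_powR; rewrite in_itv/= andbT.
apply: cvgM; first exact: h.
apply: (@continuous_comp _ _ _ (fun x : R => - (c * x)) expR).
  by apply: cvgN; apply: cvgM; [exact: cvg_cst|exact: cvg_id].
exact: continuous_expR.
Qed.

Definition gamma_int a c : \bar R :=
  (\int[mu]_(x in `]0%R, +oo[) (gamma_kernel a c x)%:E)%E.

Lemma gamma_int_scale a c : 0 < a -> 0 < c ->
  (gamma_int a 1 = (c `^ a)%:E * gamma_int a c)%E.
Proof.
move=> a0 c0.
have h1 := ge0_integral_pos_cvg c0 (measurable_gamma_kernel a 1) (gamma_kernel_ge0 a 1).
have h2 := ge0_integral_pos_cvg ltr01 (measurable_gamma_kernel a c) (gamma_kernel_ge0 a c).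
have E n : (\int[mu]_(x in `[(c / n.+1%:R)%R, (c * n.+1%:R)%R]) (gamma_kernel a 1 x)%:E
   = (c `^ a)%:E * \int[mu]_(x in `[(1 / n.+1%:R)%R, (1 * n.+1%:R)%R]) (gamma_kernel a c x)%:E)%E.
  have n0 : 0 < n.+1%:R :> R by rewrite ltr0n.
  have n1 : 1 / n.+1%:R <= 1 * n.+1%:R :> R.
    by rewrite !mul1r (@le_trans _ _ 1) ?invf_le1 ?ler1n.
  have dc (x : R) : is_derive x (1 : R) (fun x => c * x) c.
    by apply: is_derive_eq; rewrite /GRing.scale/=; ring.
  rewrite (_ : c / n.+1%:R = c * (1 / n.+1%:R)); last by rewrite div1r.
  rewrite (_ : c * n.+1%:R = c * (1 * n.+1%:R)); last by rewrite mul1r.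
  rewrite (@substitution_increasing (fun x => c * x) (fun=> c))//.
  - rewrite -ge0_integralZl//.
    + apply: eq_integral => x; rewrite inE/= in_itv/= => /andP[x0 _].
      have {}x0 : 0 < x by apply: lt_le_trans x0; rewrite divr_gt0.
      rewrite -EFinM /gamma_kernel mul1r; congr EFin.
      rewrite powRM ?(ltW c0) ?(ltW x0)//.
      by rewrite -(mulr_powRB1 (ltW c0) a0); ring.
    + apply: measurable_funTS; apply/measurable_EFinP; exact: measurable_gamma_kernel.
    + by move=> x _; rewrite lee_fin gamma_kernel_ge0.
    + by rewrite lee_fin powR_ge0.
  - by move=> x; exact: cvg_cst.
  - by move=> x y _ _; rewrite ltr_pM2l.
  - move=> x; rewrite inE/= in_itv/= => /andP[x0 _].
    apply: continuous_gamma_kernel; apply: lt_le_trans x0.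
    by rewrite mulr_gt0// divr_gt0.
rewrite -[LHS](cvg_lim _ h1)//; apply/cvg_lim => //.
under eq_cvg do rewrite E.
by apply: cvgeMl.
Qed.

(** The substitution [x = z ^+ 2] turns the Gamma integral at a half-integer into
    a moment of the Gaussian function. *)
Lemma gamma_int_half_lty m : (gamma_int (m.+1%:R / 2) 1 < +oo)%E.
Proof.
set a := m.+1%:R / 2.
have [C C0 CP] := @expRN_poly_bounded R (1 / 2) m (divr_gt0 ltr01 (ltr0n _ 2)).
pose B := 2 * C * (normal_peak 1)^-1.
apply: (@le_lt_trans _ _ B%:E); last exact: ltry.
have hc := ge0_integral_pos_cvg ltr01 (measurable_gamma_kernel a 1) (gamma_kernel_ge0 a 1).
rewrite /gamma_int -(cvg_lim _ hc)//; apply: lime_le; first by apply/cvg_ex; eexists; exact: hc.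
apply: nearW => n; have n0 : 0 < n.+1%:R :> R by rewrite ltr0n.
have l0 : 0 < 1 / n.+1%:R :> R by rewrite divr_gt0.
have r0 : 0 < 1 * n.+1%:R :> R by rewrite mul1r.
have lr : 1 / n.+1%:R <= 1 * n.+1%:R :> R.
  by rewrite !mul1r (@le_trans _ _ 1) ?invf_le1 ?ler1n.
rewrite -[1 / _](sqr_sqrtr (ltW l0)) -[X in `[_, X]](sqr_sqrtr (ltW r0)).
set l := Num.sqrt (1 / _); set r := Num.sqrt _.
have l_gt0 : 0 < l by rewrite sqrtr_gt0.
have dF (x : R) : is_derive x (1 : R) (fun x => x ^+ 2) (2 * x).
  by apply: is_derive_eq; rewrite /GRing.scale/=; ring.
rewrite (@substitution_increasing (fun x => x ^+ 2) (fun x => 2 * x))//.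
- pose g x := 2 * C * (normal_peak 1)^-1 * normal_pdf 0 1 x.
  have mg : measurable_fun setT g by apply: measurable_funM => //; exact: measurable_normal_pdf.
  apply: (@le_trans _ _ (\int[mu]_(x in `[l, r]) (g x)%:E)%E).
    apply: ge0_le_integral => //.
    + move=> x; rewrite /= in_itv/= => /andP[lx _].
      rewrite lee_fin mulr_ge0 ?gamma_kernel_ge0// mulr_ge0//.
      by rewrite ltW// (lt_le_trans l_gt0).
    + apply: measurable_funTS; apply/measurable_EFinP; apply: measurable_funM.
        apply: (measurableT_comp (measurable_gamma_kernel a 1)).
        exact: measurable_funX.
      exact: measurable_funM.
    + by apply: measurable_funTS; apply/measurable_EFinP.
    + move=> x; rewrite /= in_itv/= => /andP[lx _]; rewrite lee_fin.
      have x0 : 0 < x := lt_le_trans l_gt0 lx.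
      have gE : g x = 2 * C * expR (- (1 / 2 * x ^+ 2)).
        rewrite /g normal_pdfE ?oner_neq0// /normal_fun subr0 expr1n.
        have pk : normal_peak (1 : R) != 0 by rewrite gt_eqF// normal_peak_gt0// oner_neq0.
        rewrite (_ : - x ^+ 2 / (1 *+ 2) = - (1 / 2 * x ^+ 2)); last by field.
        by field.
      have -> : gamma_kernel a 1 (x ^+ 2) * (2 * x) = 2 * (x ^+ m * expR (- x ^+ 2)).
        rewrite /gamma_kernel mul1r; set ex := expR _.
        rewrite -powR_mulrn ?(ltW x0)// -powRrM.
        rewrite (_ : 2 * (a - 1) = m%:R - 1); last first.
          by rewrite /a -[m.+1%:R]natr1; field.
        rewrite powRB ?(gt_eqF x0) ?implybT// powRr1 ?(ltW x0)// powR_mulrn ?(ltW x0)//.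
        by field; rewrite gt_eqF.
      rewrite gE; have -> : expR (- x ^+ 2)
          = expR (- (1 / 2 * x ^+ 2)) * expR (- (1 / 2 * x ^+ 2)).
        by rewrite -expRD; congr expR; field.
      set ee := expR _; have ee0 : 0 <= ee by exact: expR_ge0.
      rewrite (_ : 2 * _ = 2 * (ee * x ^+ m) * ee); last by ring.
      rewrite ler_wpM2r// ler_wpM2l//.
      apply: le_trans (CP _ (sqr_ge0 x)); rewrite ler_wpM2l//.
      rewrite lerXn2r ?nnegrE ?(ltW x0) ?addr_ge0 ?sqr_ge0//.
      by apply: le_trans (norm_le_1Dsqr x); exact: ler_norm.
  apply: (@le_trans _ _ (\int[mu]_x (g x)%:E)%E).
    apply: ge0_subset_integral => //; first exact/measurable_EFinP.
    by move=> x _; rewrite lee_fin !mulr_ge0 ?normal_pdf_ge0 ?invr_ge0 ?normal_peak_ge0.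
  rewrite /g; under eq_integral do rewrite EFinM.
  rewrite ge0_integralZl//.
  + by rewrite integral_normal_pdf mule1.
  + by apply/measurable_EFinP; exact: measurable_normal_pdf.
  + by move=> x _; rewrite lee_fin normal_pdf_ge0.
  + by rewrite lee_fin !mulr_ge0 ?invr_ge0 ?normal_peak_ge0.
- by rewrite ler_sqrt.
- by move=> x; apply: cvgM; [exact: cvg_cst|exact: cvg_id].
- move=> x y; rewrite !in_itv/= => /andP[lx _] _ xy.
  by rewrite ltr_pXn2r// nnegrE ltW// ?(lt_trans _ xy)// (lt_le_trans l_gt0).
- move=> x; rewrite inE/= in_itv/= => /andP[lx _].
  by apply: continuous_gamma_kernel; apply: lt_le_trans lx; rewrite exprn_gt0.
Qed.

Lemma gamma_int_half_gt0 m : (0 < gamma_int (m.+1%:R / 2) 1)%E.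
Proof.
set a := m.+1%:R / 2.
apply: (@lt_le_trans _ _ (\int[mu]_(x in `[1%R, 2%R]) (1 / 2 * expR (- 2))%:E)%E).
  rewrite integral_cst//= lebesgue_measure_itv/= lte_fin ltr1n -EFinB -EFinM lte_fin.
  by rewrite !mulr_gt0 ?expR_gt0//; lra.
apply: (@le_trans _ _ (\int[mu]_(x in `[1%R, 2%R]) (gamma_kernel a 1 x)%:E)%E).
  apply: ge0_le_integral => //.
  - by apply: measurable_funTS; apply/measurable_EFinP; exact: measurable_gamma_kernel.
  - move=> x; rewrite /= in_itv/= => /andP[x1 x2]; rewrite lee_fin /gamma_kernel.
    apply: ler_pM => //; [|by rewrite ler_expR; lra].
    apply: (@le_trans _ _ (x `^ (- 1))).
      by rewrite powR_inv1 ?(le_trans _ x1)// div1r lef_pV2 ?posrE//; lra.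
    by apply: ler_powR => //; rewrite /a; have := ler0n R m.+1; lra.
apply: ge0_subset_integral => //.
- by apply: measurable_funTS; apply/measurable_EFinP; exact: measurable_gamma_kernel.
- by move=> x _; rewrite lee_fin gamma_kernel_ge0.
- by move=> x /=; rewrite !in_itv/= andbT => /andP[x1 _]; lra.
Qed.

End gamma_integral.

(** * Laws determined by their Laplace transforms *)

Section laplace_unique.
Context {R : realType}.
Implicit Types mu nu : probability R R.

Definition laplace mu (s : R) : \bar R := (\int[mu]_x (expR (- (s * x)))%:E)%E.

Lemma measure_neg0 mu (A : set R) : mu `]-oo, 0[%classic = 0%E -> measurable A ->
  mu A = mu (A `&` `[0, +oo[).
Proof.
move=> mu0 mA; rewrite (measureDI mu mA (measurable_itv `]-oo, 0[)).
rewrite [X in (_ + X)%E](_ : _ = 0%E) ?adde0.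
  congr (mu _); rewrite setDE; congr (_ `&` _).
  by rewrite setCitvl.
apply/eqP; rewrite eq_le measure_ge0 andbT -mu0.
by apply: le_measure; rewrite ?inE//; exact: measurableI.
Qed.

Lemma laplace_norm mu s : mu `]-oo, 0[%classic = 0%E -> 0 <= s ->
  laplace mu s = (\int[mu]_x expR (- (s * `|x|)))%:E.
Proof.
move=> mu0 s0.
have mabs : measurable_fun setT (fun x : R => expR (- (s * `|x|))).
  apply: measurableT_comp => //; apply: measurableT_comp => //.
  by apply: measurable_funM => //; exact: measurableT_comp.
have mexp : measurable_fun setT (fun x : R => expR (- (s * x))).
  by apply: measurableT_comp => //; apply: measurableT_comp => //; exact: measurable_funM.
rewrite -(@expectation_Rintegral _ _ _ mu _ 1)//; last first.
  move=> x; rewrite ger0_norm ?expR_ge0// expR_le1 oppr_le0 mulr_ge0//.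
rewrite unlock; apply: ae_eq_integral => //; try exact/measurable_EFinP.
exists `]-oo, 0[%classic; split => // x /= /not_implyP[_ xE].
rewrite in_itv/= ltNge; apply/negP => x0; apply: xE.
by rewrite ger0_norm.
Qed.

Section test_functions.
Variable r : R.

(** These continuous functions increase to the indicator of the half-line above [r]. *)
Definition ramp (n : nat) (x : R) : R := 1 - expR (- (n%:R * (x - r + `|x - r|))).

Lemma continuous_ramp n : continuous (ramp n).
Proof.
move=> x; apply: cvgB; first exact: cvg_cst.
apply: (@continuous_comp _ _ _ (fun x : R => - (n%:R * (x - r + `|x - r|))) expR);
  last exact: continuous_expR.
apply: cvgN; apply: cvgM; first exact: cvg_cst.
have h : x - r @[x --> x] --> x - r by apply: cvgB; [exact: cvg_id|exact: cvg_cst].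
by apply: cvgD => //; exact: cvg_norm.
Qed.

Lemma ramp01 n x : 0 <= ramp n x <= 1.
Proof.
rewrite /ramp subr_ge0 expR_le1 oppr_le0 gerBl expR_ge0 andbT mulr_ge0//.
by have := ler_norm (- (x - r)); rewrite normrN; lra.
Qed.

Lemma cvg_ramp (x : R) : ramp n x @[n --> \oo] --> (\1_(`]r, +oo[%classic) x : R).
Proof.
have [rx|xr] := ltP r x.
  rewrite indicE mem_set /= ?in_itv/= ?rx//.
  rewrite -[X in _ --> X]subr0; apply: cvgB; first exact: cvg_cst.
  rewrite (_ : (fun n => _) = (fun n => expR (- (x - r + `|x - r|)) ^+ n)).
    apply: cvg_expr; rewrite ger0_norm ?expR_ge0// expR_lt1 oppr_lt0.
    by rewrite ltr_pwDl ?subr_gt0.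
  by apply/funext => n; rewrite -mulrN expRM_natl.
rewrite indicE memNset; last by rewrite /= in_itv/= andbT; apply/negP; rewrite -leNgt.
rewrite (_ : ramp^~ x = fun=> 0); first exact: cvg_cst.
apply/funext => n; rewrite /ramp ler0_norm ?subr_le0// addrN mulr0 oppr0 expR0.
by rewrite subrr.
Qed.

Lemma Rintegral_ramp_cvg mu :
  \int[mu]_x ramp n `|x| @[n --> \oo] --> fine (mu [set x | r < `|x|]).
Proof.
have mr n : measurable_fun setT (fun x : R => ramp n `|x|).
  have mrn : measurable_fun setT (ramp n : R -> R).
    by apply: continuous_measurable_fun; exact: continuous_ramp.
  exact: (measurableT_comp mrn (@normr_measurable R setT)).
pose A := [set x : R | r < `|x|].
have mA : measurable A.
  rewrite (_ : A = (@Num.norm R R) @^-1` `]r, +oo[); last first.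
    by apply/seteqP; split => x /=; rewrite in_itv/= andbT.
  by rewrite -[X in measurable X]setTI; exact: normr_measurable.
have : (\int[mu]_x (ramp n `|x|)%:E)%E @[n --> \oo] --> (\int[mu]_x (\1_A x)%:E)%E.
  apply: (@dominated_cvg _ _ _ _ _ _ _ _ (cst 1%E)) => //.
  - by move=> n; exact/measurable_EFinP.
  - move=> x _; apply/fine_cvgP; split; first by near=> n.
    have := @cvg_ramp `|x|; rewrite (_ : \1_(`]r, +oo[%classic) `|x| = \1_A x)//.
    rewrite !indicE; congr (_%:R); congr nat_of_bool.
    by apply/idP/idP; rewrite !inE /A /= in_itv/= andbT.
  - exact: finite_measure_integrable_cst.
  - move=> n x _; have /andP[h1 h2] := ramp01 n `|x|.
    by rewrite /= lee_fin ger0_norm.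
rewrite integral_indic// setIT -[X in _ --> X](@fineK _ (mu A)) ?fin_num_measure//.
by move=> /fine_cvgP[].
Unshelve. all: by end_near. Qed.

End test_functions.

(** Equality of the Laplace transforms is convergence of a constant sequence, so
    both laws give the same mass to all the half-lines. *)
Theorem laplace_unique mu nu (phi : R -> R) :
  mu `]-oo, 0[%classic = 0%E -> nu `]-oo, 0[%classic = 0%E ->
  (forall s, 0 <= s -> laplace mu s = (phi s)%:E) ->
  (forall s, 0 <= s -> laplace nu s = (phi s)%:E) ->
  (forall e, 0 < e -> exists2 s, 0 < s & 1 - e <= phi s) ->
  forall A, measurable A -> mu A = nu A.
Proof.
move=> mu0 nu0 muphi nuphi phi0.
have muI s : 0 <= s -> \int[mu]_x expR (- (s * `|x|)) = phi s.
  by move=> s0; have := muphi s s0; rewrite laplace_norm// => -[].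
have nuI s : 0 <= s -> \int[nu]_x expR (- (s * `|x|)) = phi s.
  by move=> s0; have := nuphi s s0; rewrite laplace_norm// => -[].
have mnorm : measurable_fun setT (@Num.norm R R) by exact: normr_measurable.
have weak : cvg_in_distribution mu (fun=> @Num.norm R R) nu (@Num.norm R R).
  apply: laplace_cvg_in_distribution => //.
  - by move=> s s0; rewrite nuI//; under eq_cvg do rewrite muI//; exact: cvg_cst.
  - by move=> e /phi0[s s0 sP]; exists s => //; rewrite nuI// ltW.
have test n r : \int[mu]_x ramp r n `|x| = \int[nu]_x ramp r n `|x|.
  have cr : continuous (ramp r n) by exact: continuous_ramp.
  have rM x : `|ramp r n x| <= 1.
    by have /andP[? ?] := ramp01 r n x; rewrite ger0_norm.
  have mr : measurable_fun setT (ramp r n \o (@Num.norm R R)).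
    have mrn : measurable_fun setT (ramp r n : R -> R) by exact: continuous_measurable_fun.
    exact: (measurableT_comp mrn mnorm).
  have W := weak _ cr (ex_intro _ 1 rM).
  rewrite (expectation_Rintegral nu mr (fun x => rM `|x|)) in W.
  rewrite (expectation_Rintegral mu mr (fun x => rM `|x|)) in W.
  have : (\int[nu]_x (ramp r n \o (@Num.norm R R)) x)%:E
       = (\int[mu]_x (ramp r n \o (@Num.norm R R)) x)%:E.
    exact: (cvg_unique (@ereal_hausdorff R) W (cvg_cst _)).
  by case.
have ray r : mu `]r, +oo[%classic = nu `]r, +oo[%classic.
  have h (Q : probability R R) : Q `]-oo, 0[%classic = 0%E ->
      Q `]r, +oo[%classic = Q [set x | r < `|x|].
    move=> Q0; rewrite (measure_neg0 Q0)//.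
    rewrite [RHS](measure_neg0 Q0).
      congr (Q _); apply/seteqP; split => x /=; rewrite !in_itv/= !andbT => -[h1 h2].
        by rewrite ger0_norm.
      by rewrite ger0_norm in h1.
    rewrite (_ : [set x | _] = (@Num.norm R R) @^-1` `]r, +oo[); last first.
      by apply/seteqP; split => x /=; rewrite in_itv/= andbT.
    by rewrite -[X in measurable X]setTI; exact: mnorm.
  rewrite !h//; have hmu := @Rintegral_ramp_cvg r mu.
  have hnu := @Rintegral_ramp_cvg r nu.
  rewrite (_ : (fun n => _) = (fun n => \int[mu]_x ramp r n `|x|)) in hnu; last first.
    by apply/funext => n; rewrite test.
  have e : fine (mu [set x | r < `|x|]) = fine (nu [set x | r < `|x|]).
    exact: (cvg_unique (@Rhausdorff R) hmu hnu).
  have mA : measurable [set x : R | r < `|x|].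
    rewrite (_ : [set x | _] = (@Num.norm R R) @^-1` `]r, +oo[); last first.
      by apply/seteqP; split => x /=; rewrite in_itv/= andbT.
    by rewrite -[X in measurable X]setTI; exact: mnorm.
  rewrite -[LHS](@fineK _ (mu [set x : R | r < `|x|])) ?fin_num_measure//.
  by rewrite e fineK// fin_num_measure.
move=> A mA; apply: (measure_unique (@RGenOInfty.G R) (fun n => `](- n%:R)%R, +oo[%classic)) => //.
- exact: RGenOInfty.measurableE.
- move=> _ _ [x ->] [y ->]; exists (Num.max x y).
  by apply/seteqP; split => z /=; rewrite !in_itv/= !andbT gt_max => /andP.
- by move=> n; eexists.
- apply/seteqP; split => // x _; exists (Num.truncn `|x|).+1 => //=.
  rewrite in_itv/= andbT ltrNl; apply: le_lt_trans (truncnS_gt _).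
  by rewrite -normrN ler_norm.
- by move=> _ [x ->]; exact: ray.
- move=> n; rewrite -ge0_fin_numE//; exact: fin_num_measure.
Qed.

End laplace_unique.

(** * Laplace transforms of the chi-squared and Gamma laws *)

Section chi2_laplace.
Context {R : realType}.

(** Up to a constant, the Gaussian density multiplied by [expR (- (s * y ^+ 2))] is that
    of the variance [sg ^+ 2 = (1 + 2 * s)^-1]. *)
Lemma normal_sqr_laplace (s : R) : 0 <= s ->
  (\int[normal_prob (0 : R) 1]_y (expR (- (s * y ^+ 2)))%:E
   = (expR (- (1 / 2 * ln (1 + 2 * s))))%:E)%E.
Proof.
move=> s0; rewrite (@ge0_integral_density _ _ _ lebesgue_measure _ (normal_pdf 0 1))//.
- set sg := expR _; have sg0 : 0 < sg by exact: expR_gt0.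
  have sg2 : sg ^+ 2 = (1 + 2 * s)^-1.
    rewrite /sg -expRM_natl mulrN mulrA (_ : 2 * (1 / 2) = 1); last by field.
    by rewrite mul1r expRN lnK// posrE; lra.
  have E y : (expR (- (s * y ^+ 2)) * normal_pdf 0 1 y = sg * normal_pdf 0 sg y)%R.
    rewrite !normal_pdfE ?gt_eqF ?oner_neq0// /normal_fun /normal_peak.
    have p0 : 0 < pi *+ 2 :> R by rewrite mulrn_wgt0// pi_gt0.
    rewrite !subr0 expr1n mul1r -[(sg ^+ 2 * pi) *+ 2]mulrnAr sqrtrM ?sqr_ge0//.
    rewrite sqrtr_sqr (gtr0_norm sg0) invfM [in RHS]mulrA [sg * _]mulrA.
    rewrite divff ?gt_eqF// mul1r mulrCA -expRD; congr (_ * expR _).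
    rewrite -mulr_natr -[(sg ^+ 2) *+ 2]mulr_natr sg2; field; lra.
  under eq_integral do rewrite -EFinM E EFinM.
  rewrite ge0_integralZl//.
  + by rewrite integral_normal_pdf mule1.
  + by apply/measurable_EFinP; exact: measurable_normal_pdf.
  + by move=> x _; rewrite lee_fin normal_pdf_ge0.
  + by rewrite lee_fin ltW.
- exact: measurable_normal_pdf.
- by move=> x; exact: normal_pdf_ge0.
- apply/measurable_EFinP; apply: measurableT_comp => //; apply: measurableT_comp => //.
  by apply: measurable_funM => //; exact: measurable_funX.
Qed.

Lemma chi2_laplace m (s : R) : 0 <= s ->
  laplace (@chi2_law R m) s = (expR (- (m%:R / 2 * ln (1 + 2 * s))))%:E.
Proof.
move=> s0; have mexp : measurable_fun setT (fun x : R => expR (- (s * x))).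
  by apply: measurableT_comp => //; apply: measurableT_comp => //; exact: measurable_funM.
elim: m => [|m IH] /=.
  rewrite /laplace integral_dirac//; last exact/measurable_EFinP.
  by rewrite diracT mul1e mulr0 oppr0 mul0r mul0r oppr0.
rewrite /laplace ge0_integral_distribution//; last exact/measurable_EFinP.
have mE : measurable_fun setT (fun x : R => (expR (- (s * x)))%:E).
  exact/measurable_EFinP.
rewrite fubini_tonelli1//; last 2 first.
- exact: (measurableT_comp mE measurable_add_sqr).
- by move=> x /=; rewrite lee_fin expR_ge0.
rewrite /fubini_F /=.
set c := expR (- (1 / 2 * ln (1 + 2 * s))).
have E (x : R) : (\int[normal_prob (0 : R) 1]_y (expR (- (s * add_sqr (x, y))))%:E
    = (expR (- (s * x)))%:E * c%:E)%E.
  rewrite /c -(normal_sqr_laplace s0) -ge0_integralZl//.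
  - apply: eq_integral => y _.
    by rewrite -EFinM -expRD /add_sqr /= mulrDr opprD.
  - apply/measurable_EFinP; apply: measurableT_comp => //; apply: measurableT_comp => //.
    by apply: measurable_funM => //; exact: measurable_funX.
transitivity (\int[chi2_law m]_x ((expR (- (s * x)))%:E * c%:E))%E.
  by apply: eq_integral => x _; exact: E.
rewrite ge0_integralZr//; last by rewrite lee_fin expR_ge0.
rewrite -/(laplace _ _) IH -EFinM -expRD; congr (expR _)%:E.
by rewrite -natr1; field.
Qed.

Lemma chi2_neg0 m : @chi2_law R m `]-oo, 0[%classic = 0%E.
Proof.
elim: m => [|m IH] /=.
  by rewrite diracE memNset//= in_itv/= ltxx.
apply/eqP; rewrite eq_le measure_ge0 andbT /distribution /pushforward.
apply: (@le_trans _ _ ((chi2_law m \x normal_prob (0 : R) 1)%E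
    (`]-oo, 0[%classic `*` setT))).
  apply: le_measure; rewrite ?inE.
  - by rewrite -[X in measurable X]setTI; exact: measurable_add_sqr.
  - exact: measurableX.
  - move=> [x y] /=; rewrite !in_itv/= /add_sqr/= => h; split => //.
    by apply: le_lt_trans h; rewrite lerDl sqr_ge0.
rewrite product_measure1E//.
rewrite [X in (X * _)%E](_ : _ = 0%E) ?mul0e//; exact: IH.
Qed.

End chi2_laplace.

Lemma law_probability {R : realType} d (T : measurableType d) (P : probability T R)
    (X : T -> R) : measurable_fun setT X -> exists Q : probability R R,
  (forall A, Q A = P (X @^-1` A)) /\
  (forall s, laplace Q s = \int[P]_t (expR (- (s * X t)))%:E)%E.
Proof.
move=> mX; pose Y : {RV P >-> R} := HB.pack X (isMeasurableFun.Build _ _ _ _ X mX).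
exists (distribution P Y); split => // s; rewrite /laplace ge0_integral_distribution//.
apply/measurable_EFinP; apply: measurableT_comp => //; exact: measurableT_comp.
Qed.

Section gamma_laplace.
Context {R : realType}.
Notation mu := (@lebesgue_measure R).

Lemma gamma_pdfE (a b : R) : gamma_pdf a b =
  (fun w => b `^ a / Gamma_fun a * gamma_kernel a b w) \_ `]0, +oo[.
Proof.
apply/funext => w; rewrite patchE /gamma_pdf.
case: ifPn => w0; first by rewrite mem_set/= ?in_itv/= ?andbT// mulrA.
by rewrite memNset//= in_itv/= andbT; exact/negP.
Qed.

Lemma Gamma_funE m : ((Gamma_fun (m.+1%:R / 2 : R))%:E = gamma_int (m.+1%:R / 2) 1)%E.
Proof.
rewrite /Gamma_fun /Rintegral.
have -> : (\int[mu]_(x in `]0%R, +oo[) (x `^ (m.+1%:R / 2 - 1) * expR (- x))%:E)%E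
    = gamma_int (m.+1%:R / 2) 1.
  by apply: eq_integral => x _; rewrite /gamma_kernel mul1r.
by rewrite fineK// ge0_fin_numE ?gamma_int_half_lty// ltW// gamma_int_half_gt0.
Qed.

(** The density multiplied by [expR (- (s * x))] is the Gamma kernel with rate [b + s],
    whose integral is known by scaling. The value at [s = 0] shows that the law has
    mass [1]. *)
Lemma gamma_law_probability m (b : R) : 0 < b -> exists Q : probability R R,
  [/\ forall A : set R, Q A = gamma_law (m.+1%:R / 2) b A,
      Q `]-oo, 0[%classic = 0%E &
      forall s, 0 <= s ->
        laplace Q s = (expR (- (m.+1%:R / 2 * ln (1 + s / b))))%:E].
Proof.
move=> b0; set a := m.+1%:R / 2; have a0 : 0 < a by rewrite divr_gt0.
have Gam0 : 0 < Gamma_fun a by rewrite -lte_fin Gamma_funE gamma_int_half_gt0.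
pose c := b `^ a / Gamma_fun a.
have c0 : 0 <= c by rewrite divr_ge0 ?powR_ge0// ltW.
have pdf0 w : 0 <= gamma_pdf a b w.
  by rewrite gamma_pdfE; apply: restrict_ge0 => x _; rewrite mulr_ge0// gamma_kernel_ge0.
have mpdf : measurable_fun setT (gamma_pdf a b).
  rewrite gamma_pdfE; apply/measurable_restrict => //; apply: measurable_funTS.
  by apply: measurable_funM => //; exact: measurable_gamma_kernel.
have lap s : 0 <= s -> (\int[mu]_x ((expR (- (s * x)))%:E * (gamma_pdf a b x)%:E))%E
    = (expR (- (a * ln (1 + s / b))))%:E.
  move=> s0; have bs0 : 0 < b + s by rewrite ltr_pwDl.
  transitivity (\int[mu]_(x in `]0%R, +oo[) (c%:E * (gamma_kernel a (b + s) x)%:E))%E.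
    rewrite [RHS]integral_mkcond; apply: eq_integral => x _.
    rewrite gamma_pdfE !patchE; case: ifPn => _; last by rewrite mule0.
    rewrite -!EFinM /gamma_kernel; congr EFin.
    by rewrite mulrDl opprD expRD -/c; ring.
  rewrite ge0_integralZl//; last 2 first.
  - by apply: measurable_funTS; apply/measurable_EFinP; exact: measurable_gamma_kernel.
  - by move=> x _; rewrite lee_fin gamma_kernel_ge0.
  have := gamma_int_scale a0 bs0; rewrite -Gamma_funE -/a.
  have p0 : 0 < (b + s) `^ a by rewrite powR_gt0.
  have : (gamma_int a (b + s) \is a fin_num).
    rewrite ge0_fin_numE; last by apply: integral_ge0 => x _; rewrite lee_fin gamma_kernel_ge0.
    rewrite ltNge leye_eq; apply/eqP => goo.
    by have := gamma_int_scale a0 bs0; rewrite -Gamma_funE goo gt0_muley ?lte_fin.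
  rewrite -/(gamma_int a (b + s)); case: (gamma_int a (b + s)) => // g _.
  rewrite -EFinM => -[gE]; rewrite -EFinM; congr EFin.
  rewrite /c gE invfM (_ : b `^ a = expR (a * ln b)); last by rewrite /powR gt_eqF.
  rewrite (_ : (b + s) `^ a = expR (a * ln (b + s))); last by rewrite /powR gt_eqF.
  have g0 : g != 0.
    by apply: contraTneq Gam0 => g0; rewrite gE g0 mulr0 ltxx.
  rewrite (_ : _ * g = expR (a * ln b) * (expR (a * ln (b + s)))^-1 :> R).
    rewrite -expRN -expRD; congr expR.
    have -> : 1 + s / b = (b + s) / b by field; rewrite gt_eqF.
    by rewrite ln_div ?posrE//; ring.
  by field; rewrite g0 gt_eqF ?expR_gt0.
have one : (\int[mu]_x (gamma_pdf a b x)%:E = 1)%E.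
  have := lap 0 (lexx 0); rewrite mul0r addr0 ln1 mulr0 oppr0 expR0 => <-.
  by apply: eq_integral => x _; rewrite mul0r oppr0 expR0 mul1e.
have [Q0 Q0E] := @density_probability R _ (measurableTypeR R) mu _ mpdf pdf0 one.
have [Q [QP Qlap]] := @law_probability R _ (measurableTypeR R) Q0 idfun
  (@measurable_id _ _ setT).
have QE A : Q A = (\int[mu]_(x in A) (gamma_pdf a b x)%:E)%E by rewrite QP Q0E.
exists Q; split => //.
- rewrite QE integral0_eq// => x /=; rewrite in_itv/= => x0.
  by rewrite /gamma_pdf ltNge (ltW x0).
- move=> s s0; rewrite Qlap (@ge0_integral_density _ _ _ mu _ (gamma_pdf a b))//.
  + exact: lap.
  + by move=> A _; exact: Q0E.
  + apply/measurable_EFinP; apply: measurableT_comp => //; apply: measurableT_comp => //.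
    by apply: measurable_funM => //; exact: measurable_id.
Qed.

End gamma_laplace.

(** * Multiples of a chi-squared variable *)

Section scaled_chi2.
Context {R : realType}.

(** The continuity at [0] of the Laplace transform of a Gamma law. *)
Lemma expRN_ln_at0 (c u : R) : 0 <= c -> 0 <= u ->
  forall e, 0 < e -> exists2 s, 0 < s & 1 - e <= expR (- (c * ln (1 + u * s))).
Proof.
move=> c0 u0 e e0; have cu0 : 0 <= c * u by exact: mulr_ge0.
have d0 : 0 < c * u + 1 by rewrite ltr_wpDl.
exists (e / (c * u + 1)); first by rewrite divr_gt0.
set s := e / _; have s0 : 0 < s by rewrite divr_gt0.
apply: le_trans (expR_ge1Dx _); rewrite lerD2l lerN2.
apply: (@le_trans _ _ (c * (u * s))).
  by apply: ler_wpM2l => //; apply: le_ln1Dx; rewrite (lt_le_trans (ltrN10 _))// mulr_ge0// ltW.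
have -> : c * (u * s) = e * (c * u / (c * u + 1)) by rewrite /s; field; rewrite gt_eqF.
by rewrite ger_pMr// ler_pdivrMr// mul1r lerDl.
Qed.

Context {d : measure_display} {T : measurableType d} (P : probability T R).
Variables (W : T -> R) (m : nat).
Hypothesis lawW : has_law P W (@chi2_law R m).

Let mW : measurable_fun setT W. Proof. by case: lawW. Qed.

Lemma chi2_rv_laplace s : 0 <= s ->
  (\int[P]_t (expR (- (s * W t)))%:E = (expR (- (m%:R / 2 * ln (1 + 2 * s))))%:E)%E.
Proof.
move=> s0; have [Q [QP <-]] := law_probability P mW.
rewrite -chi2_laplace//; apply: eq_measure_integral => A mA _.
by case: lawW => _ /(_ A mA); rewrite /= QP => h; first [exact: h|exact/esym].
Qed.

Variable l : R.
Hypothesis l0 : 0 < l.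

Let mlW : measurable_fun setT (fun t => l * W t).
Proof. exact: measurable_funM. Qed.

Let W_neg0 : P [set t | W t < 0] = 0%E.
Proof.
rewrite -(chi2_neg0 m); by case: lawW => _ <-.
Qed.

Let mneg : measurable [set t | W t < 0].
Proof.
rewrite (_ : [set _ | _] = W @^-1` `]-oo, 0[); last first.
  by apply/seteqP; split => t /=; rewrite in_itv.
by rewrite -[X in measurable X]setTI; exact: mW.
Qed.

Let ae_norm (f : R -> R) :
  ae_eq P setT (fun t => (f `|l * W t|)%:E) (fun t => (f (l * W t))%:E).
Proof.
exists [set t | W t < 0]; split => // t /= /not_implyP[_ tE].
rewrite ltNge; apply/negP => W0; apply: tE.
by rewrite ger0_norm// mulr_ge0// ltW.
Qed.

(** Both laws have the Laplace transform [(1 + 2 * l * s) `^ (- (m / 2))]. *)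
Lemma scaled_chi2_law_gamma A : (0 < m)%N -> measurable A ->
  P ((fun t => l * W t) @^-1` A) = gamma_law (m%:R / 2) (1 / (2 * l)) A.
Proof.
move=> m0 mA; have [Q [QP Qlap]] := law_probability P mlW.
have b0 : 0 < 1 / (2 * l) by rewrite divr_gt0// mulr_gt0.
have [G] := gamma_law_probability m.-1 b0; rewrite prednK// => -[GE G0 Glap].
rewrite -QP -GE.
apply: (@laplace_unique _ Q G (fun s => expR (- (m%:R / 2 * ln (1 + 2 * l * s))))) => //.
- rewrite QP -W_neg0; congr (P _); apply/seteqP; split => t /=; rewrite in_itv/=.
    by rewrite pmulr_rlt0.
  by rewrite pmulr_rlt0.
- move=> s s0; rewrite Qlap; under eq_integral do rewrite mulrA.
  rewrite chi2_rv_laplace; last by rewrite mulr_ge0// ltW.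
  by congr (expR (- (_ * ln (1 + _))))%:E; ring.
- move=> s s0; rewrite Glap//; congr (expR (- (_ * ln (1 + _))))%:E.
  by field; rewrite gt_eqF.
- by apply: expRN_ln_at0; rewrite ?mulr_ge0// ltW.
Qed.

(** A variable with a chi-squared law is only almost surely nonnegative, hence the
    convergence is first obtained towards [`|l * W|]. *)
Lemma laplace_cvg_scaled_chi2 {d'} {T' : measurableType d'} (P' : probability T' R)
    (X : nat -> T' -> R) :
  (forall n, measurable_fun setT (X n)) -> (forall n t, 0 <= X n t) ->
  (forall s, 0 <= s -> \int[P']_t expR (- (s * X n t)) @[n --> \oo] -->
     expR (- (m%:R / 2 * ln (1 + 2 * (l * s))))) ->
  cvg_in_distribution P' X P (fun t => l * W t).
Proof.
move=> mX X0 lap.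
have mN : measurable_fun setT (fun t => `|l * W t|) by exact: measurableT_comp.
have lapN s : 0 <= s ->
    \int[P]_t expR (- (s * `|l * W t|)) = expR (- (m%:R / 2 * ln (1 + 2 * (l * s)))).
  move=> s0; have ls0 : 0 <= l * s by rewrite mulr_ge0// ltW.
  suff E : (\int[P]_t (expR (- (s * `|l * W t|)))%:E)%E
         = (\int[P]_t (expR (- (l * s * W t)))%:E)%E.
    by rewrite /Rintegral E (chi2_rv_laplace ls0).
  transitivity (\int[P]_t (expR (- (s * (l * W t))))%:E)%E; last first.
    by apply: eq_integral => t _; rewrite mulrA [s * l]mulrC.
  apply: ae_eq_integral => //.
  - apply/measurable_EFinP; apply: measurableT_comp => //; apply: measurableT_comp => //.
    exact: measurable_funM.
  - apply/measurable_EFinP; apply: measurableT_comp => //; apply: measurableT_comp => //.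
    exact: measurable_funM.
  - exact: (ae_norm (fun x => expR (- (s * x)))).
have C : cvg_in_distribution P' X P (fun t => `|l * W t|).
  apply: laplace_cvg_in_distribution => //.
  - by move=> s s0; rewrite lapN//; exact: lap.
  - move=> e e0; have [||s s0 se] := @expRN_ln_at0 (m%:R / 2) (2 * l) _ _ e e0.
    + by rewrite divr_ge0.
    + by rewrite mulr_ge0// ltW.
    + by exists s => //; rewrite lapN ?(ltW s0)// mulrA.
move=> f cf bf; have := C f cf bf.
suff -> : ('E_P[f \o (fun t => (l * W t)%R)] = 'E_P[f \o (fun t => `|l * W t|%R)])%E.
  by [].
apply/esym; rewrite !unlock; apply: ae_eq_integral => //.
- by apply/measurable_EFinP; apply: measurableT_comp => //; exact: continuous_measurable_fun.
- by apply/measurable_EFinP; apply: measurableT_comp => //; exact: continuous_measurable_fun.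
- exact: ae_norm.
Qed.

End scaled_chi2.

Lemma chi2_law_gamma {R : realType} m (A : set R) : (0 < m)%N -> measurable A ->
  @chi2_law R m A = gamma_law (m%:R / 2) (1 / 2) A.
Proof.
move=> m0 mA.
have h : has_law (@chi2_law R m) (fun x => x) (@chi2_law R m) by split.
have := scaled_chi2_law_gamma h ltr01 m0 mA; rewrite mulr1 => <-.
by congr (chi2_law m _); apply/seteqP; split => x /=; rewrite mul1r.
Qed.

(** * From random draws to words *)

Section draw_words.
Context {R : realType} {J : finType} {d : measure_display} {T : measurableType d}.
Variables (P : probability T R) (drawn : nat -> T -> J) (q : seq J -> J -> R).

(** Here [drawn m] stands for the draw at time [m.+1], so that the word at time [n] has
    [n] letters. *)
Fixpoint word (n : nat) (t : T) : seq J :=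
  if n is m.+1 then drawn m t :: word m t else [::].

Lemma size_word n t : size (word n t) = n.
Proof. by elim: n => //= n ->. Qed.

Hypothesis mword : forall n w, measurable [set t | word n t = w].
Hypothesis word_law : forall n w j, size w = n ->
  P [set t | word n.+1 t = j :: w] = ((q w j)%:E * P [set t | word n t = w])%E.

Let ind n (w : seq J) (t : T) : R := \1_[set t | word n t = w] t.

Let mind n w : measurable_fun setT (ind n w). Proof. exact: measurable_indic. Qed.

Let ind_sum n (f : seq J -> R) t :
  f (word n t) = \sum_(w : n.-tuple J) f w * ind n w t.
Proof.
have sw : size (word n t) == n by rewrite size_word.
rewrite (bigD1 (Tuple sw))//= big1 ?addr0.
  by rewrite /ind indicE mem_set// mulr1.
move=> w /eqP wn; rewrite /ind indicE memNset ?mulr0// => /= wE.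
by apply: wn; apply: val_inj; rewrite /= wE.
Qed.

Lemma measurable_word n (f : seq J -> R) : measurable_fun setT (fun t => f (word n t)).
Proof.
rewrite (_ : (fun _ => _) = (fun t => \sum_(w : n.-tuple J) f w * ind n w t)).
  by apply: measurable_sum => w; exact: measurable_funM.
by apply/funext => t; exact: ind_sum.
Qed.

Let word_integral_sum n (f : seq J -> R) : (\int[P]_t (f (word n t))%:E =
  (\sum_(w : n.-tuple J) f w * fine (P [set t | word n t = w]))%:E)%E.
Proof.
under eq_integral do rewrite ind_sum -sumEFin.
rewrite integral_sum//.
  rewrite -sumEFin; apply: eq_bigr => w _.
  under eq_integral do rewrite EFinM.
  rewrite integralZl//.
    by rewrite integral_indic// setIT EFinM fineK// fin_num_measure.
  apply: (@bounded_integrable _ _ _ P (ind n w) 1) => // t.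
  by rewrite /ind indicE; case: (_ \in _); rewrite ?normr0 ?normr1.
move=> w; apply: (@bounded_integrable _ _ _ P (fun t => f w * ind n w t) `|f w|) => //.
  exact: measurable_funM.
move=> t; rewrite normrM ler_piMr// /ind indicE.
by case: (_ \in _); rewrite ?normr0 ?normr1.
Qed.

Let big_cons_tuple n (G : seq J -> R) :
  \sum_(u : n.+1.-tuple J) G u = \sum_(w : n.-tuple J) \sum_j G (j :: w).
Proof.
rewrite pair_bigA/= (reindex (fun x : n.-tuple J * J => cons_tuple x.2 x.1))//=.
exists (fun u => (behead_tuple u, thead u)) => [[w j] _|u _] /=.
  by congr pair; apply: val_inj.
by rewrite [RHS](tuple_eta u); apply: val_inj.
Qed.

Lemma word_integral n (f : seq J -> R) :
  (\int[P]_t (f (word n t))%:E = (path_exp q n f)%:E)%E.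
Proof.
elim: n f => [|n IH] f.
  by rewrite /= integral_cst//= probability_setT mule1.
rewrite [path_exp _ _ _]/= -IH word_integral_sum.
rewrite (word_integral_sum n (fun w => \sum_j q w j * f (j :: w))); congr EFin.
rewrite (big_cons_tuple n (fun u => f u * fine (P [set t | word n.+1 t = u]))).
apply: eq_bigr => w _; rewrite mulr_suml; apply: eq_bigr => j _.
rewrite (word_law _ (size_tuple w)) fineM ?fin_num_measure//=.
by rewrite mulrA [f _ * _]mulrC.
Qed.

Lemma word_Rintegral n (f : seq J -> R) : \int[P]_t f (word n t) = path_exp q n f.
Proof. by rewrite /Rintegral word_integral. Qed.

End draw_words.

(** * The rescaled urn as a random word *)

Section urn.
Context {R : realType} {k : nat} {d : measure_display} {T : measurableType d}.
Variables (P : probability T R) (alpha beta : R) (b0 B0 : 'cV[R]_k).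
Variable xi : nat -> T -> 'cV[R]_k.
Hypothesis alpha_gt0 : 0 < alpha.
Hypothesis beta01 : 0 <= beta < 1.
Hypothesis urn : rescaled_polya_urn P alpha beta b0 B0 xi.
Hypothesis p0_gt0 : forall i, 0 < rp_p0 b0 i 0.
Variable drawn : nat -> T -> 'I_k.
Hypothesis drawnE : forall n t, xi n.+1 t = delta_mx (drawn n t) 0.

Notation b := (norm1 b0).
Notation p := (fun i => rp_p0 b0 i 0).
Notation B := (fun i => B0 i 0).
Notation q := (UrnPath.draw alpha beta b p B).
Notation word := (word drawn).

Let b_gt0 : 0 < b. Proof. exact: rp_b0_gt0 urn. Qed.
Let B_ge0 i : 0 <= B i. Proof. exact: rp_B0_ge0 urn i. Qed.

Lemma norm1_b0 : b = \sum_i b0 i 0.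
Proof. by apply: eq_bigr => i _; rewrite ger0_norm// (rp_b0_ge0 urn). Qed.

Lemma norm1_p0 i : b * p i = b0 i 0.
Proof. by rewrite /rp_p0 mxE mulrA mulfV ?mul1r// gt_eqF. Qed.

Lemma rp_p0_sum1 : \sum_i p i = 1.
Proof.
apply: (mulfI (lt0r_neq0 b_gt0)); rewrite mulr_sumr mulr1 [RHS]norm1_b0.
by apply: eq_bigr => i _; exact: norm1_p0.
Qed.

Lemma xi_drawn n t i : xi n.+1 t i 0 = (drawn n t == i)%:R.
Proof. by rewrite drawnE mxE andbT eq_sym. Qed.

Lemma rp_B_word n t i : rp_B alpha beta B0 xi n t i 0 = UrnPath.urnB alpha beta B (word n t) i.
Proof.
elim: n => [//|n IH] /=; rewrite !mxE -IH; congr (_ + _ * _).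
by rewrite xi_drawn.
Qed.

Lemma rp_psi_word n t i : rp_psi alpha beta b0 B0 xi n t i 0 = q (word n t) i.
Proof.
rewrite /UrnPath.draw norm1_p0 -rp_B_word mxE [X in _ * X]mxE mulrC; congr (_ / _).
rewrite -(UrnPath.urnB_sum alpha beta B (word n t)) [X in _ = X + _]norm1_b0 -big_split.
apply: eq_bigr => j _; rewrite ger0_norm /rp_N mxE rp_B_word//.
by rewrite addr_ge0 ?(rp_b0_ge0 urn)// UrnPath.urnB_ge0// ltW.
Qed.

Lemma rp_count_word N i t :
  rp_count xi N i t - N%:R * p i = UrnPath.centred p (word N t) i.
Proof.
rewrite /rp_count; elim: N => [|N IH].
  by rewrite big_geq//= mul0r subrr.
by rewrite big_nat_recr//= -IH xi_drawn -natr1; ring.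
Qed.

Let drawn_event n j : [set t | drawn n t = j] = [set t | xi n.+1 t j 0 = 1].
Proof.
apply/seteqP; split => t /=; rewrite xi_drawn; first by move=> ->; rewrite eqxx.
by case: eqP => // _ /eqP; rewrite eq_sym oner_eq0.
Qed.

Let word_cons n j w :
  [set t | word n.+1 t = j :: w] = [set t | drawn n t = j] `&` [set t | word n t = w].
Proof. by apply/seteqP; split => t /= [-> ->]. Qed.

Lemma filtration_word n w : size w = n -> rp_filtration xi n [set t | word n t = w].
Proof.
pose G n := [set A | exists m i Y, [/\ (1 <= m <= n)%N, measurable (Y : set R) &
                              A = (fun t => xi m t i 0) @^-1` Y]].
rewrite -[rp_filtration _ _]/(<<s G n >>).
have sub n' A : <<s G n' >> A -> <<s G n'.+1 >> A.
  apply: smallest_sub; first exact: smallest_sigma_algebra.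
  move=> B' [m [i [Y [/andP[m1 m2] mY ->]]]].
  by apply: sub_sigma_algebra; exists m, i, Y; rewrite m1 (leqW m2).
elim: n w => [|n IH] [|j w]//; first move=> _; last move=> [wn].
  rewrite (_ : [set _ | _] = setT); first exact: (@measurableT _ (g_sigma_algebraType (G 0%N))).
  by apply/seteqP; split.
rewrite word_cons; apply: (@measurableI _ (g_sigma_algebraType (G n.+1))); last first.
  exact: (sub n _ (IH w wn)).
rewrite drawn_event; apply: sub_sigma_algebra; exists n.+1, j, [set 1].
by split; rewrite ?leqnn.
Qed.

Lemma measurable_filtration n A : rp_filtration xi n A -> measurable A.
Proof.
apply: smallest_sub; first exact: sigma_algebra_measurable.
move=> _ [m [i [Y [/andP[m1 _] mY ->]]]].
by rewrite -[X in measurable X]setTI; exact: (rp_draw_measurable urn).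
Qed.

Lemma measurable_word_event n w : measurable [set t | word n t = w].
Proof.
have [wn|wn] := eqVneq (size w) n.
  exact: (measurable_filtration (filtration_word wn)).
rewrite (_ : [set _ | _] = set0); first exact: measurable0.
apply/seteqP; split => // t /= wE.
by move: wn; rewrite -wE size_word eqxx.
Qed.

(** The drawing probabilities are constant on the event that the past is [w]. *)
Lemma word_law n w j : size w = n ->
  P [set t | word n.+1 t = j :: w] = ((q w j)%:E * P [set t | word n t = w])%E.
Proof.
move=> wn; have [_ _ law] := rp_draw_law urn n j.
rewrite word_cons drawn_event -law; last exact: filtration_word.
rewrite -integral_cst//; last exact: measurable_word_event.
by apply: eq_integral => t; rewrite inE/= rp_psi_word => ->.
Qed.

Lemma urn_word_Rintegral n f : \int[P]_t f (word n t) = path_exp q n f.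
Proof. exact: word_Rintegral measurable_word_event word_law n f. Qed.

Lemma urn_word_integral n f : (\int[P]_t (f (word n t))%:E = (path_exp q n f)%:E)%E.
Proof. exact: word_integral measurable_word_event word_law n f. Qed.

Lemma urn_measurable_word n f : measurable_fun setT (fun t => f (word n t) : R).
Proof. exact: measurable_word measurable_word_event n f. Qed.

End urn.

(** * Almost sure convergence from summable expectations *)

Section ae_cvg0.
Context {R : realType} {d : measure_display} {T : measurableType d}.
Variables (P : probability T R) (f : nat -> T -> R) (C : R).

Lemma sum_inv_sqr_le n : \sum_(0 <= i < n) (i.+1%:R ^+ 2)^-1 <= 2 :> R.
Proof.
suff : \sum_(0 <= i < n) (i.+1%:R ^+ 2)^-1 <= 2 - 2 / n.+1%:R :> R.
  by move=> /le_trans; apply; rewrite gerBl divr_ge0.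
elim: n => [|n IH]; first by rewrite big_geq// divr1 subrr.
rewrite big_nat_recr//=; apply: (le_trans (lerD IH (lexx _))).
have x0 : 0 < n.+1%:R :> R by [].
rewrite -subr_ge0 -[n.+2%:R]natr1; set x := n.+1%:R : R in x0 *.
have x1 : 1 <= x by rewrite /x ler1n.
rewrite (_ : _ - _ = (x - 1) / (x ^+ 2 * (x + 1))); last first.
  by field; rewrite !gt_eqF//; lra.
by rewrite divr_ge0 ?subr_ge0// mulr_ge0 ?sqr_ge0//; lra.
Qed.

Hypothesis mf : forall n, measurable_fun setT (f n).
Hypothesis f_ge0 : forall n t, 0 <= f n t.
Hypothesis f_le : forall n, (\int[P]_t (f n.+1 t)%:E <= (C * (n.+1%:R ^+ 2)^-1)%:E)%E.

(** The sum of the series has a finite expectation, hence is almost surely finite, and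
    then the general term is at most the remainder. *)
Lemma ae_cvg0 : {ae P, forall t, f n t @[n --> \oo] --> (0 : R)}.
Proof.
pose g n t := (f n.+1 t)%:E.
have g0 n t : (0 <= g n t)%E by rewrite lee_fin.
have mg n : measurable_fun setT (g n) by exact/measurable_EFinP.
have C0 : 0 <= C.
  have : (0 <= (C * (1%:R ^+ 2)^-1)%:E)%E.
    by apply: le_trans (f_le 0); apply: integral_ge0 => t _; rewrite lee_fin.
  by rewrite lee_fin expr1n invr1 mulr1.
have int_le : (\int[P]_t (\sum_(n <oo) g n t) <= (C * 2)%:E)%E.
  rewrite integral_nneseries//; apply: lime_le.
    by apply: is_cvg_nneseries => n _ _; exact: integral_ge0.
  apply: nearW => n.
  apply: (@le_trans _ _ (\sum_(0 <= i < n) (C * (i.+1%:R ^+ 2)^-1)%:E)%E).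
    by apply: lee_sum => i _; exact: f_le.
  by rewrite sumEFin lee_fin -mulr_sumr ler_wpM2l// sum_inv_sqr_le.
have sg0 t : (0 <= \sum_(n <oo) g n t)%E by exact: nneseries_ge0.
have int : P.-integrable setT (fun t => (\sum_(n <oo) g n t)%E).
  apply/integrableP; split; first exact: ge0_emeasurable_sum.
  under eq_integral do rewrite gee0_abs//.
  exact: le_lt_trans int_le (ltry _).
apply: filterS (integrable_ae measurableT int) => t /(_ I) fin.
have tail : (\sum_(N <= n <oo) g n t)%E @[N --> \oo] --> 0%E.
  by apply: nneseries_tail_cvg => //; rewrite -ge0_fin_numE.
have : g n t @[n --> \oo] --> 0%E.
  apply: (squeeze_cvge _ (cvg_cst _) tail); apply: nearW => n; rewrite g0/=.
  have := @nneseries_lim_ge R (fun i => g i t) xpredT n n.+1 (fun i _ _ => g0 i t).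
  by rewrite big_nat1.
move=> /fine_cvgP[_ h]; rewrite -(cvg_shiftS (fun n => f n t)).
exact: h.
Qed.

End ae_cvg0.

(** * The limit theorems *)

Lemma expr4_cvg0 {R : realType} (u : nat -> R) :
  u n ^+ 4 @[n --> \oo] --> 0 -> u n @[n --> \oo] --> 0.
Proof.
move=> u4; apply/cvgrPdist_lt => e e0.
move/cvgrPdist_lt : u4 => /(_ (e ^+ 4) (exprn_gt0 _ e0)).
apply: filterS => n; rewrite !sub0r !normrN normrX.
by rewrite ltr_pXn2r// nnegrE// ltW.
Qed.

Section urn_limits.
Context {R : realType} {k : nat} {d : measure_display} {T : measurableType d}.
Variables (P : probability T R) (alpha beta : R) (b0 B0 : 'cV[R]_k).
Variable xi : nat -> T -> 'cV[R]_k.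
Hypothesis alpha_gt0 : 0 < alpha.
Hypothesis beta01 : 0 <= beta < 1.
Hypothesis urn : rescaled_polya_urn P alpha beta b0 B0 xi.
Hypothesis p0_gt0 : forall i, 0 < rp_p0 b0 i 0.

Notation b := (norm1 b0).
Notation p := (fun i => rp_p0 b0 i 0).
Notation B := (fun i => B0 i 0).
Notation q := (UrnPath.draw alpha beta b p B).
Notation lam := (UrnPath.lam alpha beta b).

Let b_gt0 : 0 < b. Proof. exact: rp_b0_gt0 urn. Qed.
Let B_ge0 i : 0 <= B i. Proof. exact: rp_B0_ge0 urn i. Qed.
Let p1 : \sum_i p i = 1. Proof. exact: rp_p0_sum1 urn. Qed.

Lemma urn_drawn : exists drawn : nat -> T -> 'I_k,
  forall n t, xi n.+1 t = delta_mx (drawn n t) 0.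
Proof.
have /choice[f fE] (nt : nat * T) : exists j, xi nt.1.+1 nt.2 = delta_mx j 0.
  exact: (rp_draw_basis urn).
by exists (fun n t => f (n, t)) => n t; exact: (fE (n, t)).
Qed.

(** The fourth moment of the centred count is of order [N ^+ 2], so that those of the
    centred frequencies are summable. *)
Theorem rp_count_ae_cvg i : {ae P, forall t,
  rp_count xi N i t / N%:R @[N --> \oo] --> rp_p0 b0 i 0}.
Proof.
have [drawn drawnE] := urn_drawn.
have [C C0 CP] := UrnPath.centred_pow4_le alpha_gt0 beta01 b_gt0 p0_gt0 p1 B_ge0 i.
pose f n (w : seq 'I_k) := (UrnPath.centred p w i / n%:R) ^+ 4.
have f0 n w : 0 <= f n w by rewrite /f (exprM _ 2 2) sqr_ge0.
have h := @ae_cvg0 _ _ _ P (fun n t => f n (word drawn n t)) C _ _ _.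
apply: filterS (h _ _ _) => [t /expr4_cvg0 ft0|n|n t|n].
- have lim : UrnPath.centred p (word drawn N t) i / N%:R + rp_p0 b0 i 0 @[N --> \oo]
      --> rp_p0 b0 i 0.
    by rewrite -[X in _ --> X]add0r; apply: cvgD => //; exact: cvg_cst.
  apply: cvg_trans lim; apply: near_eq_cvg; near=> N.
  have N0 : N%:R != 0 :> R by rewrite pnatr_eq0 -lt0n; near: N; exact: nbhs_infty_gt.
  by rewrite -(rp_count_word b0 drawnE); field.
- exact: (urn_measurable_word urn drawnE n (f n)).
- exact: f0.
- rewrite (urn_word_integral alpha_gt0 beta01 urn drawnE n.+1 (f n.+1)) lee_fin /f.
  have n0 : n.+1%:R != 0 :> R by rewrite pnatr_eq0.
  rewrite (_ : path_exp _ _ _ = (n.+1%:R ^+ 4)^-1 * path_exp q n.+1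
      (fun w => UrnPath.centred p w i ^+ 4)).
    have -> : C * (n.+1%:R ^+ 2)^-1 = (n.+1%:R ^+ 4)^-1 * (C * n.+1%:R ^+ 2) by field.
    by rewrite ler_wpM2l ?invr_ge0 ?exprn_ge0//; exact: CP.
  rewrite -(path_expZ q); apply: eq_path_exp => w _.
  by rewrite expr_div_n mulrC.
Unshelve. all: by end_near. Qed.

Lemma urn_chi2_laplace_cvg s : 0 <= s ->
  \int[P]_t expR (- (s * rp_chi2_stat b0 xi N t)) @[N --> \oo] -->
  expR (- (k.-1%:R / 2 * ln (1 + 2 * (lam * s)))).
Proof.
move=> s0; have [drawn drawnE] := urn_drawn.
have := UrnPath.centred_laplace_cvg alpha_gt0 beta01 b_gt0 p0_gt0 p1 B_ge0 s0.
rewrite card_ord; apply: cvg_trans; apply: near_eq_cvg; apply: nearW => N.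
rewrite -(urn_word_Rintegral alpha_gt0 beta01 urn drawnE); apply: eq_Rintegral => t _.
congr (expR (- _)); rewrite /rp_chi2_stat mulr_sumr mulr_sumr.
apply: eq_bigr => i _; rewrite (rp_count_word b0 drawnE) invfM.
by ring.
Qed.

Lemma measurable_rp_chi2_stat N : measurable_fun setT (rp_chi2_stat b0 xi N).
Proof.
have [drawn drawnE] := urn_drawn.
rewrite (_ : rp_chi2_stat b0 xi N =
    (fun t => \sum_i UrnPath.centred p (word drawn N t) i ^+ 2 / (N%:R * p i))).
  exact: (urn_measurable_word urn drawnE N
    (fun w => \sum_i UrnPath.centred p w i ^+ 2 / (N%:R * p i))).
by apply/funext => t; apply: eq_bigr => i _; rewrite (rp_count_word b0 drawnE).
Qed.

Lemma rp_chi2_stat_ge0 N t : 0 <= rp_chi2_stat b0 xi N t.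
Proof. by apply: sumr_ge0 => i _; rewrite divr_ge0 ?sqr_ge0// mulr_ge0// ltW. Qed.

Lemma rp_gammaE : rp_gamma alpha beta b0 = UrnPath.gam alpha beta b.
Proof. by rewrite /UrnPath.gam UrnPath.gainE// (norm1_b0 urn). Qed.

Lemma rp_lambdaE : rp_lambda beta (rp_gamma alpha beta b0) = lam.
Proof. by rewrite /rp_lambda rp_gammaE UrnPath.lamE. Qed.

End urn_limits.

Theorem theorem1p1 (R : realType) (k : nat) (d : measure_display)
    (T : measurableType d) (P : probability T R)
    (alpha beta : R) (b0 B0 : 'cV[R]_k) (xi : nat -> T -> 'cV[R]_k)
    (hk : (2 <= k)%N) (halpha : 0 < alpha) (hbeta : 0 <= beta < 1)
    (hurn : rescaled_polya_urn P alpha beta b0 B0 xi)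
    (hp0 : forall i, 0 < rp_p0 b0 i 0) :
  let gamma := rp_gamma alpha beta b0 in
  let lambda := rp_lambda beta gamma in
  [/\ beta < gamma < 1,
      1 < lambda,
      forall i, {ae P, forall t,
        rp_count xi N i t / N%:R @[N --> \oo] --> rp_p0 b0 i 0},
      forall A : set R, measurable A ->
        @chi2_law R k.-1 A = gamma_law (k.-1%:R / 2) (1 / 2) A &
      forall (d' : measure_display) (T' : measurableType d')
             (P' : probability T' R) (W0 : T' -> R),
        has_law P' W0 (@chi2_law R k.-1) ->
        cvg_in_distribution P (rp_chi2_stat b0 xi)
          P' (fun t => lambda * W0 t) /\
        has_law P' (fun t => lambda * W0 t)
          (gamma_law (k.-1%:R / 2) (1 / (2 * lambda)))].
Proof.
have b_gt0 : 0 < norm1 b0 := rp_b0_gt0 hurn.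
have k1 : (0 < k.-1)%N by rewrite -subn1 subn_gt0.
have lam1 : 1 < rp_lambda beta (rp_gamma alpha beta b0).
  by rewrite (rp_lambdaE halpha hbeta hurn); exact: UrnPath.lam_gt1.
have lam0 := lt_trans ltr01 lam1.
move=> gamma lambda; split => //.
- by rewrite /gamma (rp_gammaE halpha hbeta hurn); exact: UrnPath.gam_bounds.
- exact: rp_count_ae_cvg halpha hbeta hurn hp0.
- by move=> A mA; exact: chi2_law_gamma.
- move=> d' T' P' W0 lawW; split.
    apply: (laplace_cvg_scaled_chi2 lawW lam0).
    + exact: measurable_rp_chi2_stat hurn.
    + exact: rp_chi2_stat_ge0.
    + move=> s s0; rewrite /lambda /gamma (rp_lambdaE halpha hbeta hurn).
      exact: (urn_chi2_laplace_cvg halpha hbeta hurn hp0 s0).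
  split; first by case: lawW => mW _; exact: measurable_funM.
  by move=> A mA; exact: (scaled_chi2_law_gamma lawW lam0).
Qed.
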